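(* Let $u_0\in\mathcal{M}$. There exist positive constants $C_u$, $C_g$ and $C_\alpha$, with $C_\alpha\le 1$, depending only on $\mathcal{D}$, $d$, $\beta$, $V$, $\Omega$ and $\|u_0\|_{H_0^1}$, such that for any sequence of step sizes $\{\alpha_n\}_{n=0}^\infty$ satisfying $0<\alpha_{\min}\le\alpha_n\le\alpha_{\max}\le C_\alpha$, the sequence $\{u_n\}_{n=0}^\infty$ generated from $u_0$ by the $a_0$ scheme $$u_{n+1}=R\big(u_n-\alpha_n\nabla^{\mathcal{R}}_{a_0}E(u_n)\big)$$ satisfies, for all $n\ge 0$: (i) $\|u_n\|_{a_0}\le C_u$; (ii) $\|\nabla^{\mathcal{R}}_{a_0}E(u_n)\|_{a_0}\le\|\nabla_{a_0}E(u_n)\|_{a_0}\le C_g$; (iii) $E(u_n)-E(u_{n+1})\ge\frac{\alpha_{\min}}{2}\|\nabla^{\mathcal{R}}_{a_0}E(u_n)\|_{a_0}^2$.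
   Context: Setting: $\mathcal{D}\subseteq\mathbb{R}^d$ ($d=2,3$) is a bounded domain; points are written $r=(x,y)$ or $r=(x,y,z)$. $V\in L^\infty(\mathcal{D};\mathbb{R}_{\ge0})$, $\beta>0$, $\Omega\ge0$, $L_z=-\mathrm{i}(x\partial_y-y\partial_x)$. Standing assumption: there is a constant $K>0$ with $V(r)\ge\frac{1+K}{4}\Omega^2(x^2+y^2)$ for all $r\in\mathcal{D}$. All function spaces are complex valued; $(v,w)_{L^2}=\int_{\mathcal{D}}\overline{v}w\,dr$ and $\|v\|_{H_0^1}=\|\nabla v\|_{L^2}$. $\Re$ denotes the real part. Energy: $E(u)=\int_{\mathcal{D}}\big(\frac12|\nabla u|^2+\frac12V|u|^2+\frac\beta4|u|^4-\frac\Omega2\overline{u}L_zu\big)dr$ for $u\in H_0^1(\mathcal{D})$. Constraint manifold: $\mathcal{M}=\{u\in H_0^1(\mathcal{D};\mathbb{C}):\|u\|_{L^2}=1\}$. The real Fréchet derivative is $\langle E'(u),v\rangle=\Re(\nabla u,\nabla v)_{L^2}+\Re(Vu+\beta|u|^2u-\Omega L_zu,v)_{L^2}$. $a_0$ inner product: $(v,w)_{a_0}=\int_{\mathcal{D}}(\nabla\overline{v}\cdot\nabla w+V\overline{v}w-\Omega\overline{v}L_zw)\,dr$, with induced norm $\|\cdot\|_{a_0}$ (an inner product on $H_0^1(\mathcal{D})$ whose norm is equivalent to $\|\cdot\|_{H_0^1}$ under the standing assumption). With $X=a_0$: the Sobolev gradient $\nabla_XE(u)\in H_0^1(\mathcal{D})$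 is the unique function with $\Re(\nabla_XE(u),h)_X=\langle E'(u),h\rangle$ for all $h\in H_0^1(\mathcal{D})$; $\mathcal{G}_X$ is defined by $(\mathcal{G}_Xw,h)_X=(w,h)_{L^2}$ for all $h\in H_0^1(\mathcal{D})$; the projected gradient is $\nabla^{\mathcal{R}}_XE(u)=\mathcal{P}_{u,X}(\nabla_XE(u))$, where $\mathcal{P}_{u,X}w=w-\frac{\Re(w,\mathcal{G}_Xu)_X}{\|\mathcal{G}_Xu\|_X^2}\mathcal{G}_Xu$ is the $X$-orthogonal projection onto $T_u\mathcal{M}=\{v\in H_0^1(\mathcal{D}):\Re(u,v)_{L^2}=0\}$. Retraction: $R(v)=v/\|v\|_{L^2}$ for $v\in H_0^1(\mathcal{D})\setminus\{0\}$. *)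

(* Defs.v *)
From HB Require Import structures.
From mathcomp Require Import all_boot all_order all_algebra.
From mathcomp Require Import all_classical all_reals all_analysis.
From mathcomp Require Import complex.

Set Implicit Arguments.
Unset Strict Implicit.
Unset Printing Implicit Defensive.

Import Order.TTheory GRing.Theory Num.Theory.
Import numFieldNormedType.Exports.

Local Open Scope classical_set_scope.
Local Open Scope ring_scope.

(* The library has no Lebesgue measure on R^n: 'rV_n gets the sigma-algebra
   generated by the coordinates, and the measure is the n-fold product. *)

Definition measure_rV_display : measure_display -> measure_display.
Proof. exact. Qed.

Section measurable_rV.
Context {d} {T : sigmaRingType d}.
Variable n : nat.

Let coors : 'I_n -> 'rV[T]_n -> T := fun i x => x ord0 i.

Let rV_set0 : g_sigma_preimage coors set0.
Proof. exact: sigma_algebra0. Qed.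

Let rV_setC A : g_sigma_preimage coors A -> g_sigma_preimage coors (~` A).
Proof. exact: sigma_algebraC. Qed.

Let rV_bigcup (F : _^nat) : (forall i, g_sigma_preimage coors (F i)) ->
  g_sigma_preimage coors (\bigcup_i (F i)).
Proof. exact: sigma_algebra_bigcup. Qed.

HB.instance Definition _ := @isMeasurable.Build (measure_rV_display d)
  'rV[T]_n (g_sigma_preimage coors) rV_set0 rV_setC rV_bigcup.

End measurable_rV.

Section measurable_rV_lemmas.
Context d1 d2 (T1 : measurableType d1) (T2 : measurableType d2).

Lemma measurable_coord n (i : 'I_n) :
  measurable_fun [set: 'rV[T2]_n] (fun x : 'rV[T2]_n => x ord0 i).
Proof.
move=> _ Y mY; rewrite setTI; apply: sub_sigma_algebra => /=.
rewrite -bigcup_seq/=; exists i => /=; first by rewrite mem_index_enum.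
by exists Y => //; rewrite setTI.
Qed.

Lemma measurable_fun_rV n (f : T1 -> 'rV[T2]_n) :
  (forall i, measurable_fun [set: T1] (fun x => f x ord0 i)) ->
  measurable_fun [set: T1] f.
Proof.
move=> mf.
have sub : g_sigma_preimage (fun i x => f x ord0 i) `<=` @measurable _ T1.
  apply: smallest_sub; first exact: sigma_algebra_measurable.
  case: n => [|n] in f mf *; first by rewrite big_ord0.
  rewrite -bigcup_mkord_ord; apply: bigcup_sub => i Ii.
  by move=> A [B mB <-]; exact: mf.
move=> _ A mA; apply: sub.
rewrite (g_sigma_preimage_comp (fun i (x : 'rV[T2]_n) => x ord0 i) f).
by exists A.
Qed.

End measurable_rV_lemmas.

Section product_rV.
Context d (T : measurableType d) (R : realType) (n : nat).
Variable m1 : {sigma_finite_measure set T -> \bar R}.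
Variable m : {sigma_finite_measure set 'rV[T]_n -> \bar R}.

Definition cons_rV (p : T * 'rV[T]_n) : 'rV[T]_n.+1 :=
  \row_i (if unlift ord0 i is Some j then p.2 ord0 j else p.1).

Lemma measurable_cons_rV : measurable_fun setT cons_rV.
Proof.
apply: measurable_fun_rV => i.
case: (unliftP ord0 i) => [j ->|->].
- rewrite (_ : (fun x => _) = (fun x : 'rV[T]_n => x ord0 j) \o snd).
    apply: measurableT_comp; last exact: measurable_snd.
    exact: measurable_coord.
  by apply/funext => x; rewrite /= mxE liftK.
- rewrite (_ : (fun x => _) = fst); first exact: measurable_fst.
  by apply/funext => x; rewrite /= mxE unlift_none.
Qed.

HB.instance Definition _ :=
  isMeasurableFun.Build _ _ _ _ cons_rV measurable_cons_rV.

Definition uncons_rV (x : 'rV[T]_n.+1) : T * 'rV[T]_n :=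
  (x ord0 ord0, \row_j x ord0 (lift ord0 j)).

Lemma cons_rVK : cancel cons_rV uncons_rV.
Proof.
move=> [a x]; rewrite /uncons_rV mxE unlift_none; congr pair.
by apply/rowP => j; rewrite !mxE liftK.
Qed.

Lemma uncons_rVK : cancel uncons_rV cons_rV.
Proof.
move=> x; apply/rowP => i; rewrite mxE.
by case: (unliftP ord0 i) => [j ->|->] //=; rewrite mxE.
Qed.

Lemma measurable_uncons_rV : measurable_fun setT uncons_rV.
Proof.
apply: measurable_fun_pair => /=; first exact: measurable_coord.
apply: measurable_fun_rV => i; rewrite (_ : (fun x => _) =
  (fun x : 'rV[T]_n.+1 => x ord0 (lift ord0 i))); first exact: measurable_coord.
by apply/funext => x; rewrite mxE.
Qed.

Definition product_rV : set 'rV[T]_n.+1 -> \bar R :=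
  pushforward (m1 \x m)%E cons_rV.

Let product_rV0 : product_rV set0 = 0%E.
Proof. by rewrite /product_rV /pushforward preimage_set0 measure0. Qed.

Let product_rV_ge0 A : (0 <= product_rV A)%E.
Proof. exact: measure_ge0. Qed.

Let product_rV_sigma_additive : semi_sigma_additive product_rV.
Proof.
move=> F mF tF mUF; rewrite /product_rV /pushforward preimage_bigcup.
apply: measure_semi_sigma_additive.
- by move=> k; rewrite -[X in measurable X]setTI; exact: measurable_cons_rV.
- apply/trivIsetP => /= i j _ _ ij; rewrite -preimage_setI.
  by move/trivIsetP : tF => /(_ _ _ _ _ ij) ->//; rewrite preimage_set0.
- by rewrite -preimage_bigcup -[X in measurable X]setTI;
    exact: measurable_cons_rV.
Qed.

HB.instance Definition _ := isMeasure.Build _ _ _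
  product_rV product_rV0 product_rV_ge0 product_rV_sigma_additive.

Let product_rV_sigma_finite : sigma_finite setT product_rV.
Proof.
have /sigma_finiteP[F [TF ndF Foo]] := sigma_finiteT m1.
have /sigma_finiteP[G [TG ndG Goo]] := sigma_finiteT m.
exists (fun k => uncons_rV @^-1` (F k `*` G k)).
  apply/esym; rewrite -preimage_bigcup predeqE => x; split=> // _.
  have [i _ Fi] : (\bigcup_i F i) (uncons_rV x).1 by rewrite -TF.
  have [j _ Gj] : (\bigcup_i G i) (uncons_rV x).2 by rewrite -TG.
  exists (maxn i j) => //; split.
  - by move: Fi; exact/subsetPset/ndF/leq_maxl.
  - by move: Gj; exact/subsetPset/ndG/leq_maxr.
move=> k; have [mFk Fk] := Foo k; have [mGk Gk] := Goo k; split.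
  rewrite -[X in measurable X]setTI; apply: measurable_uncons_rV => //.
  exact: measurableX.
rewrite /product_rV /pushforward -comp_preimage.
rewrite (_ : uncons_rV \o cons_rV = id); last exact/funext/cons_rVK.
rewrite preimage_id.
rewrite [X in (X < _)%E](_ : _ = m1 (F k) * m (G k))%E.
  by rewrite lte_mul_pinfty// ge0_fin_numE.
exact: product_measure1E.
Qed.

HB.instance Definition _ := Measure_isSigmaFinite.Build _ _ _
  product_rV product_rV_sigma_finite.

End product_rV.

Fixpoint lebesgue_rV (R : realType) (n : nat) :
    {sigma_finite_measure set 'rV[measurableTypeR R]_n -> \bar R} :=
  match n with
  | 0 => @dirac _ 'rV[measurableTypeR R]_0 (\row_i 0) R
  | k.+1 => product_rV (@lebesgue_measure R) (lebesgue_rV R k)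
  end.

Section functions.
Context (R : realType) (n : nat).
Local Notation C := R[i].
Local Notation reC := (@complex.Re R).
Local Notation imC := (@complex.Im R).
Local Notation cabs := (@Normc.normc R).
Local Notation E := 'rV[R]_n.
(* Same type as E up to conversion; this form carries the sigma-algebra. *)
Local Notation mE := 'rV[measurableTypeR R]_n.
Local Notation mu := (lebesgue_rV R n).

Definition cintegral (D : set E) (f : E -> C) : C :=
  Complex (\int[mu]_(x in D) reC (f x)) (\int[mu]_(x in D) imC (f x)).

Definition cmeasurable (D : set E) (f : E -> C) : Prop :=
  @measurable_fun _ _ mE R D (fun x => reC (f x)) /\
  @measurable_fun _ _ mE R D (fun x => imC (f x)).

(* Elements of L^2(D; C) are represented by functions; integrals over D do not
   see the values outside D nor changes on null sets. *)
Definition L2 (D : set E) : set (E -> C) :=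
  [set f | cmeasurable D f /\
    (\int[mu]_(x in D) ((cabs (f x) ^+ 2)%:E) < +oo)%E].

Definition L2ip (D : set E) (v w : E -> C) : C :=
  cintegral D (fun x => conjc (v x) * w x).

Definition L2norm (D : set E) (v : E -> C) : R :=
  Num.sqrt (\int[mu]_(x in D) (cabs (v x) ^+ 2)).

Definition partial (i : 'I_n) (f : E -> R) : E -> R :=
  fun x => 'D_(delta_mx 0 i) f x.

Definition smooth (f : E -> R) : Prop :=
  forall s : seq 'I_n, let g := foldr partial f s in
    continuous g /\ forall i x, derivable g x (delta_mx 0 i).

(* C_c^oo(D; R) and C_c^oo(D; C) *)
Definition test_fun (D : set E) : set (E -> R) :=
  [set f | smooth f /\
    exists K : set E, [/\ compact K, K `<=` D & forall x, ~ K x -> f x = 0]].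

Definition ctest_fun (D : set E) : set (E -> C) :=
  [set f | test_fun D (fun x => reC (f x)) /\ test_fun D (fun x => imC (f x))].

Definition is_weak_partial (D : set E) (i : 'I_n) (u g : E -> C) : Prop :=
  forall phi, test_fun D phi ->
    cintegral D (fun x => u x * (partial i phi x)%:C%C) =
    - cintegral D (fun x => g x * (phi x)%:C%C).

Definition weak_partial (D : set E) (i : 'I_n) (u : E -> C) : E -> C :=
  xget (fun=> 0) [set g | L2 D g /\ is_weak_partial D i u g].

Definition H1 (D : set E) : set (E -> C) :=
  [set u | L2 D u /\ forall i, exists g, L2 D g /\ is_weak_partial D i u g].

Definition gradnorm (D : set E) (u : E -> C) : R :=
  Num.sqrt (\sum_(i < n) L2norm D (weak_partial D i u) ^+ 2).

Definition H1norm (D : set E) (u : E -> C) : R :=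
  Num.sqrt (L2norm D u ^+ 2 + gradnorm D u ^+ 2).

(* closure of C_c^oo(D; C) in H^1(D; C) *)
Definition H01 (D : set E) : set (E -> C) :=
  [set u | H1 D u /\ forall e : R, 0 < e ->
    exists2 phi, ctest_fun D phi & H1norm D (fun x => u x - phi x) < e].

Definition bounded_domain (D : set E) : Prop :=
  [/\ open D, connected D, D !=set0 & bounded_set D].

(* V in L^oo(D; R_{>= 0}) *)
Definition nonneg_Linfty (D : set E) (V : E -> R) : Prop :=
  [/\ @measurable_fun _ _ mE R D V,
      {ae mu, forall x, D x -> 0 <= V x}
    & exists M : R, {ae mu, forall x, D x -> V x <= M}].

Definition manifold (D : set E) : set (E -> C) :=
  [set u | H01 D u /\ L2norm D u = 1].

Definition retraction (D : set E) (v : E -> C) : E -> C :=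
  fun x => ((L2norm D v)^-1)%:C%C * v x.

End functions.

Section rotating_energy.
Context (R : realType) (n : nat).
Local Notation C := R[i].
Local Notation reC := (@complex.Re R).
Local Notation cabs := (@Normc.normc R).
(* The ambient dimension is n.+2; the theorem takes it to be 2 or 3. *)
Local Notation E := 'rV[R]_n.+2.
Local Notation mu := (lebesgue_rV R n.+2).
Local Notation toC r := (r%:C%C : C).

Definition ix : 'I_n.+2 := ord0.
Definition iy : 'I_n.+2 := lift ord0 ord0.

Definition trap_condition (D : set E) (V : E -> R) (Om : R) : Prop :=
  exists K : R, 0 < K /\
    {ae mu, forall r, D r ->
       (1 + K) / 4 * Om ^+ 2 * (r 0 ix ^+ 2 + r 0 iy ^+ 2) <= V r}.

Definition Lz (D : set E) (u : E -> C) : E -> C := fun r =>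
  - 'i%C * (toC (r 0 ix) * weak_partial D iy u r -
            toC (r 0 iy) * weak_partial D ix u r).

Variables (D : set E) (V : E -> R) (beta Om : R).

(* pointwise value of \nabla \bar v . \nabla w *)
Definition graddot (v w : E -> C) : E -> C := fun r =>
  \sum_(i < n.+2) conjc (weak_partial D i v r) * weak_partial D i w r.

(* The integral is real for u in H_0^1 because L_z is symmetric there; reC only
   changes the type from C to R. *)
Definition energy (u : E -> C) : R := reC (cintegral D (fun r =>
  toC (1 / 2) * graddot u u r
  + toC (1 / 2 * V r * cabs (u r) ^+ 2)
  + toC (beta / 4 * cabs (u r) ^+ 4)
  - toC (Om / 2) * conjc (u r) * Lz D u r)).

Definition denergy (u v : E -> C) : R :=
  reC (cintegral D (graddot u v)) +
  reC (L2ip D (fun r => toC (V r) * u r + toC (beta * cabs (u r) ^+ 2) * u r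
                       - toC Om * Lz D u r) v).

Definition a0ip (v w : E -> C) : C := cintegral D (fun r =>
  graddot v w r + toC (V r) * conjc (v r) * w r
  - toC Om * conjc (v r) * Lz D w r).

Definition a0norm (v : E -> C) : R := Num.sqrt (reC (a0ip v v)).

(* The defining conditions of [sobolev_grad] and [a0_green] determine their
   values up to equality a.e. in D, by the Riesz representation theorem. *)
Definition sobolev_grad (u : E -> C) : E -> C :=
  xget (fun=> 0) [set g | H01 D g /\
    forall h, H01 D h -> reC (a0ip g h) = denergy u h].

Definition a0_green (w : E -> C) : E -> C :=
  xget (fun=> 0) [set g | H01 D g /\
    forall h, H01 D h -> a0ip g h = L2ip D w h].

Definition tangent_proj (u w : E -> C) : E -> C := fun r =>
  w r - toC (reC (a0ip w (a0_green u)) / a0norm (a0_green u) ^+ 2)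
        * a0_green u r.

Definition riemannian_grad (u : E -> C) : E -> C :=
  tangent_proj u (sobolev_grad u).

Definition a0_step (alpha : R) (u : E -> C) : E -> C :=
  retraction D (fun r => u r - toC alpha * riemannian_grad u r).

End rotating_energy.

(* Main.v *)
Require Import Defs.
From HB Require Import structures.
From mathcomp Require Import all_boot all_order all_algebra.
From mathcomp Require Import all_classical all_reals all_analysis.
From mathcomp Require Import complex measurable_realfun.
From mathcomp Require Import ring lra.
Import Order.TTheory GRing.Theory Num.Theory.
Import numFieldNormedType.Exports.
Local Open Scope classical_set_scope.
Local Open Scope ring_scope.

Set Implicit Arguments.
Unset Strict Implicit.

(** Write [A] for the real form [Aform] of the [a0] inner product and [p] for the
    projected gradient at [u].  The derivative of the energy in the direction [p]
    is [A p p].  In dimension 2 or 3 the space H01 embeds in L4, which bounds the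
    quartic part of the energy along the line [u - a p], so the energy there is at
    most [E u - a * A p p + M * a ^+ 2 * A p p] for [a <= 1], with [M] depending only on upper
    bounds for [A u u] and for the square norm of the Sobolev gradient.  As [p] is
    tangent to the sphere, [u - a p] has L2 norm at least 1, so the retraction
    multiplies it by a factor in [0, 1] and does not increase the energy.  Hence
    [a * M <= 1 / 2] yields the decrease [a / 2 * A p p].  Since [A u u <= 2 * E u]
    and [A u u] bounds the Sobolev gradient, all bounds are controlled by the initial
    energy, and they persist along the iteration. *)

(** * Square-integrable real functions *)

(** The Sobolev gradient, the Green function and weak derivatives are picked by [xget], which
    returns the zero function when no candidate exists. Nothing can be said of the scheme before
    existence is shown, hence the completeness of [H01] and the Riesz theorem for [Aform]. Weak
    derivatives are fixed only up to null sets, so linearity and all other identities for them go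
    through the fundamental lemma of the calculus of variations, tested on products of
    one-dimensional bumps. Integral inequalities are proved for test functions, where lines and
    slices make sense, and reach [H01] by density, with Fatou's lemma for the quartic term. The
    rotation term has no sign. Completing squares against the trap absorbs it into the potential and
    the fraction [1 / (1 + K)] of the squared gradient norm, which leaves coercivity with constant
    [K / (1 + K)]. Symmetry of [Aform] rests on that of [Lz], an integration by parts in which no
    coordinate factor is ever differentiated. The initial function enters the constants only through
    its gradient norm [rho], which bounds [Aform] by the Poincaré inequality and hence the initial
    energy. *)

Lemma aeS d (T : measurableType d) (R : realType) (mu : {measure set T -> \bar R})
  (P Q : T -> Prop) : (forall x, P x -> Q x) ->
  {ae mu, forall x, P x} -> {ae mu, forall x, Q x}.
Proof. by move=> PQ; apply: filterS. Qed.

Lemma aeS2 d (T : measurableType d) (R : realType) (mu : {measure set T -> \bar R})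
  (P Q S : T -> Prop) : (forall x, P x -> Q x -> S x) ->
  {ae mu, forall x, P x} -> {ae mu, forall x, Q x} -> {ae mu, forall x, S x}.
Proof. by move=> PQ; apply: filterS2. Qed.

Lemma indic_split (T : Type) (R : pzRingType) (X Y B : set T) (x : T) : Y `<=` X ->
  \1_(X `&` B) x = \1_((X `\` Y) `&` B) x + \1_(Y `&` B) x :> R.
Proof.
move=> YX; rewrite !indicE.
have e A : (x \in A `&` B) = (x \in A) && (x \in B) by rewrite in_setI.
have e' : (x \in X `\` Y) = (x \in X) && (x \notin Y) by rewrite in_setD.
have : (x \in Y) ==> (x \in X) by apply/implyP; rewrite !inE; exact: YX.
rewrite !e e'.
by case: (x \in X); case: (x \in Y); case: (x \in B) => //= _; rewrite ?addr0 ?add0r.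
Qed.

(** The minimizer [- b / c] gives the claim when [c] is positive; when [c] is 0 a nonnegative affine
    function has no slope. Every Cauchy-Schwarz inequality below is an instance. *)
Lemma discr_le (R : realFieldType) (a b c : R) : 0 <= c ->
  (forall t, 0 <= a + 2 * b * t + c * t ^+ 2) -> b ^+ 2 <= a * c.
Proof.
rewrite le_eqVlt => /predU1P[<-|c0] h.
  have [->|b0] := eqVneq b 0; first by rewrite expr0n/= mulr0.
  have := h (- (a + 1) / (2 * b)); rewrite mul0r addr0.
  have -> : 2 * b * (- (a + 1) / (2 * b)) = - (a + 1) by field.
  by move=> ?; exfalso; lra.
have := h (- b / c).
have -> : a + 2 * b * (- b / c) + c * (- b / c) ^+ 2 = (a * c - b ^+ 2) / c.
  by field; rewrite gt_eqF.
by rewrite pmulr_lge0 ?invr_gt0// subr_ge0.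
Qed.

Section square_integrable.
Context d (T : measurableType d) (R : realType) (mu : {measure set T -> \bar R}).
Variable D : set T.
Hypothesis mD : measurable D.
Implicit Types f g h : T -> R.

Local Notation intble f := (mu.-integrable D (EFin \o (f : T -> R))).

Definition sqintegrable f :=
  measurable_fun D f /\ intble (fun x => f x ^+ 2).

Definition rip f g : R := \int[mu]_(x in D) (f x * g x).

Lemma integrable_le_real f g : measurable_fun D f ->
  (forall x, D x -> `|f x| <= g x) -> intble g -> intble f.
Proof.
move=> mf fg ig; apply: (le_integrable mD _ _ ig).
  exact/measurable_EFinP.
move=> x Dx /=; rewrite lee_fin (le_trans (fg x Dx))//; exact: ler_norm.
Qed.

Lemma integrable_real_measurable f : intble f -> measurable_fun D f.
Proof. by move=> /measurable_int /measurable_EFinP. Qed.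

Lemma integrableD_real f g : intble f -> intble g -> intble (fun x => f x + g x).
Proof. by move=> fi gi; exact: (integrableD mD fi gi). Qed.

Lemma integrableZ_real (k : R) f : intble f -> intble (fun x => k * f x).
Proof. by move=> fi; exact: (integrableZl mD k fi). Qed.

Lemma sqintegrableP f : measurable_fun D f ->
  (\int[mu]_(x in D) ((f x ^+ 2)%:E) < +oo)%E -> sqintegrable f.
Proof.
move=> mf fo; split => //; apply/integrableP; split.
  by apply/measurable_EFinP; exact: measurable_funX.
rewrite (eq_integral (fun x => (f x ^+ 2)%:E))// => x _ /=.
by rewrite ger0_norm// sqr_ge0.
Qed.

Lemma sqintegrableM f g : sqintegrable f -> sqintegrable g ->
  intble (fun x => f x * g x).
Proof.
move=> [mf f2] [mg g2]; apply: (@integrable_le_real _ (fun x => f x ^+ 2 + g x ^+ 2)).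
- exact: measurable_funM.
- move=> x Dx; rewrite ler_norml; apply/andP; split; nra.
- exact: integrableD_real.
Qed.

Lemma sqintegrableD f g : sqintegrable f -> sqintegrable g ->
  sqintegrable (fun x => f x + g x).
Proof.
move=> [mf f2] [mg g2]; split; first exact: measurable_funD.
apply: (@integrable_le_real _ (fun x => 2 * (f x ^+ 2 + g x ^+ 2))).
- by apply: measurable_funX; exact: measurable_funD.
- by move=> x Dx; rewrite ger0_norm ?sqr_ge0//; have := sqr_ge0 (f x - g x); nra.
- by apply: integrableZ_real; exact: integrableD_real.
Qed.

Lemma integrable_le_ae f g : measurable_fun D f ->
  {ae mu, forall x, D x -> `|f x| <= g x} -> intble g -> intble f.
Proof.
move=> mf fg /[dup] ig /integrableP[mg gfin]; apply/integrableP; split.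
  exact/measurable_EFinP.
apply: le_lt_trans gfin; apply: ae_ge0_le_integral => //.
- by apply: measurableT_comp => //; exact/measurable_EFinP.
- exact: measurableT_comp.
- apply: aeS fg => x h Dx; rewrite /= lee_fin (le_trans (h Dx))//; exact: ler_norm.
Qed.

Lemma sqintegrableMb_ae (b f : T -> R) (M : R) : measurable_fun D b ->
  {ae mu, forall x, D x -> `|b x| <= M} ->
  sqintegrable f -> sqintegrable (fun x => b x * f x).
Proof.
move=> mb bM [mf f2]; split; first exact: measurable_funM.
apply: (@integrable_le_ae _ (fun x => M ^+ 2 * f x ^+ 2)).
- by apply: measurable_funX; exact: measurable_funM.
- apply: aeS bM => x bM Dx; rewrite ger0_norm ?sqr_ge0// exprMn ler_wpM2r ?sqr_ge0//.
  have := bM Dx => h.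
  by rewrite -[b x ^+ 2]real_normK ?num_real// lerXn2r ?nnegrE// ?(le_trans _ h).
- exact: integrableZ_real.
Qed.

Lemma sqintegrableZ (k : R) f : sqintegrable f -> sqintegrable (fun x => k * f x).
Proof.
by move=> fi; apply: (@sqintegrableMb_ae (fun=> k) f `|k| (measurable_cst _) _ fi); exact: aeW.
Qed.

Lemma sqintegrableN f : sqintegrable f -> sqintegrable (fun x => - f x).
Proof.
move=> fi; have := sqintegrableZ (-1) fi.
by congr sqintegrable; apply/funext => x /=; rewrite mulN1r.
Qed.

Lemma sqintegrableB f g : sqintegrable f -> sqintegrable g ->
  sqintegrable (fun x => f x - g x).
Proof. by move=> fi gi; apply: sqintegrableD => //; exact: sqintegrableN. Qed.

Lemma rip_sqr f : rip f f = \int[mu]_(x in D) (f x ^+ 2).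
Proof. by []. Qed.

Lemma ripC f g : rip f g = rip g f.
Proof. by apply: eq_Rintegral => x _; rewrite mulrC. Qed.

Lemma ripDl f g h : sqintegrable f -> sqintegrable g -> sqintegrable h ->
  rip (fun x => f x + g x) h = rip f h + rip g h.
Proof.
move=> fi gi hi; rewrite /rip -RintegralD//; try exact: sqintegrableM.
by apply: eq_Rintegral => x _; rewrite mulrDl.
Qed.

Lemma ripZl k f g : sqintegrable f -> sqintegrable g ->
  rip (fun x => k * f x) g = k * rip f g.
Proof.
move=> fi gi; rewrite /rip -RintegralZl//; last exact: sqintegrableM.
by apply: eq_Rintegral => x _; rewrite mulrA.
Qed.

Lemma rip_ge0 f : 0 <= rip f f.
Proof. by apply: Rintegral_ge0 => x _; rewrite -expr2 sqr_ge0. Qed.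

Lemma rip_sqrD t f g : sqintegrable f -> sqintegrable g ->
  rip (fun x => f x + t * g x) (fun x => f x + t * g x) =
  rip f f + 2 * rip f g * t + rip g g * t ^+ 2.
Proof.
move=> fi gi; have ti := sqintegrableZ t gi.
have fti := sqintegrableD fi ti.
rewrite ripDl// ripZl// [rip f _]ripC [rip g _]ripC !ripDl// !ripZl// [rip g f]ripC.
ring.
Qed.

Lemma rip_CS f g : sqintegrable f -> sqintegrable g ->
  rip f g ^+ 2 <= rip f f * rip g g.
Proof.
move=> fi gi; apply: discr_le; first exact: rip_ge0.
by move=> t; rewrite -rip_sqrD// rip_ge0.
Qed.

Lemma eq_rip_ae f f' g : sqintegrable f -> sqintegrable f' -> sqintegrable g ->
  {ae mu, forall x, D x -> f x = f' x} -> rip f g = rip f' g.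
Proof.
move=> fi fi' gi ff'; rewrite /rip /Rintegral; congr fine.
apply: ae_eq_integral => //.
- exact: (measurable_int _ (sqintegrableM fi gi)).
- exact: (measurable_int _ (sqintegrableM fi' gi)).
- by apply: filterS ff' => x /= xx Dx; rewrite xx.
Qed.

Hypothesis finD : (mu D < +oo)%E.

Lemma integrable_cst_real (k : R) : intble (fun=> k).
Proof.
apply: measurable_bounded_integrable => //.
exact: bounded_cst.
Qed.

Lemma sqintegrable_integrable f : sqintegrable f -> intble f.
Proof.
move=> [mf f2]; apply: (@integrable_le_real _ (fun x => f x ^+ 2 + 1)) => //.
  by move=> x Dx; rewrite ler_norml; apply/andP; split; nra.
apply: integrableD_real => //; exact: integrable_cst_real.
Qed.

Let geo (k : nat) : R := (2^-1) ^+ k.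

(* [2 |g_k| <= 2^k g_k^2 + 2^-k], so the weighted sum converges in [L^1] since [mu D] is finite. *)
Lemma ae_cvg_series_norm (g : nat -> T -> R) : (forall k, sqintegrable (g k)) ->
  (forall k, rip (g k) (g k) <= geo k ^+ 2) ->
  {ae mu, forall x, D x -> cvgn (series (fun k => `|g k x|))}.
Proof.
move=> gi gk.
have mg k : measurable_fun D (fun x => `|g k x|%:E).
  apply/measurable_EFinP; apply: measurableT_comp => //; exact: (gi k).1.
have geo0 k : 0 < geo k by rewrite exprn_gt0// invr_gt0.
have L1 k : (\int[mu]_(x in D) `|g k x|%:E <= ((1 + fine (mu D)) * geo k)%:E)%E.
  have i2 := integrableD_real (integrableZ_real ((geo k)^-1) (gi k).2)
     (integrable_cst_real (geo k)).
  apply: (@le_trans _ _ (\int[mu]_(x in D) ((geo k)^-1 * g k x ^+ 2 + geo k)%:E)%E).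
    apply: ge0_le_integral => //.
    - exact: (measurable_int _ i2).
    - move=> x Dx; rewrite lee_fin.
      set e := geo k; have e0 : 0 < e := geo0 k.
      rewrite -(ler_pM2l e0) mulrDr mulrA divff ?gt_eqF// mul1r.
      have := sqr_ge0 (`|g k x| - e); have := sqr_ge0 (g k x).
      rewrite -[g k x ^+ 2]real_normK ?num_real//; have := normr_ge0 (g k x); nra.
  rewrite -[X in (X <= _)%E]fineK; last exact: (integrable_fin_num _ i2).
  rewrite lee_fin -[X in X <= _]/(\int[mu]_(x in D) ((geo k)^-1 * g k x ^+ 2 + geo k)).
  rewrite RintegralD//; last 2 first.
    exact: (integrableZ_real _ (gi k).2).
    exact: integrable_cst_real.
  rewrite RintegralZl//; last exact: (gi k).2.
  rewrite Rintegral_cst// mulrDl mul1r [X in _ + X]mulrC lerD2r.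
  rewrite ler_pdivrMl ?geo0// -expr2; exact: gk.
have fin : (\int[mu]_(x in D) \sum_(0 <= k <oo) `|g k x|%:E < +oo)%E.
  rewrite integral_nneseries//.
  apply: (@le_lt_trans _ _ (\sum_(0 <= k <oo) ((1 + fine (mu D)) * geo k)%:E)%E).
    apply: lee_nneseries => [n _ _|n _]; [exact: integral_ge0|exact: L1].
  have cv : cvgn (series (geometric (1 + fine (mu D)) (2^-1))).
    apply: is_cvg_geometric_series; rewrite ger0_norm; lra.
  rewrite (_ : (fun _ => _) = EFin \o series (geometric (1 + fine (mu D)) (2^-1))).
    by rewrite EFin_lim// ltry.
  by apply/funext => m /=; rewrite sumEFin.
have : mu.-integrable D (fun x => \sum_(0 <= k <oo) `|g k x|%:E)%E.
  apply/integrableP; split.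
    exact: ge0_emeasurable_sum.
  under eq_integral do rewrite gee0_abs ?nneseries_ge0//.
  exact: fin.
move=> /(integrable_ae mD); apply: filterS => x /= xx Dx.
apply: nnseries_is_cvg => //.
by rewrite -ge0_fin_numE ?xx// nneseries_ge0.
Qed.

(** The terms of a convergent series tend to 0. The geometric rate gives convergence of the whole
    sequence, so no subsequence has to be extracted. *)
Lemma ae_cvg0 (g : nat -> T -> R) : (forall k, sqintegrable (g k)) ->
  (forall k, rip (g k) (g k) <= geo k ^+ 2) ->
  {ae mu, forall x, D x -> g ^~ x @ \oo --> 0}.
Proof.
move=> gi gk; apply: filterS (ae_cvg_series_norm gi gk) => x /= xx Dx.
apply/norm_cvg0P; exact: (cvg_series_cvg_0 (xx Dx)).
Qed.

Lemma Rintegral_le_fin f (e : R) : intble f ->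
  (\int[mu]_(x in D) (f x)%:E <= e%:E)%E -> \int[mu]_(x in D) f x <= e.
Proof.
by move=> fi; rewrite -[X in (X <= _)%E]fineK ?lee_fin//; exact: (integrable_fin_num _ fi).
Qed.

Lemma Rintegral_EFin f : intble f ->
  (\int[mu]_(x in D) (f x)%:E)%E = (\int[mu]_(x in D) f x)%:E.
Proof. by move=> fi; rewrite fineK//; exact: (integrable_fin_num _ fi). Qed.

(** The limit [G] is nonnegative only almost everywhere, hence the absolute value; in this form the
    bound also yields integrability of [G]. The lower limit sees only the tail of the integrals, so
    an eventual bound is enough. *)
Lemma fatou_real (F : nat -> T -> R) (G : T -> R) (e : R) :
  (forall m, measurable_fun D (F m)) -> (forall m x, D x -> 0 <= F m x) ->
  measurable_fun D G -> {ae mu, forall x, D x -> F ^~ x @ \oo --> G x} ->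
  (exists M, forall m, (M <= m)%N -> (\int[mu]_(x in D) (F m x)%:E <= e%:E)%E) ->
  (\int[mu]_(x in D) `|G x|%:E <= e%:E)%E.
Proof.
move=> mF F0 mG FG [M Me].
have mF' m : measurable_fun D (fun x => (F m x)%:E) by exact/measurable_EFinP.
have F0' m x : D x -> (0 <= (F m x)%:E)%E by move=> Dx; rewrite lee_fin F0.
apply: (@le_trans _ _ (\int[mu]_(x in D) limn_einf (fun m => (F m x)%:E))%E).
  apply: ae_ge0_le_integral => //.
  - by apply/measurable_EFinP; exact: measurableT_comp.
  - move=> x Dx; rewrite limn_einf_lim; apply: lime_ge; first exact: is_cvg_einfs.
    near=> n; apply: le_ereal_inf_tmp => _ [k /= nk <-]; exact: F0'.
  - under eq_fun do rewrite limn_einf_lim.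
    apply: (emeasurable_fun_cvg (fun n x => einfs (fun m => (F m x)%:E) n)).
      move=> n; exact: (measurable_fun_einfs (f := fun m x => (F m x)%:E)).
    move=> x Dx; exact: is_cvg_einfs.
  - apply: filterS FG => x /= xx Dx.
    have FGx := xx Dx.
    have : (fun m => (F m x)%:E) @ \oo --> (G x)%:E by apply/fine_cvgP; split; [exact: nearW|exact:
      FGx].
    move/cvg_limn_einf_sup => [-> _].
    rewrite lee_fin ger0_norm//; rewrite -(cvg_lim _ FGx)//.
    apply: limr_ge; first by apply/cvg_ex; exists (G x).
    by near=> n; exact: F0.
apply: (le_trans (fatou mu mD (f := fun m x => (F m x)%:E) mF' F0')).
rewrite limn_einf_lim; apply: lime_le; first exact: is_cvg_einfs.
near=> n; apply: ereal_inf_le; exists (\int[mu]_(x in D) (F n x)%:E)%E.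
  by exists n => /=.
by apply: Me; near: n; exists M.
Unshelve. all: by end_near. Qed.

(** Riesz-Fischer: a subsequence with geometric increments converges almost everywhere, and Fatou's
    lemma carries the Cauchy bound between [f k] and the subsequence over to the limit. *)
Lemma rip_complete (f : nat -> T -> R) : (forall k, sqintegrable (f k)) ->
  (forall e : R, 0 < e -> exists N, forall j k, (N <= j)%N -> (N <= k)%N ->
    rip (fun x => f j x - f k x) (fun x => f j x - f k x) <= e) ->
  exists2 g, sqintegrable g &
    forall e : R, 0 < e -> exists N, forall k, (N <= k)%N ->
      rip (fun x => f k x - g x) (fun x => f k x - g x) <= e.
Proof.
move=> fi cf.
have geo0 k : 0 < geo k by rewrite exprn_gt0// invr_gt0.
have /choice[N HN] : forall m, exists N, forall j k, (N <= j)%N -> (N <= k)%N ->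
    rip (fun x => f j x - f k x) (fun x => f j x - f k x) <= geo m ^+ 2.
  by move=> m; apply: cf; rewrite exprn_gt0.
(* The indices [s m] are nondecreasing and dominate both [N m] and [m]. The first bound makes
   consecutive increments geometric; the second lets a Cauchy threshold be passed to the
   subsequence. *)
pose s := fix s m := if m is m'.+1 then maxn (s m') (maxn (N m) m) else N 0%N.
have sN m : (N m <= s m)%N.
  by case: m => //= m; rewrite !leq_max leqnn !orbT.
have sm m : (m <= s m)%N by case: m => //= m; rewrite !leq_max leqnn !orbT.
have sS m : (s m <= s m.+1)%N by exact: leq_maxl.
have gi m : sqintegrable (fun x => f (s m.+1) x - f (s m) x).
  exact: sqintegrableB.
have := ae_cvg_series_norm gi.
move=> /(_ _)[m|]; first by apply: HN; rewrite ?(leq_trans _ (sS m)).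
move=> Z [mZ Z0 subZ].
have cvZ x : D x -> ~ Z x -> cvgn (fun m => f (s m) x).
  move=> Dx nZ.
  have : cvgn (series (fun m => `|f (s m.+1) x - f (s m) x|)).
    by apply: contrapT => nc; apply: nZ; apply: subZ => /= /(_ Dx).
  move=> cv.
  have -> : (fun m => f (s m) x) =
     (fun m => f (s 0%N) x + series (fun m => f (s m.+1) x - f (s m) x) m).
    apply/funext => m; rewrite seriesEnat/= telescope_sumr//; ring.
  apply: is_cvgD; first exact: is_cvg_cst.
  by apply: normed_cvg; exact: cv.
(* Killing the exceptional null set makes the sequence converge at every point of [D], so that the
   pointwise limit [g] is measurable. *)
pose h m x := f (s m) x * \1_(~` Z) x.
pose g x := limn (fun m => h m x).
have hg x : D x -> (fun m => h m x) @ \oo --> g x.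
  move=> Dx; rewrite /g /h; have [Zx|nZx] := pselect (Z x).
    rewrite (_ : (fun m => _) = (fun=> 0)); first exact: is_cvg_cst.
    by apply/funext => m; rewrite indicE memNset ?mulr0//=; apply.
  rewrite (_ : (fun m => _) = (fun m => f (s m) x)); first exact: cvZ.
  by apply/funext => m; rewrite indicE mem_set ?mulr1.
have mh m : measurable_fun D (h m).
  apply: measurable_funM; first exact: (fi _).1.
  exact/measurable_indic/measurableC.
have mg : measurable_fun D g by exact: (measurable_fun_cvg mh).
have fs m : {ae mu, forall x, D x -> f (s m) x = h m x}.
  exists Z; split => // x /= nx; apply: contrapT => nZ; apply: nx => Dx.
  by rewrite /h indicE mem_set ?mulr1.
have mhk k m : measurable_fun D (fun x => (f k x - h m x) ^+ 2).
  by apply: measurable_funX; apply: measurable_funB => //; exact: (fi _).1.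
have main e : 0 < e -> exists M, forall k, (M <= k)%N ->
    (\int[mu]_(x in D) `|(f k x - g x) ^+ 2|%:E <= e%:E)%E.
  move=> e0; have [M HM] := cf e e0; exists M => k Mk.
  apply: (@fatou_real (fun m x => (f k x - h m x) ^+ 2)) => //.
  - by move=> m x _; rewrite sqr_ge0.
  - by apply: measurable_funX; apply: measurable_funB => //; exact: (fi _).1.
  - apply: aeW => x Dx; rewrite expr2; under eq_fun do rewrite expr2.
    by apply: cvgM; (apply: cvgB; [exact: cvg_cst|exact: hg]).
  - exists M => m Mm.
    have -> : (\int[mu]_(x in D) ((f k x - h m x) ^+ 2)%:E =
      \int[mu]_(x in D) ((f k x - f (s m) x) ^+ 2)%:E)%E.
      apply: ae_eq_integral => //.
      - exact/measurable_EFinP.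
      - exact: (measurable_int _ (sqintegrableB (fi k) (fi (s m))).2).
      - by apply: filterS (fs m) => x /= xx Dx; rewrite xx.
    rewrite Rintegral_EFin; last exact: (sqintegrableB (fi k) (fi (s m))).2.
    by rewrite lee_fin; apply: HM => //; exact: leq_trans (sm m).
have gi' : sqintegrable g.
  have [M HM] := main 1 ltr01.
  (* Square integrability of [g] is read off the bound 1 on the distance from [f M] to [g]. *)
  have -> : g = (fun x => f M x - (f M x - g x)) by apply/funext => x; ring.
  apply: sqintegrableB => //; apply: sqintegrableP.
    by apply: measurable_funB => //; exact: (fi _).1.
  apply: le_lt_trans (ltry 1); apply: le_trans (HM M (leqnn _)).
  apply: ge0_le_integral => //.
  - by move=> x _; rewrite lee_fin sqr_ge0.
  - by apply/measurable_EFinP/measurable_funX/measurable_funB => //; exact: (fi _).1.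
  - apply/measurable_EFinP; apply: measurableT_comp => //.
    by apply: measurable_funX; apply: measurable_funB => //; exact: (fi _).1.
  - by move=> x _; rewrite lee_fin ler_norm.
exists g => // e /main[M HM]; exists M => k Mk.
rewrite rip_sqr; apply: Rintegral_le_fin; first exact: (sqintegrableB (fi k) gi').2.
apply: le_trans (HM k Mk); apply: ge0_le_integral => //.
- by move=> x _; rewrite lee_fin sqr_ge0.
- exact: (measurable_int _ (sqintegrableB (fi k) gi').2).
- apply/measurable_EFinP; apply: measurableT_comp => //.
  by apply: measurable_funX; exact: (sqintegrableB (fi k) gi').1.
- by move=> x _; rewrite lee_fin ler_norm.
Qed.

End square_integrable.

(** * Boxes and the sigma-algebra of row vectors *)

Section rV_boxes.
Context (R : realType) (n : nat).
Local Notation E := 'rV[R]_n.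
Local Notation mE := 'rV[measurableTypeR R]_n.

Definition obox (a b : 'I_n -> R) : set E :=
  [set x | forall i, a i < x ord0 i < b i].

Definition cbox (a b : 'I_n -> R) : set E :=
  [set x | forall i, a i <= x ord0 i <= b i].

(** Rational corners make the family countable. The shape [box] is a parameter because each pair of
    corners is used twice: the open box covers, the closed one has to stay inside the open set so
    that bumps are compactly supported there. *)
Definition ratbox (box : ('I_n -> R) -> ('I_n -> R) -> set E)
  (q : 'rV[rat]_n * 'rV[rat]_n) : set E :=
  box (fun i => ratr (q.1 ord0 i)) (fun i => ratr (q.2 ord0 i)).

Lemma obox_sub_cbox a b : obox a b `<=` cbox a b.
Proof. by move=> x xab i; have /andP[/ltW -> /ltW ->] := xab i. Qed.

Lemma oboxI a b a' b' : obox a b `&` obox a' b' =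
  obox (fun i => Num.max (a i) (a' i)) (fun i => Num.min (b i) (b' i)).
Proof.
apply/seteqP; split => x.
  move=> [h h'] i; have /andP[h1 h2] := h i; have /andP[h3 h4] := h' i.
  by rewrite gt_max lt_min h1 h2 h3 h4.
move=> h; split => i; have := h i; rewrite gt_max lt_min.
  by move=> /andP[/andP[-> _]/andP[-> _]].
by move=> /andP[/andP[_ ->]/andP[_ ->]].
Qed.

Lemma cbox_compact a b : compact (cbox a b).
Proof.
have := @rV_compact R n (fun i => [set` `[a i, b i]]) (fun i => @segment_compact _ _ _).
congr compact; apply/seteqP; split => x /= h i; have := h i;
  by rewrite in_itv/=.
Qed.

Lemma open_ratbox (U : set E) (x : E) : open U -> U x ->
  exists q, ratbox obox q x /\ ratbox cbox q `<=` U.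
Proof.
move=> oU Ux; have : nbhs x U by exact: open_nbhs_nbhs.
move=> /nbhs_ballP[e /= e0 eU].
have /choice[q1 Hq1] : forall i : 'I_n, exists q : rat, ratr q \in `]x ord0 i - e / 2, x ord0 i[.
  by move=> i; apply: rat_in_itvoo; lra.
have /choice[q2 Hq2] : forall i : 'I_n, exists q : rat, ratr q \in `]x ord0 i, x ord0 i + e / 2[.
  by move=> i; apply: rat_in_itvoo; lra.
exists (\row_i q1 i, \row_i q2 i); split.
  move=> i; rewrite !mxE.
  by have := Hq1 i; have := Hq2 i; rewrite !in_itv/= => /andP[-> _] /andP[_ ->].
move=> y yq; apply: eU; split => // i j; rewrite ord1 /ball/=.
have := yq j; rewrite !mxE.
have := Hq1 j; have := Hq2 j; rewrite !in_itv/= => /andP[? ?] /andP[? ?] /andP[? ?].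
rewrite ltr_norml; apply/andP; split; lra.
Qed.

Lemma open_bigcup_ratbox (U : set E) : open U ->
  U = \bigcup_q (if `[< ratbox cbox q `<=` U >] then ratbox obox q else set0).
Proof.
move=> oU; apply/seteqP; split => x.
  move=> Ux; have [q [qx qU]] := open_ratbox oU Ux.
  by exists q => //; rewrite asboolT.
by move=> [q _]; case: asboolP => // qU /obox_sub_cbox /qU.
Qed.

Definition oboxes : set (set mE) := [set B | exists a b, B = obox a b].

Lemma open_sigma_oboxes (U : set E) : open U -> <<s oboxes >> U.
Proof.
move=> oU; rewrite (open_bigcup_ratbox oU).
apply: (@countable_bigcupT_measurable _ (g_sigma_algebraType oboxes)).
  exact: countableP.
move=> q; case: ifPn => _; last exact: (@measurable0 _ (g_sigma_algebraType oboxes)).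
by apply: sub_sigma_algebra; eexists; eexists; reflexivity.
Qed.

Lemma open_coord_gt (i : 'I_n) (a : R) : open [set x : E | a < x ord0 i].
Proof.
apply: (@open_comp _ _ (fun x : E => x ord0 i) [set y | a < y]).
  by move=> x _; exact: coord_continuous.
exact: open_gt.
Qed.

(** Boxes are stable under intersection, which the pi-lambda argument of the fundamental lemma
    requires of a generating family. With [open_sigma_oboxes] this also makes open sets
    measurable. *)
Lemma measurable_sigma_oboxes : @measurable _ mE = <<s oboxes >>.
Proof.
apply/seteqP; split.
  apply: smallest_sub; first exact: smallest_sigma_algebra.
  rewrite -bigcup_seq/=; apply: bigcup_sub => i _.
  suff mi : @measurable_fun _ _ (g_sigma_algebraType oboxes) R setT
      (fun x : E => x ord0 i).
    by move=> A [B mB <-]; exact: mi.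
  apply: (measurability _ (RGenOInfty.measurableE R)).
  move=> /= _ [_ [a ->]] <-; rewrite setTI.
  have := open_sigma_oboxes (@open_coord_gt i a).
  congr (<<s _ >> _); apply/seteqP; split => x /=; by rewrite in_itv/= andbT.
apply: smallest_sub; first exact: sigma_algebra_measurable.
move=> _ [a [b ->]].
rewrite (_ : obox a b = \bigcap_(i in setT) [set x : mE | a i < x ord0 i < b i]); last first.
  by apply/seteqP; split => x; [move=> h i _; exact: h|move=> h i; exact: (h i)].
apply: fin_bigcap_measurable => // i _.
have := @measurable_coord _ (measurableTypeR R) n i measurableT
  [set` `]a i, b i[] (measurable_itv _).
by rewrite setTI; congr (measurable _).
Qed.

Lemma open_measurable_rV (U : set E) : open U -> @measurable _ mE U.
Proof. by rewrite measurable_sigma_oboxes; exact: open_sigma_oboxes. Qed.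

Lemma measurable_obox a b : @measurable _ mE (obox a b).
Proof.
rewrite measurable_sigma_oboxes; apply: sub_sigma_algebra.
by exists a, b.
Qed.

Lemma continuous_measurable_rV (f : E -> R) : continuous f ->
  @measurable_fun _ _ mE R setT f.
Proof.
move=> cf; apply: (measurability _ (RGenOInfty.measurableE R)).
move=> /= _ [_ [a ->]] <-; rewrite setTI; apply: open_measurable_rV.
have -> : `]a, +oo[%classic = [set y : R | a < y].
  by apply/seteqP; split => x /=; rewrite in_itv/= andbT.
apply: open_comp; last exact: open_gt.
by move=> x _; exact: cf.
Qed.

Lemma continuous_measurable_rV_in (D : set E) (f : E -> R) :
  @measurable _ mE D -> continuous f -> @measurable_fun _ _ mE R D f.
Proof.
move=> mD cf; apply: (@measurable_funS _ _ mE R setT) => //.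
exact: continuous_measurable_rV.
Qed.

End rV_boxes.

(** * Bump functions *)

Section theta.
Context (R : realType).
Implicit Types (c y : R) (k : nat).

(** For [k] equal to 0 this is the classical flat function at the origin. The powers of [y^-1] are
    what differentiation produces, so the family is closed under derivatives up to linear
    combinations; letting [c] tend to 0 turns the case [k = 0] into the indicator of the positive
    half-line. *)
Definition theta c k y : R := if 0 < y then y^-1 ^+ k * expR (- c * y^-1) else 0.

Lemma theta_ge0 c k y : 0 <= theta c k y.
Proof.
rewrite /theta; case: ifP => // y0.
by rewrite mulr_ge0 ?expR_ge0// exprn_ge0// invr_ge0 ltW.
Qed.

Lemma theta_le1 c y : 0 < c -> theta c 0 y <= 1.
Proof.
move=> c0; rewrite /theta; case: ifP => // y0.
rewrite expr0 mul1r -expR0 ler_expR mulNr oppr_le0 mulr_ge0 ?invr_ge0 ?ltW//.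
Qed.

(** Uses [expR t >= t ^+ k.+1 / (k.+1)!] at [t = c / y]: one power more than the singular factor
    leaves a bound linear in [y]. *)
Lemma theta_le c k y : 0 < c -> 0 <= y ->
  theta c k y <= (k.+1)`!%:R / c ^+ k.+1 * y.
Proof.
move=> c0; rewrite le_eqVlt => /predU1P[<-|y0]; first by rewrite /theta ltxx mulr0.
rewrite /theta y0.
have t0 : 0 <= c * y^-1 by rewrite mulr_ge0 ?invr_ge0 ?ltW.
have := @expR_ge1Dxn R (c * y^-1) k t0.
have f0 : 0 < (k.+1)`!%:R :> R by rewrite ltr0n fact_gt0.
set F := (k.+1)`!%:R : R in f0 *.
have e0 := expR_gt0 (c * y^-1).
rewrite mulNr expRN => h.
have {}h : (c * y^-1) ^+ k.+1 / F <= expR (c * y^-1) by apply: le_trans h; lra.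
rewrite ler_pdivrMr// exprMn in h.
rewrite ler_pdivrMr// -(ler_pM2l (exprn_gt0 k.+1 c0)) -(ler_pM2r (_ : 0 < y^-1)) ?invr_gt0//.
have ck : c ^+ k.+1 != 0 by rewrite expf_neq0// gt_eqF.
rewrite -mulrA -exprSr (le_trans h)// le_eqVlt; apply/orP; left; apply/eqP.
by field; rewrite gt_eqF// ck.
Qed.

Lemma is_derive_theta c k y : 0 < c ->
  is_derive y 1 (theta c k) (c * theta c k.+2 y - k%:R * theta c k.+1 y).
Proof.
move=> c0; have [y0|y0|<-] := ltgtP 0 y.
- apply: (@near_eq_is_derive _ _ _ (fun y => y^-1 ^+ k * expR (- c * y^-1))).
    near=> z; rewrite /theta ifT//; near: z; exact: lt_nbhsr.
  have iV : is_derive y 1 (fun z : R => z^-1) (- y^-1 ^+ 2).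
    have := @is_deriveV R id y 1 1 (lt0r_neq0 y0) (is_derive_id _ _).
    by move/is_derive_eq; apply; rewrite /GRing.scale/= mulr1 exprVn.
  have iX := is_deriveX k iV.
  have iE : is_derive y 1 (fun z => expR (- c * z^-1)) (expR (- c * y^-1) * (- c * - y^-1 ^+ 2)).
    have iZ := is_deriveZ (- c) iV.
    exact: (is_derive1_comp (is_derive_expR _) iZ).
  have iM := is_deriveM iX iE.
  have -> : (fun y => y^-1 ^+ k * expR (- c * y^-1)) =
      (fun z : R => z^-1) ^+ k * (fun z : R => expR (- c * z^-1)).
    by apply/funext => z; rewrite !fctE.
  apply: (is_derive_eq iM).
  rewrite /theta y0 /GRing.scale/= !fctE.
  set e := expR _; set z := y^-1.
  by case: k {iX iM} => [|k]; rewrite /= ?mulr0n !exprS ?expr0; ring.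
- apply: (@near_eq_is_derive _ _ _ (fun=> 0)).
    near=> z; rewrite /theta ifF//; apply/negbTE; rewrite -leNgt ltW//.
    near: z; exact: lt_nbhsl.
  apply: (is_derive_eq (is_derive_cst _ _ _)).
  by rewrite /theta !ifF ?(lt_gtF y0)// !mulr0 subr0.
- have lim0 : h^-1 *: ((theta c k \o shift 0) (h *: 1) - theta c k 0) @[h --> 0^'] --> (0 : R).
    (* The difference quotient at 0 is again a member of the family, with [k] raised by one, and it
       is squeezed to 0 by its linear bound. *)
    have -> : (fun h : R => h^-1 *: ((theta c k \o shift 0) (h *: 1) - theta c k 0)) =
      (fun h => theta c k.+1 h).
      apply/funext => h; rewrite /= /GRing.scale/= mulr1 addr0 /theta ltxx subr0.
      by case: ifP; rewrite ?mulr0// exprS mulrA.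
    set C := (k.+2)`!%:R / c ^+ k.+2.
    apply: (@squeeze_cvgr _ _ _ _ (fun=> 0) (fun h => C * `|h|)).
    + near=> h; rewrite theta_ge0/=.
      have [h0|h0] := leP 0 h; first by rewrite ger0_norm// theta_le.
      rewrite /theta ifF ?(lt_gtF h0)// mulr_ge0//.
      by rewrite divr_ge0// ?ler0n// exprn_ge0// ltW.
    + exact: cvg_cst.
    + apply: cvg_within_filter.
      have : (fun h : R => C * `|h|) @ (0 : R) --> C * `|0 : R|.
        by apply: cvgM; [exact: cvg_cst|exact: norm_continuous].
      by rewrite normr0 mulr0.
  have -> : c * theta c k.+2 0 - k%:R * theta c k.+1 0 = 0.
    by rewrite /theta ltxx !mulr0 subr0.
  apply: DeriveDef; first by apply/cvg_ex; exists 0.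
  exact: cvg_lim.
Unshelve. all: by end_near. Qed.

Lemma continuous_theta c k : 0 < c -> continuous (theta c k).
Proof.
move=> c0 y; have [df _] := is_derive_theta k y c0.
by apply/differentiable_continuous/derivable1_diffP.
Qed.

Lemma theta_cvg1 y : 0 < y -> (fun m => theta (m.+1%:R^-1) 0 y) @ \oo --> (1 : R).
Proof.
move=> y0; have -> : (fun m => theta (m.+1%:R^-1) 0 y) = (fun m => expR (- harmonic m * y^-1)).
  by apply/funext => m; rewrite /theta y0 expr0 mul1r.
rewrite -expR0; apply: (@cvg_comp _ _ _ (fun m => - harmonic m * y^-1) expR); last exact:
  continuous_expR.
rewrite -(mul0r y^-1) -oppr0; apply: cvgM; last exact: cvg_cst.
by apply: cvgN; exact: cvg_harmonic.
Qed.

End theta.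

(** * Derivatives along lines and continuity *)

Section lines.
Context (R : realType).

Lemma is_derive_line (V : normedModType R) (f : V -> R) (x v : V) (t d : R) :
  is_derive (t *: v + x) v f d <-> is_derive t 1 (fun s : R => f (s *: v + x)) d.
Proof.
have -> : is_derive (t *: v + x) v f d = is_derive t 1 (fun s : R => f (s *: v + x)) d.
  have e : (fun h : R => h^-1 *: ((f \o shift (t *: v + x)) (h *: v) - f (t *: v + x))) =
    (fun h : R => h^-1 *: (((fun s : R => f (s *: v + x)) \o shift t) (h *: 1) - f (t *: v + x))).
    apply/funext => h; congr (_ *: (f _ - _)).
    by rewrite /= -[X in (X + t) *: _]/(h * 1) mulr1 scalerDl addrA.
  by apply/propext; split => -[H1 H2]; apply: DeriveDef; move: H1 H2; rewrite /derivable /derive e.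
by [].
Qed.

Lemma is_derive_line0 (V : normedModType R) (f : V -> R) (x v : V) (d : R) :
  is_derive x v f d <-> is_derive (0 : R) 1 (fun s : R => f (s *: v + x)) d.
Proof. by rewrite -is_derive_line scale0r add0r. Qed.

Context (V : normedModType R).
Implicit Types (f g : V -> R) (x v : V).

Lemma is_deriveD_fun f g x v d e : is_derive x v f d -> is_derive x v g e ->
  is_derive x v (fun y => f y + g y) (d + e).
Proof. exact: is_deriveD. Qed.

Lemma is_deriveZ_fun c f x v d : is_derive x v f d ->
  is_derive x v (fun y => c * f y) (c * d).
Proof. exact: is_deriveZ. Qed.

Lemma is_deriveM_fun f g x v d e : is_derive x v f d -> is_derive x v g e ->
  is_derive x v (fun y => f y * g y) (f x * e + g x * d).
Proof. exact: is_deriveM. Qed.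

End lines.

Section continuity.
Context (R : realType) (T : topologicalType).
Implicit Types f g : T -> R.

Lemma continuousM_fun f g : continuous f -> continuous g -> continuous (fun x => f x * g x).
Proof. by move=> cf cg x; apply: cvgM; [exact: cf|exact: cg]. Qed.

Lemma continuousD_fun f g : continuous f -> continuous g -> continuous (fun x => f x + g x).
Proof. by move=> cf cg x; apply: cvgD; [exact: cf|exact: cg]. Qed.

Lemma continuousB_fun f g : continuous f -> continuous g -> continuous (fun x => f x - g x).
Proof. by move=> cf cg x; apply: cvgB; [exact: cf|exact: cg]. Qed.

Lemma continuousZ_fun c f : continuous f -> continuous (fun x => c * f x).
Proof. by move=> cf x; apply: cvgM; [exact: cvg_cst|exact: cf]. Qed.

Lemma continuous_comp_fun (h : R -> R) f : continuous h -> continuous f ->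
  continuous (fun x => h (f x)).
Proof. by move=> ch cf x; apply: (cvg_comp _ _ (cf x)); exact: ch. Qed.

Lemma continuous_prod (I : Type) (r : seq I) (F : I -> T -> R) :
  (forall i, continuous (F i)) -> continuous (fun x => \prod_(i <- r) F i x).
Proof.
move=> cF; elim: r => [|i r IH].
  by under eq_fun do rewrite big_nil; exact: cst_continuous.
by under eq_fun do rewrite big_cons; exact: continuousM_fun.
Qed.

End continuity.

(** * Smooth functions and bumps on boxes *)

Section smooth.
Context (R : realType) (n : nat).
Local Notation E := 'rV[R]_n.
Local Notation dl i := (delta_mx 0 i : 'rV[R]_n).
Implicit Types f g p q : E -> R.

Inductive lin_span (S : set (E -> R)) : (E -> R) -> Prop :=
| lin_span_base f of S f : lin_span S f
| lin_spanZ c f of lin_span S f : lin_span S (fun x => c * f x)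
| lin_spanD f g of lin_span S f & lin_span S g : lin_span S (fun x => f x + g x).

Lemma partialE i f x d : is_derive x (dl i) f d -> partial i f x = d.
Proof. by move=> h; rewrite /partial derive_val. Qed.

(** Smoothness quantifies over all words of partial derivatives. A span closed under first partials
    allows induction on the word without any formula for iterated derivatives. *)
Lemma lin_span_smooth (S : set (E -> R)) :
  (forall f, S f -> continuous f) ->
  (forall f i, S f -> exists2 g, lin_span S g & forall x, is_derive x (dl i) f (g x)) ->
  forall f, lin_span S f -> smooth f.
Proof.
move=> Sc Sd.
have key f : lin_span S f -> continuous f /\
    forall i, exists2 g, lin_span S g & forall x, is_derive x (dl i) f (g x).
  elim=> {f} [f Sf|c f _ [cf df]|f g _ [cf df] _ [cg dg]].
  - by split; [exact: Sc|move=> i; exact: Sd].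
  - split; first exact: continuousZ_fun.
    move=> i; have [g Sg dg] := df i; exists (fun x => c * g x).
      exact: lin_spanZ.
    by move=> x; exact: is_deriveZ_fun.
  - split; first exact: continuousD_fun.
    move=> i; have [f' Sf' df'] := df i; have [g' Sg' dg'] := dg i.
    exists (fun x => f' x + g' x); first exact: lin_spanD.
    by move=> x; exact: is_deriveD_fun.
move=> f Sf s; have : lin_span S (foldr (@partial R n) f s).
  elim: s => //= i s IH; have [_ /(_ i)[g Sg dg]] := key _ IH.
  suff -> : partial i (foldr (@partial R n) f s) = g by [].
  by apply/funext => x; apply: partialE; exact: dg.
move=> /key[cg dg]; split=> // i x; have [g _ /(_ x) dgx] := dg i.
by have [] := dgx.
Qed.

Lemma smooth_partial f i : smooth f -> smooth (partial i f).
Proof. by move=> sf s; have := sf (rcons s i); rewrite foldr_rcons. Qed.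

Lemma smooth_continuous f : smooth f -> continuous f.
Proof. by move=> /(_ [::])[]. Qed.

Lemma smooth_is_derive f i x : smooth f -> is_derive x (dl i) f (partial i f x).
Proof. by move=> /(_ [::])[_ /(_ i x) h]; exact: DeriveDef. Qed.

Lemma smooth_lin f g c : smooth f -> smooth g -> smooth (fun x => c * f x + g x).
Proof.
move=> sf sg; apply: (@lin_span_smooth [set f | smooth f]) => [h|h i|].
- exact: smooth_continuous.
- move=> sh; exists (partial i h); first by apply: lin_span_base; exact: smooth_partial.
  by move=> x; exact: smooth_is_derive.
- by apply: lin_spanD; [apply: lin_spanZ|]; exact: lin_span_base.
Qed.

Lemma is_derive_coord i j x : is_derive x (dl i) (fun y : E => y 0 j) (i == j)%:R.
Proof.
apply/is_derive_line0.
have -> : (fun s : R => (s *: dl i + x) 0 j) = (fun s => (i == j)%:R * s + x 0 j).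
  by apply/funext => s; rewrite !mxE eqxx/= eq_sym mulrC.
have h1 : is_derive (0 : R) 1 (fun s : R => (i == j)%:R * s) ((i == j)%:R * 1).
  by apply: is_deriveZ; exact: is_derive_id.
have h2 : is_derive (0 : R) 1 (fun s : R => x 0 j) 0 by exact: is_derive_cst.
by have := is_deriveD h1 h2; rewrite mulr1 addr0.
Qed.

(** The Leibniz rule turns a product with the coordinate into another such product plus a multiple
    of the smooth factor, so both kinds of functions generate the span. Products with coordinates
    serve as test functions in the symmetry of [Lz]. *)
Lemma smooth_coordM f j : smooth f -> smooth (fun x => x 0 j * f x).
Proof.
move=> sf.
apply: (@lin_span_smooth [set g | smooth g \/ exists2 h, smooth h & g = fun x => x 0 j * h x]).
- move=> h [|[g sg ->]]; first exact: smooth_continuous.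
  by apply: continuousM_fun; [exact: coord_continuous|exact: smooth_continuous].
- move=> h i [sh|[g sg ->]].
    exists (partial i h); last by move=> x; exact: smooth_is_derive.
    by apply: lin_span_base; left; exact: smooth_partial.
  exists (fun x : E => x 0 j * partial i g x + (i == j)%:R * g x).
    apply: lin_spanD; last by apply: lin_spanZ; apply: lin_span_base; left.
    by apply: lin_span_base; right; exists (partial i g) => //; exact: smooth_partial.
  move=> x; have := is_deriveM_fun (is_derive_coord i j x) (smooth_is_derive i x sg).
  by rewrite [X in _ + X]mulrC.
- by apply: lin_span_base; right; exists f.
Qed.

Lemma partial_coordM f i j x : smooth f ->
  partial i (fun x => x 0 j * f x) x = x 0 j * partial i f x + (i == j)%:R * f x.
Proof.
move=> sf; apply: partialE.
have := is_deriveM_fun (is_derive_coord i j x) (smooth_is_derive i x sf).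
by rewrite [X in _ + X]mulrC.
Qed.

Lemma partial_lin f g c i x : smooth f -> smooth g ->
  partial i (fun x => c * f x + g x) x = c * partial i f x + partial i g x.
Proof.
move=> sf sg; apply: partialE; apply: is_deriveD_fun; last exact: smooth_is_derive.
by apply: is_deriveZ_fun; exact: smooth_is_derive.
Qed.

(** Every face of the box has its own exponent, because a derivative in direction [j] raises the
    exponents of the two faces orthogonal to [j] and no others. *)
Definition bump (c : R) (k l : 'I_n -> nat) (a b : 'I_n -> R) : E -> R :=
  fun x => \prod_i (theta c (k i) (x 0 i - a i) * theta c (l i) (b i - x 0 i)).

Let incr (k : 'I_n -> nat) j m i := if i == j then (m + k i)%N else k i.

Lemma bump_split c k l a b j x : bump c k l a b x =
  theta c (k j) (x 0 j - a j) * theta c (l j) (b j - x 0 j) *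
  \prod_(i | i != j) (theta c (k i) (x 0 i - a i) * theta c (l i) (b i - x 0 i)).
Proof. by rewrite /bump (bigD1 j). Qed.

Lemma bump_split_incr c k l a b j x m m' : bump c (incr k j m) (incr l j m') a b x =
  theta c (m + k j) (x 0 j - a j) * theta c (m' + l j) (b j - x 0 j) *
  \prod_(i | i != j) (theta c (k i) (x 0 i - a i) * theta c (l i) (b i - x 0 i)).
Proof.
rewrite (bump_split _ _ _ _ _ j) /incr eqxx; congr (_ * _).
by apply: eq_bigr => i /negbTE ->.
Qed.

Lemma is_derive_bump c k l a b j x : 0 < c ->
  is_derive x (dl j) (bump c k l a b)
    (c * bump c (incr k j 2) (incr l j 0) a b x +
     ((- (k j)%:R) * bump c (incr k j 1) (incr l j 0) a b x +
      ((- c) * bump c (incr k j 0) (incr l j 2) a b x +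
       (l j)%:R * bump c (incr k j 0) (incr l j 1) a b x))).
Proof.
move=> c0; apply/is_derive_line0.
rewrite !bump_split_incr.
set P := \prod_(i | i != j) _.
have -> : (fun s : R => bump c k l a b (s *: dl j + x)) = (fun s : R => P *
   (theta c (k j) (s + (x 0 j - a j)) * theta c (l j) ((b j - x 0 j) - s))).
  apply/funext => s; rewrite (bump_split _ _ _ _ _ j) mulrC; congr (_ * (_ * _)).
  - apply: eq_bigr => i ij; rewrite !mxE eqxx/= (negbTE ij) mulr0 add0r//.
  - by rewrite !mxE !eqxx/= mulr1 addrA.
  - by rewrite !mxE !eqxx/= mulr1; congr theta; ring.
have i1 : is_derive (0 : R) 1 (fun s : R => s + (x 0 j - a j)) 1.
  have := is_deriveD (is_derive_id (0 : R) (1 : R)) (is_derive_cst (x 0 j - a j) (0 : R) (1 : R)).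
  by rewrite addr0.
have i2 : is_derive (0 : R) 1 (fun s : R => (b j - x 0 j) - s) (- 1).
  have := is_deriveB (is_derive_cst (b j - x 0 j) (0 : R) (1 : R)) (is_derive_id (0 : R) (1 : R)).
  by rewrite sub0r.
have t1 : is_derive (0 : R) 1 (fun s => theta c (k j) (s + (x 0 j - a j))) _ :=
  @is_derive1_comp R (theta c (k j)) (fun s => s + (x 0 j - a j)) 0 _ _
    (is_derive_theta (k j) (0 + (x 0 j - a j)) c0) i1.
have t2 : is_derive (0 : R) 1 (fun s => theta c (l j) ((b j - x 0 j) - s)) _ :=
  @is_derive1_comp R (theta c (l j)) (fun s => (b j - x 0 j) - s) 0 _ _
    (is_derive_theta (l j) ((b j - x 0 j) - 0) c0) i2.
apply: (is_derive_eq (is_deriveZ_fun P (is_deriveM_fun t1 t2))).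
rewrite !add0r subr0 !add0n.
rewrite /= !add1n; ring.
Qed.

Lemma continuous_bump c k l a b : 0 < c -> continuous (bump c k l a b).
Proof.
move=> c0; apply: continuous_prod => i; apply: continuousM_fun.
  apply: continuous_comp_fun; first exact: continuous_theta.
  by apply: continuousB_fun; [exact: coord_continuous|exact: cst_continuous].
apply: continuous_comp_fun; first exact: continuous_theta.
by apply: continuousB_fun; [exact: cst_continuous|exact: coord_continuous].
Qed.

Lemma smooth_bump c k l a b : 0 < c -> smooth (bump c k l a b).
Proof.
move=> c0.
apply: (@lin_span_smooth [set f | exists k l, f = bump c k l a b]).
- by move=> _ [k' [l' ->]]; exact: continuous_bump.
- move=> _ j [k' [l' ->]]; eexists; last by move=> x; exact: is_derive_bump.
  do ?[apply: lin_spanD]; apply: lin_spanZ; apply: lin_span_base; by eexists; eexists.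
- by apply: lin_span_base; exists k, l.
Qed.

Lemma bump_out c k l a b x : ~ obox a b x -> bump c k l a b x = 0.
Proof.
move=> nx; have /existsNP[j /negP] := nx.
rewrite (bump_split _ _ _ _ _ j).
rewrite negb_and => /orP[h|h].
  by rewrite {1}/theta subr_gt0 (negbTE h) !mul0r.
by rewrite {2}/theta subr_gt0 (negbTE h) mulr0 mul0r.
Qed.

Lemma bump_test_fun (D : set E) c k l a b : 0 < c -> cbox a b `<=` D ->
  test_fun D (bump c k l a b).
Proof.
move=> c0 abD; split; first exact: smooth_bump.
exists (cbox a b); split => //; first exact: cbox_compact.
by move=> x nx; apply: bump_out => /obox_sub_cbox.
Qed.

Lemma bump_bounds c a b x : 0 < c ->
  0 <= bump c (fun=> 0%N) (fun=> 0%N) a b x <= 1.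
Proof.
move=> c0; rewrite /bump; elim/big_ind: _ => [|u v /andP[u0 u1] /andP[v0 v1]|i _].
- by rewrite ler01 lexx.
- by rewrite mulr_ge0//= mulr_ile1.
- by rewrite mulr_ge0 ?theta_ge0//= mulr_ile1 ?theta_ge0 ?theta_le1.
Qed.

Lemma bump_cvg a b x :
  (fun m => bump (m.+1%:R^-1) (fun=> 0%N) (fun=> 0%N) a b x) @ \oo --> (\1_(obox a b) x : R).
Proof.
have [xab|nx] := pselect (obox a b x); last first.
  by under eq_fun do rewrite bump_out//; rewrite indicE memNset//; exact: cvg_cst.
rewrite indicE mem_set//= -[X in _ --> X](_ : \prod_(i < n) (1 * 1 : R) = 1); last first.
  by rewrite big1// => i _; rewrite mulr1.
apply: cvg_big => [|i _]; first exact: mul_continuous.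
have /andP[h1 h2] := xab i.
by apply: cvgM; apply: theta_cvg1; rewrite subr_gt0.
Qed.

End smooth.

(** * The fundamental lemma of the calculus of variations *)

Section fundamental_lemma.
Context (R : realType) (n : nat).
Local Notation E := 'rV[R]_n.
Local Notation mE := 'rV[measurableTypeR R]_n.
Local Notation mu := (lebesgue_rV R n).
Variable D : set E.
Hypothesis oD : open D.
Variable g : mE -> R.
Hypothesis gi : mu.-integrable (D : set mE) (EFin \o g).
Hypothesis g0 : forall phi, test_fun D phi ->
  \int[mu]_(x in (D : set mE)) (g x * phi x) = 0.

Let mD : @measurable _ mE D.
Proof. exact: open_measurable_rV. Qed.

Let mg : @measurable_fun _ _ mE R D g.
Proof. exact: integrable_real_measurable gi. Qed.

Let gI (A : set mE) := (\int[mu]_(x in (D : set mE)) (g x * \1_A x)%:E)%E.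

Let mgI (A : set mE) : measurable A -> measurable_fun (D : set mE) (fun x => (g x * \1_A x)%:E).
Proof.
by move=> mA; apply/measurable_EFinP; apply: measurable_funM => //; exact: measurable_indic.
Qed.

Let abs_g : mu.-integrable (D : set mE) (fun x => `|(g x)%:E|%E).
Proof. exact: (integrable_abse gi). Qed.

Let gI_int (A : set mE) : measurable A ->
  mu.-integrable (D : set mE) (fun x => (g x * \1_A x)%:E).
Proof.
move=> mA; apply: (le_integrable mD (mgI mA) _ gi) => x _ /=.
rewrite lee_fin normrM ler_piMr// ger0_norm ?indicE ?ler0n//; by case: (_ \in _).
Qed.

Let gI_cvg (F : nat -> mE -> R) (A : set mE) : measurable A ->
  (forall m, @measurable_fun _ _ mE R D (F m)) -> (forall m x, `|F m x| <= 1) ->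
  (forall x, (fun m => F m x) @ \oo --> (\1_A x : R)) ->
  (fun m => \int[mu]_(x in (D : set mE)) (g x * F m x)%:E)%E @ \oo --> gI A.
Proof.
move=> mA mF F1 FA.
have [] := @dominated_convergence _ _ _ mu D mD (fun m x => (g x * F m x)%:E)
  (fun x => (g x * \1_A x)%:E) (fun x => `|(g x)%:E|%E).
- by move=> m; apply/measurable_EFinP; exact: measurable_funM.
- exact: mgI.
- apply: aeW => x _; apply: cvg_EFin; first exact: nearW.
  by apply: cvgM; [exact: cvg_cst|exact: FA].
- exact: abs_g.
- apply: aeW => x m _ /=; rewrite lee_fin normrM ler_piMr//; exact: F1.
- by move=> _ _; exact.
Qed.

Let gI_box (a b : 'I_n -> R) : cbox a b `<=` D -> gI (obox a b) = 0%E.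
Proof.
move=> abD; have m0 m : 0 < m.+1%:R^-1 :> R by rewrite invr_gt0.
pose F m := bump (m.+1%:R^-1) (fun=> 0%N) (fun=> 0%N) a b.
have h1 m : @measurable_fun _ _ mE R D (F m).
  by apply: continuous_measurable_rV_in => //; exact: continuous_bump.
have h2 m x : `|F m x| <= 1.
  by have /andP[? ?] := bump_bounds a b x (m0 m); rewrite ger0_norm.
have h3 x : (fun m => F m x) @ \oo --> (\1_(obox a b) x : R) by exact: bump_cvg.
rewrite -(cvg_lim _ (gI_cvg (measurable_obox a b) h1 h2 h3))//.
rewrite (_ : (fun m => _) = (fun=> 0%E)); first by rewrite lim_cst.
apply/funext => m.
have tm := bump_test_fun (fun=> 0%N) (fun=> 0%N) (m0 m) abD.
have := g0 tm; rewrite /Rintegral => h.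
rewrite -[LHS]fineK; first by rewrite h.
apply: integrable_fin_num => //.
apply: (le_integrable mD _ _ gi).
  by apply/measurable_EFinP; apply: measurable_funM => //; exact: h1.
by move=> x _ /=; rewrite lee_fin normrM ler_piMr// h2.
Qed.

(** A pi-lambda argument relative to one fixed box. The intersection with it puts the whole space
    into the class: the integral of [g] is known to vanish on boxes inside [D], but not on [D]
    itself. *)
Let gI_measurable (a b : 'I_n -> R) : cbox a b `<=` D ->
  forall A : set mE, measurable A -> gI (A `&` obox a b) = 0%E.
Proof.
move=> abD; set B := obox a b; have mB : @measurable _ mE B by exact: measurable_obox.
pose H : set (set mE) := [set A | @measurable _ mE A /\ gI (A `&` B) = 0%E].
suff : @measurable _ mE `<=` H by move=> h A /h[].
rewrite measurable_sigma_oboxes.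
apply: lambda_system_subset => //.
- by move=> _ _ [a1 [b1 ->]] [a2 [b2 ->]]; rewrite oboxI; eexists; eexists.
- split => //.
  + by split; [exact: measurableT|rewrite setTI; exact: gI_box].
  + move=> X Y YX [mX HX] [mY HY]; split; first exact: measurableD.
    have mXB : @measurable _ mE (X `&` B) by exact: measurableI.
    have mYB : @measurable _ mE (Y `&` B) by exact: measurableI.
    have : gI (X `&` B) = (gI ((X `\` Y) `&` B) + gI (Y `&` B))%E.
      have mXYB : @measurable _ mE ((X `\` Y) `&` B) by apply: measurableI => //; exact:
        measurableD.
      rewrite /gI -integralD//; [|exact: gI_int|exact: gI_int].
      apply: eq_integral => x _; rewrite -EFinD -mulrDr; congr (_ * _)%:E.
      exact: indic_split.
    move=> e; have HX' : gI (X `&` B) = 0%E := HX.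
    have HY' : gI (Y `&` B) = 0%E := HY.
    by rewrite HX' HY' adde0 in e.
  + move=> F ndF HF.
    have mF i : @measurable _ mE (F i) by have [] := HF i.
    have mU : @measurable _ mE (\bigcup_i F i) by exact: bigcup_measurable.
    split; first exact: mU.
    pose G m : mE -> R := \1_(F m `&` B).
    have h1 m : @measurable_fun _ _ mE R D (G m).
      by apply: measurable_indic; exact: measurableI.
    have h2 m x : `|G m x| <= 1.
      by rewrite /G indicE; case: (_ \in _); rewrite ?normr1 ?normr0.
    have h3 x : (fun m => G m x) @ \oo --> (\1_(\bigcup_i F i `&` B) x : R).
      apply: cvg_near_cst; rewrite /G.
      have [[[i _ Fix] Bx]|nx] := pselect ((\bigcup_i F i `&` B) x).
        exists i => // m /= im; rewrite !indicE !mem_set//.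
          by split => //; exists i.
        by split => //; have /subsetPset := ndF _ _ im; exact.
      apply: nearW => m; rewrite !indicE !memNset//.
      by move=> [Fx Bx]; apply: nx; split => //; exists m.
    rewrite -(cvg_lim _ (gI_cvg (measurableI _ _ mU mB) h1 h2 h3))//.
    rewrite (_ : (fun m => _) = (fun=> 0%E)); first by rewrite lim_cst.
    by apply/funext => m; have [] := HF m.
- by move=> _ [a1 [b1 ->]]; split; [exact: measurable_obox|
    rewrite oboxI; apply: gI_box => x xab; apply: abD => i;
    have := xab i; rewrite ge_max le_min => /andP[/andP[_ ->] /andP[_ ->]]].
Qed.

(** Bumps are bounded by 1 and tend to indicators of boxes as their parameter goes to 0, so by
    dominated convergence the integral of [g] vanishes on each open box whose closed box lies in
    [D], then on all its measurable subsets. Hence [g] is 0 almost everywhere on each such box, and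
    countably many of them cover [D]. *)
Lemma fundamental_lemma : {ae mu, forall x, D x -> g x = 0}.
Proof.
have aebox (a b : 'I_n -> R) : cbox a b `<=` D -> {ae mu, forall x, obox a b x -> g x = 0}.
  move=> abD.
  have abD' : obox a b `<=` D by move=> x /obox_sub_cbox /abD.
  have mab : @measurable _ mE (obox a b) by exact: measurable_obox.
  have : ae_eq mu (obox a b : set mE) (EFin \o g) (cst 0%E).
    apply: integral_ae_eq => //; first exact: (integrableS mD).
    move=> A AB mA; rewrite integral_cst// mul0e.
    rewrite -(gI_measurable abD mA) (setIidl AB) /gI.
    rewrite -[X in integral _ X _ = _](_ : D `&` A = A); last first.
      by apply: setIidr => x /AB /abD'.
    rewrite integral_mkcondr; apply: eq_integral => x _.
    by rewrite patchE indicE; case: (x \in A); rewrite ?mulr1 ?mulr0.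
  by apply: filterS => x /= xx Bx; have [] := xx Bx.
(* Rational boxes are numbered by their codes, so that one null set serves all of them. *)
pose P m x := if @unpickle ('rV[rat]_n * 'rV[rat]_n)%type m is Some q
  then ratbox (@cbox R n) q `<=` D -> ratbox (@obox R n) q x -> g x = 0 else True.
have : {ae mu, forall x, forall m, P m x}.
  apply: ae_foralln => m; rewrite /P; case: unpickle => [q|]; last exact: aeW.
  have [qD|nqD] := pselect (ratbox (@cbox R n) q `<=` D); last exact: aeW.
  by apply: (aeS _ (aebox _ _ qD)) => x /= xx _.
apply: aeS => x /= xx Dx.
have [q [qx qD]] := open_ratbox oD Dx.
by have := xx (pickle q); rewrite /P pickleK; exact.
Qed.

End fundamental_lemma.

(** * Ladyzhenskaya and Poincaré inequalities *)

Section cons_rV.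
Context (R : realType) (n : nat).
Local Notation mE k := 'rV[measurableTypeR R]_k.
Local Notation cons := (@cons_rV _ (measurableTypeR R) n).

Lemma cons_rV_line (t a : R) (y : mE n) :
  cons (t + a, y) = t *: (delta_mx 0 0 : 'rV[R]_n.+1) + cons (a, y) :> 'rV[R]_n.+1.
Proof.
apply/rowP => i; rewrite !mxE; case: (unliftP ord0 i) => [j ->|->].
  by rewrite eq_sym (negbTE (neq_lift _ _)) andbF mulr0 add0r.
by rewrite !eqxx mulr1.
Qed.

Lemma cons_rV_slice (t a : R) (y : mE n) (i : 'I_n) :
  cons (a, t *: (delta_mx 0 i : 'rV[R]_n) + y : 'rV[R]_n) =
  t *: (delta_mx 0 (lift ord0 i) : 'rV[R]_n.+1) + cons (a, y) :> 'rV[R]_n.+1.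
Proof.
apply/rowP => j; rewrite !mxE; case: (unliftP ord0 j) => [k ->|->].
  by rewrite !mxE (inj_eq (@lift_inj _ ord0)).
by rewrite (negbTE (neq_lift _ _)) andbF mulr0 add0r.
Qed.

Lemma continuous_cons_l (y : mE n) : continuous (fun a : R => cons (a, y) : 'rV[R]_n.+1).
Proof.
move=> a; apply/(@cvg_ballP _ _ _ _ (nbhs_filter (a : R))) => e e0.
near=> b; split => // i j; rewrite !mxE.
case: (unliftP ord0 j) => [k _|_]; first exact: ballxx.
by near: b; exact: (nbhsx_ballx (a : R) e e0).
Unshelve. all: by end_near. Qed.

Lemma continuous_cons_r (a : R) :
  continuous (fun y : 'rV[R]_n => cons (a, y) : 'rV[R]_n.+1).
Proof.
move=> y; apply/(@cvg_ballP _ _ _ _ (nbhs_filter (y : 'rV[R]_n))) => e e0.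
near=> z; split => // i j; rewrite !mxE.
case: (unliftP ord0 j) => [k _|_]; last exact: ballxx.
have : ball y e z by near: z; exact: (nbhsx_ballx (y : 'rV[R]_n) e e0).
by move=> [_ /(_ 0 k)].
Unshelve. all: by end_near. Qed.

Lemma cons_rV_surj (x : 'rV[R]_n.+1) : exists a (y : 'rV[R]_n), x = cons (a, y).
Proof.
exists (uncons_rV (T := measurableTypeR R) x).1, (uncons_rV (T := measurableTypeR R) x).2.
by rewrite -surjective_pairing uncons_rVK.
Qed.

Local Notation leb := (@lebesgue_measure R).

Section tonelli.
Variable F : mE n.+1 -> \bar R.
Hypothesis mF : measurable_fun setT F.
Hypothesis F0 : forall x, (0 <= F x)%E.

Let mFc : measurable_fun setT (F \o cons).
Proof. by apply: measurableT_comp => //; exact: measurable_cons_rV. Qed.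

Let F0c p : (0 <= (F \o cons) p)%E. Proof. exact: F0. Qed.

Lemma integral_rV_prod : (\int[lebesgue_rV R n.+1]_x F x =
  \int[leb \x lebesgue_rV R n]_p (F \o cons) p)%E.
Proof.
by rewrite /= /product_rV ge0_integral_pushforward//; exact: measurable_cons_rV.
Qed.

Lemma integral_rV_cons : (\int[lebesgue_rV R n.+1]_x F x =
  \int[leb]_a \int[lebesgue_rV R n]_y F (cons (a, y)))%E.
Proof. by rewrite integral_rV_prod fubini_tonelli1. Qed.

Lemma integral_rV_cons_sym : (\int[lebesgue_rV R n.+1]_x F x =
  \int[lebesgue_rV R n]_y \int[leb]_a F (cons (a, y)))%E.
Proof. by rewrite integral_rV_prod fubini_tonelli2. Qed.

Lemma measurable_integral_cons :
  measurable_fun setT (fun a : measurableTypeR R => \int[lebesgue_rV R n]_y F (cons (a, y)))%E.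
Proof.
have := measurable_fun_fubini_tonelli_F (m2 := lebesgue_rV R n) _ mFc F0c.
exact.
Qed.

Lemma measurable_integral_cons_sym :
  measurable_fun setT (fun y : mE n => \int[leb]_a F (cons (a, y)))%E.
Proof.
have := measurable_fun_fubini_tonelli_G (m1 := leb) _ mFc F0c.
exact.
Qed.

End tonelli.
End cons_rV.

Lemma measurable_cbox (R : realType) (k : nat) (L : R) : @measurable _ 'rV[measurableTypeR R]_k
  (cbox (fun=> - L) (fun=> L)).
Proof.
have -> : cbox (fun=> - L) (fun=> L) = ~` [set x : 'rV[R]_k | exists i, x 0 i < - L] `&`
    ~` [set x : 'rV[R]_k | exists i, L < x 0 i].
  apply/seteqP; split => x.
    by move=> h; split => -[j]; have /andP[h1 h2] := h j; rewrite ltNge ?h1 ?h2.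
  move=> [h1 h2] i; apply/andP; split; rewrite leNgt; apply/negP => h3.
    by apply: h1; exists i.
  by apply: h2; exists i.
apply: measurableI; apply: measurableC; apply: open_measurable_rV.
  rewrite (_ : [set x | _] = \bigcup_(i in setT) [set x : 'rV[R]_k | x 0 i < - L]); last first.
    by apply/seteqP; split => x [j]; exists j.
  apply: bigcup_open => i _.
  apply: (@open_comp _ _ (fun x : 'rV[R]_k => x 0 i) [set y | y < - L]); last exact: open_lt.
  by move=> x _; exact: coord_continuous.
rewrite (_ : [set x | _] = \bigcup_(i in setT) [set x : 'rV[R]_k | L < x 0 i]); last first.
  by apply/seteqP; split => x [j]; exists j.
by apply: bigcup_open => i _; exact: open_coord_gt.
Qed.

Lemma lebesgue_rV_cbox (R : realType) (n : nat) (L : R) :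
  (lebesgue_rV R n (cbox (fun=> - L)%R (fun=> L)) < +oo)%E.
Proof.
(* In dimension 0 the measure is a Dirac mass, which is finite on every set. *)
elim: n => [|n IH]; first exact: (ltry (\1_(cbox (fun=> - L) (fun=> L)) (\row_i 0 : 'rV[R]_0))).
rewrite /= /product_rV /pushforward.
have -> : @cons_rV _ (measurableTypeR R) n @^-1` (cbox (fun=> - L) (fun=> L)) =
    [set` `[- L, L]] `*` cbox (fun=> - L) (fun=> L).
  apply/seteqP; split => -[a y] /=.
    move=> h; split => /=.
      by have := h ord0; rewrite mxE unlift_none in_itv.
    by move=> i; have := h (lift ord0 i); rewrite mxE liftK.
  move=> [/= h1 h2] i; rewrite mxE; case: (unliftP ord0 i) => [k _|_]; first exact: h2.
  by move: h1; rewrite in_itv.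
rewrite product_measure1E//; last exact: measurable_cbox.
have fl : (lebesgue_measure ([set` `[- L, L]%R] : set R) < +oo)%E.
  by rewrite lebesgue_measure_itv/=; case: ifP; rewrite ?ltry// -EFinD ltry.
rewrite lte_mul_pinfty//.
by rewrite ge0_fin_numE//; exact: fl.
Qed.

(** * Functions supported in a box: inequalities by integration along lines *)

Section compactly_supported.
Context (R : realType).
Local Notation mE k := 'rV[measurableTypeR R]_k.
Local Notation leb := (@lebesgue_measure R).
Local Notation cons := (@cons_rV _ (measurableTypeR R) _).

Definition box_supported k (L : R) (h : 'rV[R]_k -> R) :=
  continuous h /\ forall x, ~ cbox (fun=> - L) (fun=> L) x -> h x = 0.

(** The partial derivatives are a parameter [g], so that a slice of [f] comes with the matching
    slices of [g] and no derivative has to be recomputed. *)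
Definition C1_box_supported k L (f : 'rV[R]_k -> R) (g : 'I_k -> 'rV[R]_k -> R) :=
  [/\ box_supported L f, forall i, box_supported L (g i) &
      forall i x, is_derive x (delta_mx 0 i : 'rV[R]_k) f (g i x)].

Lemma box_supportedM k L (h1 h2 : 'rV[R]_k -> R) :
  box_supported L h1 -> box_supported L h2 -> box_supported L (fun x => h1 x * h2 x).
Proof.
move=> [c1 s1] [c2 s2]; split; first exact: continuousM_fun.
by move=> x nx; rewrite s1// mul0r.
Qed.

Lemma box_supported_norm k L (h : 'rV[R]_k -> R) :
  box_supported L h -> box_supported L (fun x => `|h x|).
Proof.
move=> [c1 s1]; split; last by move=> x nx; rewrite s1// normr0.
exact: (continuous_comp_fun (@norm_continuous _ R^o) c1).
Qed.

Lemma box_supported_bounded k L (h : 'rV[R]_k -> R) : box_supported L h ->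
  exists2 M, 0 <= M & forall x, `|h x| <= M.
Proof.
move=> [ch sh].
have : compact (h @` cbox (fun=> - L) (fun=> L)).
  apply: continuous_compact; last exact: cbox_compact.
  exact: continuous_subspaceT.
move=> /compact_bounded[M [_ HM]].
exists (Num.max 0 (M + 1)); first by rewrite le_max lexx.
move=> x; rewrite le_max; have [hx|/sh ->] := pselect (cbox (fun=> - L) (fun=> L) x); last first.
  by rewrite normr0 lexx.
by apply/orP; right; apply: (HM (M + 1)); [lra|exists x].
Qed.

Lemma box_supported_integrable k L (h : 'rV[R]_k -> R) : box_supported L h ->
  (lebesgue_rV R k).-integrable [set: mE k] (EFin \o h).
Proof.
move=> Ch; have [M M0 HM] := box_supported_bounded Ch.
pose B : set (mE k) := cbox (fun=> - L) (fun=> L).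
have mB : measurable B by exact: measurable_cbox.
have -> : EFin \o h = (EFin \o h) \_ B.
  apply/funext => x; rewrite patchE; case: ifPn => // /negP; rewrite inE => nx.
  by rewrite /= Ch.2.
rewrite -integrable_mkcond//; apply: measurable_bounded_integrable => //.
- exact: lebesgue_rV_cbox.
- by apply: continuous_measurable_rV_in => //; exact: Ch.1.
- by exists M; split; [exact: num_real|move=> M' MM' x _ /=; exact: le_trans (HM x) (ltW MM')].
Qed.

Lemma box_supported_sqintegrable k L (h : 'rV[R]_k -> R) : box_supported L h ->
  sqintegrable (lebesgue_rV R k) [set: mE k] h.
Proof.
move=> Ch; split; first exact: continuous_measurable_rV Ch.1.
exact: (box_supported_integrable (box_supportedM Ch Ch)).
Qed.

Lemma box_supported_slice k L (h : 'rV[R]_k.+1 -> R) a : box_supported L h ->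
  box_supported L (fun y : 'rV[R]_k => h (cons (a, y))).
Proof.
move=> [ch sh]; split.
  by move=> y; apply: (cvg_comp _ _ (@continuous_cons_r _ _ a y)); exact: ch.
move=> y ny; apply: sh => h1; apply: ny => i.
by have := h1 (lift ord0 i); rewrite mxE liftK.
Qed.

Lemma C1_box_supported_slice k L (f : 'rV[R]_k.+1 -> R) g a : C1_box_supported L f g ->
  C1_box_supported L (fun y : 'rV[R]_k => f (cons (a, y)))
    (fun i y => g (lift ord0 i) (cons (a, y))).
Proof.
move=> [Cf Cg df]; split; first exact: box_supported_slice.
  by move=> i; exact: box_supported_slice.
move=> i y; apply/is_derive_line0.
under eq_fun do rewrite cons_rV_slice.
exact: (iffLR (@is_derive_line0 R _ f _ _ _) (df _ _)).
Qed.

Lemma line_derive k (f : 'rV[R]_k.+1 -> R) (g : 'I_k.+1 -> 'rV[R]_k.+1 -> R) (s : R)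
  (y : 'rV[R]_k) : (forall i x, is_derive x (delta_mx 0 i : 'rV[R]_k.+1) f (g i x)) ->
  is_derive s (1 : R) (fun s : R => f (cons (s, y))) (g ord0 (cons (s, y))).
Proof.
move=> df.
have := df ord0 (cons (s, y)).
rewrite -[s in cons (s, _)]addr0 cons_rV_line => /is_derive_line.
by under eq_fun do rewrite -cons_rV_line addr0.
Qed.

(** The square of [f] is the integral of its derivative from a point where [f] vanishes; the
    right-hand side no longer depends on the first coordinate. *)
Lemma line_sqr_le k L (f : 'rV[R]_k.+1 -> R) g (t : R) (y : 'rV[R]_k) : C1_box_supported L f g ->
  ((f (cons (t, y)) ^+ 2)%:E <=
    \int[leb]_s `|2 * (f (cons (s, y)) * g ord0 (cons (s, y)))|%:E)%E.
Proof.
move=> [Cf Cg df].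
pose p (s : R) := f (cons (s, y)); pose q (s : R) := g ord0 (cons (s, y)).
have dp (s : R) : is_derive s (1 : R) p (q s) := line_derive s y df.
have cp : continuous p.
  by move=> s; apply: (cvg_comp _ _ (@continuous_cons_l _ _ y s)); exact: Cf.1.
have cq : continuous q.
  by move=> s; apply: (cvg_comp _ _ (@continuous_cons_l _ _ y s)); exact: (Cg ord0).1.
(* A starting point to the left of both the support and [t]. *)
pose a := Num.min (- L) t - 1.
have at' : a < t.
  have : Num.min (- L) t <= t by rewrite ge_min lexx orbT.
  by rewrite /a; lra.
have pa : p a = 0.
  apply: Cf.2 => /(_ ord0); rewrite mxE unlift_none => /andP[h _].
  have : Num.min (- L) t <= - L by rewrite ge_min lexx.
  by move: h; rewrite /a/=; lra.
have dp2 (s : R) : is_derive s (1 : R) (fun s => p s * p s) (2 * (p s * q s)).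
  apply: (is_derive_eq (is_deriveM_fun (dp s) (dp s))); ring.
have cpq : continuous (fun s => 2 * (p s * q s)).
  by apply: continuousZ_fun; exact: continuousM_fun.
have := @continuous_FTC2 R (fun s => 2 * (p s * q s)) (fun s => p s * p s) a t at'.
move=> /(_ _ _ _) h.
have {h} : (\int[leb]_(s in `[a, t]) (2 * (p s * q s))%:E = (p t * p t)%:E - (p a * p a)%:E)%E.
  apply: h.
  - exact: continuous_subspaceT.
  - have cpp : continuous (fun s => p s * p s) by exact: continuousM_fun.
    split.
    + by move=> s _; have [] := dp2 s.
    + by apply: cvg_at_right_filter; exact: cpp.
    + by apply: cvg_at_left_filter; exact: cpp.
  - by move=> s _; rewrite derive1E; exact: derive_val.
rewrite pa mul0r sube0 -expr2 => <-.
have mpq (A : set R) : measurable A -> measurable_fun A (fun s => (2 * (p s * q s))%:E).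
  move=> mA; apply/measurable_EFinP; apply: (@measurable_funS _ _ _ _ setT) => //.
  exact: continuous_measurable_fun.
apply: (le_trans (lee_abs _)); apply: (le_trans (le_abse_integral _ _ _)) => //; first exact: mpq.
apply: (@ge0_subset_integral _ _ _ leb `[a, t]%classic setT) => //.
by apply: measurableT_comp => //; exact: mpq.
Qed.

Local Notation S k h := (rip (lebesgue_rV R k) [set: mE k] h h).

Lemma box_supported_sqr_EFin k L (h : 'rV[R]_k -> R) : box_supported L h ->
  (\int[lebesgue_rV R k]_x (h x ^+ 2)%:E = (S k h)%:E)%E.
Proof.
move=> Ch; apply: Rintegral_EFin => //; exact: (box_supported_integrable (box_supportedM Ch Ch)).
Qed.

Lemma measurable_box_supported k L (h : 'rV[R]_k -> R) : box_supported L h ->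
  measurable_fun [set: mE k] h.
Proof. by move=> [ch _]; exact: continuous_measurable_rV. Qed.

Lemma measurable_abs_prod k L (f g : 'rV[R]_k -> R) : box_supported L f -> box_supported L g ->
  measurable_fun [set: mE k] (fun x => `|2 * (f x * g x)|%:E).
Proof.
move=> Cf Cg; apply/measurable_EFinP; apply: measurableT_comp => //.
apply: measurable_funM => //; apply: measurable_funM.
  exact: (measurable_box_supported Cf).
exact: (measurable_box_supported Cg).
Qed.

Lemma measurable_pow k L (f : 'rV[R]_k -> R) m : box_supported L f ->
  measurable_fun [set: mE k] (fun x => (f x ^+ m)%:E).
Proof.
by move=> Cf; apply/measurable_EFinP/measurable_funX; exact: (measurable_box_supported Cf).
Qed.

(** Young's inequality with a free weight: 1 for the quartic bounds, a small weight for the Poincaré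
    inequality, where the [f] term has to be absorbed. *)
Lemma integral_abs_prod_le k L (f g : 'rV[R]_k -> R) (e : R) : 0 < e ->
  box_supported L f -> box_supported L g ->
  (\int[lebesgue_rV R k]_x `|2 * (f x * g x)|%:E <= (e * S k f + e^-1 * S k g)%:E)%E.
Proof.
move=> e0 Cf Cg.
have f2 := box_supported_integrable (box_supportedM Cf Cf).
have g2 := box_supported_integrable (box_supportedM Cg Cg).
rewrite -RintegralZl// -RintegralZl// -RintegralD//; last 2 first.
  exact: integrableZ_real.
  exact: integrableZ_real.
rewrite -Rintegral_EFin//; last by apply: integrableD_real => //; exact: integrableZ_real.
apply: ge0_le_integral => //.
- exact: measurable_abs_prod Cf Cg.
- have i2 : (lebesgue_rV R k).-integrable [set: mE k] (EFin \o (fun x => e * (f x * f x) + e^-1 *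
  (g x * g x))).
    by apply: integrableD_real => //; exact: integrableZ_real.
  exact: (measurable_int _ i2).
- move=> x _; rewrite lee_fin -(ler_pM2l e0) mulrDr [e * (e^-1 * _)]mulrA divff ?gt_eqF// mul1r.
  rewrite -!expr2 -[f x ^+ 2]real_normK ?num_real// -[g x ^+ 2]real_normK ?num_real//.
  rewrite !normrM normr_nat; have := sqr_ge0 (e * `|f x| - `|g x|); nra.
Qed.

(** In dimension 1 the transversal factor is the one-point space with its Dirac mass, so the line
    integral is already the full integral. *)
Lemma line_sqr_le1 L (f : 'rV[R]_1 -> R) g (y : 'rV[R]_1) : C1_box_supported L f g ->
  ((f y ^+ 2)%:E <= \int[lebesgue_rV R 1]_z `|2 * (f z * g ord0 z)|%:E)%E.
Proof.
move=> C; have [Cf Cg _] := C.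
rewrite integral_rV_cons//; last exact: measurable_abs_prod Cf (Cg ord0).
have [t [y0 ->]] := cons_rV_surj y.
apply: (le_trans (line_sqr_le t y0 C)).
rewrite le_eqVlt; apply/orP; left; apply/eqP; apply: eq_integral => s _.
have h := measurableT_comp (measurable_abs_prod Cf (Cg ord0)) (measurable_cons_rV
  (T:=measurableTypeR R)(n:=0)).
rewrite /= integral_dirac//=.
  by rewrite diracT mul1e; congr (EFin `|2 * (f (cons (s, _)) * g ord0 (cons (s, _)))|); rewrite
    (thinmx0 y0) [RHS]thinmx0.
by apply: (measurableT_comp h); exact: pair1_measurable.
Qed.

(** Write [f ^+ 4] as a product of two squares. Integration along one axis bounds a square by a
    function of the other coordinate alone; using one axis for each factor makes the double integral
    split into a product. *)
Lemma ladyzhenskaya2_prod L (f : 'rV[R]_2 -> R) g : C1_box_supported L f g ->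
  (\int[lebesgue_rV R 2]_x (f x ^+ 4)%:E <=
    (\int[lebesgue_rV R 2]_x `|2 * (f x * g ord0 x)|%:E) *
    (\int[lebesgue_rV R 2]_x `|2 * (f x * g (lift ord0 ord0) x)|%:E))%E.
Proof.
move=> C; have [Cf Cg _] := C.
have m0 := measurable_abs_prod Cf (Cg ord0).
have m1 := measurable_abs_prod Cf (Cg (lift ord0 ord0)).
rewrite integral_rV_cons//; last 2 first.
  exact: measurable_pow Cf.
  by move=> x; rewrite lee_fin exprn_even_ge0.
rewrite [X in (_ <= X * _)%E]integral_rV_cons_sym// [X in (_ <= _ * X)%E]integral_rV_cons//.
set B := (\int[lebesgue_rV R 1]_y _)%E.
set A := fun a : measurableTypeR R => (\int[lebesgue_rV R 1]_y
  `|2 * (f (cons (a, y)) * g (lift ord0 ord0) (cons (a, y)))|%:E)%E.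
have mA : measurable_fun setT A by exact: (measurable_integral_cons m1).
have A0 a : (0 <= A a)%E by exact: integral_ge0.
have mB := measurable_integral_cons_sym m0 (fun _ => _ : (0 <= _)%E).
have {}mB := mB (fun x => abse_ge0 (2 * (f x * g ord0 x))%:E).
have B0 : (0 <= B)%E by apply: integral_ge0 => y _; exact: integral_ge0.
rewrite -ge0_integralZl//; last by move=> a _; exact: A0.
have mF := measurable_integral_cons (measurable_pow 4 Cf)
  (fun x => _ : (0 <= (f x ^+ 4)%:E)%E).
have {}mF := mF (fun x => ltac:(by rewrite lee_fin exprn_even_ge0)).
apply: ge0_le_integral => //.
- by move=> a _; apply: integral_ge0 => y _; rewrite lee_fin exprn_even_ge0.
- by apply: emeasurable_funM => //; exact: measurable_cst.
move=> a _; have Aa := A0 a; rewrite muleC /B -ge0_integralZl//; last by move=> y _; exact: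
  integral_ge0.
apply: ge0_le_integral => //.
- by move=> y _; rewrite lee_fin exprn_even_ge0.
- exact: (measurable_pow 4 (box_supported_slice a Cf)).
- by apply: emeasurable_funM => //; exact: measurable_cst.
move=> y _; rewrite (_ : f _ ^+ 4 = f (cons (a, y)) ^+ 2 * f (cons (a, y)) ^+ 2); last by rewrite
  -exprD.
rewrite EFinM; apply: lee_pmul; rewrite ?lee_fin ?sqr_ge0//.
  exact: (line_sqr_le1 y (C1_box_supported_slice a C)).
exact: (line_sqr_le a y C).
Qed.

Lemma integral_slice_sqr_le k L (f : 'rV[R]_k.+1 -> R) g (a : R) : C1_box_supported L f g ->
  (\int[lebesgue_rV R k]_y (f (cons (a, y)) ^+ 2)%:E <=
   \int[lebesgue_rV R k.+1]_x `|2 * (f x * g ord0 x)|%:E)%E.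
Proof.
move=> C; have [Cf Cg _] := C.
have m0 := measurable_abs_prod Cf (Cg ord0).
rewrite integral_rV_cons_sym//; apply: ge0_le_integral => //.
- by move=> y _; rewrite lee_fin sqr_ge0.
- exact: (measurable_pow 2 (box_supported_slice a Cf)).
- exact: (measurable_integral_cons_sym m0).
- by move=> y _; exact: (line_sqr_le a y C).
Qed.

Lemma ladyzhenskaya2 L (f : 'rV[R]_2 -> R) g : C1_box_supported L f g ->
  (\int[lebesgue_rV R 2]_x (f x ^+ 4)%:E <=
    (2 * (S 2 f + \sum_i S 2 (g i)) ^+ 2)%:E)%E.
Proof.
move=> C; have [Cf Cg _] := C.
apply: (le_trans (ladyzhenskaya2_prod C)).
have h0 := integral_abs_prod_le ltr01 Cf (Cg ord0).
have h1 := integral_abs_prod_le ltr01 Cf (Cg (lift ord0 ord0)).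
rewrite invr1 !mul1r in h0 h1.
apply: (@le_trans _ _ ((S 2 f + S 2 (g ord0))%:E * (S 2 f + S 2 (g (lift ord0 ord0)))%:E)%E).
  by apply: lee_pmul => //; exact: integral_ge0.
rewrite -EFinM lee_fin 2!big_ord_recl big_ord0 addr0.
have f0 : 0 <= S 2 f by exact: rip_ge0.
have g0 : 0 <= S 2 (g ord0) by exact: rip_ge0.
have g1 : 0 <= S 2 (g (lift ord0 ord0)) by exact: rip_ge0.
nra.
Qed.

(* Slicing: on each plane the two-dimensional inequality gives
   [(int f^4) <= a b] with [a^2 <= 4 (int f^2) (int g_i^2)], and the integral of
   [f^2] over the plane is bounded uniformly by the integral along the normals. *)
Lemma ladyzhenskaya3 L (f : 'rV[R]_3 -> R) g : C1_box_supported L f g ->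
  (\int[lebesgue_rV R 3]_x (f x ^+ 4)%:E <=
    (2 * (S 3 f + \sum_i S 3 (g i)) ^+ 2)%:E)%E.
Proof.
move=> C; have [Cf Cg _] := C.
have h0 := integral_abs_prod_le ltr01 Cf (Cg ord0); rewrite invr1 !mul1r in h0.
set c := S 3 f + S 3 (g ord0) in h0.
have f0 : 0 <= S 3 f by exact: rip_ge0.
have g0 i : 0 <= S 3 (g i) by exact: rip_ge0.
have c0 : 0 <= c by rewrite addr_ge0.
pose g1 := g (lift ord0 ord0); pose g2 := g (lift ord0 (lift ord0 ord0)).
have Cg1 : box_supported L g1 by exact: Cg.
have Cg2 : box_supported L g2 by exact: Cg.
have i1 := box_supported_integrable (box_supportedM Cg1 Cg1).
have i2 := box_supported_integrable (box_supportedM Cg2 Cg2).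
(* On a plane the two factors satisfy [r ^+ 2 <= 4 * c * S 2 h] with [h] the slice of [g1] or [g2];
   since [r1 * r2 <= (r1 ^+ 2 + r2 ^+ 2) / 2], the product is at most the integral of [H] over the
   plane. *)
pose H x := 2 * c * (g1 x * g1 x + g2 x * g2 x).
have H0 x : (0 <= (H x)%:E)%E.
  by rewrite lee_fin mulr_ge0 ?mulr_ge0// addr_ge0// -expr2 sqr_ge0.
have iH : (lebesgue_rV R 3).-integrable [set: mE 3] (EFin \o H).
  by apply: integrableZ_real => //; exact: integrableD_real.
have mH : measurable_fun [set: mE 3] (fun x => (H x)%:E) := measurable_int _ iH.
apply: (@le_trans _ _ (\int[lebesgue_rV R 3]_x (H x)%:E)%E); last first.
  rewrite Rintegral_EFin// lee_fin /H RintegralZl//; last exact: integrableD_real.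
  rewrite RintegralD// -!/(rip _ _ _ _) /c 3!big_ord_recl big_ord0 addr0.
  have := g0 ord0; have := g0 (lift ord0 ord0); have := g0 (lift ord0 (lift ord0 ord0)).
  rewrite -/g1 -/g2; move: f0; nra.
have f40 x : (0 <= (f x ^+ 4)%:E)%E by rewrite lee_fin exprn_even_ge0.
rewrite integral_rV_cons//; last exact: measurable_pow Cf.
rewrite integral_rV_cons//.
apply: ge0_le_integral => //.
- by move=> a _; exact: integral_ge0.
- exact: (measurable_integral_cons (measurable_pow 4 Cf)).
- exact: (measurable_integral_cons mH).
move=> a _.
have Ca := C1_box_supported_slice a C.
apply: (le_trans (ladyzhenskaya2_prod Ca)).
pose fa := fun y : 'rV[R]_2 => f (cons (a, y)).
have Cfa : box_supported L fa := box_supported_slice a Cf.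
have fac : S 2 fa <= c.
  rewrite -lee_fin -(box_supported_sqr_EFin Cfa).
  exact: (le_trans (integral_slice_sqr_le a C) h0).
have key (h : 'rV[R]_2 -> R) : box_supported L h ->
    exists2 r : R, 0 <= r /\ r ^+ 2 <= 4 * c * S 2 h &
    (\int[lebesgue_rV R 2]_y `|2 * (fa y * h y)|%:E = r%:E)%E.
  move=> Ch.
  pose p := rip (lebesgue_rV R 2) [set: mE 2] (fun y => `|fa y|) (fun y => `|h y|).
  have Cn := box_supported_norm Cfa; have Chn := box_supported_norm Ch.
  have p0 : 0 <= p by apply: Rintegral_ge0 => y _; exact: mulr_ge0.
  exists (2 * p).
    split; first exact: mulr_ge0.
    have := rip_CS measurableT (box_supported_sqintegrable Cn) (box_supported_sqintegrable Chn).
    rewrite -/p.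
    have e (u : 'rV[R]_2 -> R) : S 2 (fun y => `|u y|) = S 2 u.
      by apply: eq_Rintegral => y _; rewrite -normrM ger0_norm// -expr2 sqr_ge0.
    rewrite !e => pp.
    have : 0 <= S 2 h by exact: rip_ge0.
    nra.
  rewrite -RintegralZl//; last exact: (box_supported_integrable (box_supportedM Cn Chn)).
  rewrite -Rintegral_EFin//; last first.
    by apply: integrableZ_real => //; exact: (box_supported_integrable (box_supportedM Cn Chn)).
  by apply: eq_integral => y _; rewrite !normrM normr_nat.
have C1a : box_supported L (fun y : 'rV[R]_2 => g1 (cons (a, y))) := box_supported_slice a Cg1.
have C2a : box_supported L (fun y : 'rV[R]_2 => g2 (cons (a, y))) := box_supported_slice a Cg2.
have [r1 [r10 r1c] e1] := key _ C1a; have [r2 [r20 r2c] e2] := key _ C2a.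
rewrite [X in (X * _)%E](_ : _ = r1%:E)//  [X in (_ * X)%E](_ : _ = r2%:E)//.
have j1 := box_supported_integrable (box_supportedM C1a C1a).
have j2 := box_supported_integrable (box_supportedM C2a C2a).
rewrite [X in (_ <= X)%E]Rintegral_EFin//; last first.
  by apply: integrableZ_real => //; exact: integrableD_real.
rewrite -EFinM lee_fin /H RintegralZl//; last exact: integrableD_real.
rewrite RintegralD// -!/(rip _ _ _ _).
have := sqr_ge0 (r1 - r2); nra.
Qed.

(** Each slice orthogonal to the first axis has square norm at most the integral of [|2 f g|] over
    the whole space, and only slices over an interval of length [2 * L] contribute. *)
Lemma poincare_box k L (f : 'rV[R]_k.+1 -> R) g : 0 < L -> C1_box_supported L f g ->
  S k.+1 f <= 16 * L ^+ 2 * S k.+1 (g ord0).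
Proof.
move=> L0 C; have [Cf Cg _] := C.
have m0 := measurable_abs_prod Cf (Cg ord0).
suff : ((S k.+1 f)%:E <= (2 * L)%:E * \int[lebesgue_rV R k.+1]_x `|2 * (f x * g ord0 x)|%:E)%E.
  move=> h.
  (* With this weight the [f] term has coefficient [2 * L / (4 * L) = 1 / 2] and moves to the left;
     the [g] term has [2 * L * (4 * L)], which doubles to [16 * L ^+ 2]. *)
  have e0 : 0 < (4 * L)^-1 by rewrite invr_gt0 mulr_gt0.
  have L2 : (0 <= (2 * L)%:E)%E by rewrite lee_fin mulr_ge0// ltW.
  have := le_trans h (lee_wpmul2l L2 (integral_abs_prod_le e0 Cf (Cg ord0))).
  rewrite -EFinM lee_fin invrK mulrDr [2 * L * (_ * S _ f)]mulrA.
  rewrite (_ : 2 * L * (4 * L)^-1 = 2^-1); last by field; rewrite gt_eqF.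
  lra.
set I := (\int[_]_x _)%E.
rewrite -(box_supported_sqr_EFin Cf).
have f20 x : (0 <= (f x ^+ 2)%:E)%E by rewrite lee_fin sqr_ge0.
have mf2 := measurable_pow 2 Cf.
rewrite integral_rV_cons//.
pose J : set (measurableTypeR R) := [set` `[- L, L]%R].
have mJ : measurable J by exact: measurable_itv.
have -> : (\int[leb]_a \int[lebesgue_rV R k]_y (f (cons (a, y)) ^+ 2)%:E =
    \int[leb]_(a in J) \int[lebesgue_rV R k]_y (f (cons (a, y)) ^+ 2)%:E)%E.
  rewrite [RHS]integral_mkcond; apply: eq_integral => a _; rewrite patchE.
  case: ifPn => // /negP; rewrite inE => na.
  rewrite integral0_eq// => y _; rewrite Cf.2 ?expr0n//.
  move=> h; apply: na; rewrite /J /= in_itv/=.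
  by have := h ord0; rewrite mxE unlift_none.
apply: (@le_trans _ _ (\int[leb]_(a in J) (cst I) a)%E).
  apply: ge0_le_integral => //.
  - by move=> a _; exact: integral_ge0.
  - apply: measurable_funS (measurable_integral_cons mf2 f20) => //.
  - by move=> a _; exact: (integral_slice_sqr_le a C).
have lJ : (@lebesgue_measure R ([set` `[- L, L]%R] : set R) = (2 * L)%:E)%E.
  have LL : - L < L by lra.
  by rewrite lebesgue_measure_itv/= lte_fin LL -EFinD; congr EFin; ring.
rewrite integral_cst// [X in (_ * X <= _)%E](_ : _ = (2 * L)%:E); last exact: lJ.
by rewrite muleC.
Qed.

Lemma ladyzhenskaya k L (f : 'rV[R]_k.+2 -> R) g : k.+2 = 2%N \/ k.+2 = 3%N ->
  C1_box_supported L f g ->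
  (\int[lebesgue_rV R k.+2]_x (f x ^+ 4)%:E <=
    (2 * (S k.+2 f + \sum_i S k.+2 (g i)) ^+ 2)%:E)%E.
Proof.
by case=> -[k0]; subst k; [exact: ladyzhenskaya2|exact: ladyzhenskaya3].
Qed.

End compactly_supported.

(** * Complex square-integrable functions *)

Section complex_numbers.
Context (R : rcfType).
Implicit Types x y : R[i].

Lemma ReM x y : complex.Re (x * y) = complex.Re x * complex.Re y - complex.Im x * complex.Im y.
Proof. by case: x y => [a b] [c d]. Qed.

Lemma ImM x y : complex.Im (x * y) = complex.Re x * complex.Im y + complex.Im x * complex.Re y.
Proof. by case: x y => [a b] [c d]. Qed.

Lemma ReD x y : complex.Re (x + y) = complex.Re x + complex.Re y.
Proof. by case: x y => [a b] [c d]. Qed.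

Lemma ImD x y : complex.Im (x + y) = complex.Im x + complex.Im y.
Proof. by case: x y => [a b] [c d]. Qed.

Lemma ReN x : complex.Re (- x) = - complex.Re x. Proof. by case: x. Qed.
Lemma ImN x : complex.Im (- x) = - complex.Im x. Proof. by case: x. Qed.

Lemma ReJ x : complex.Re (conjc x) = complex.Re x. Proof. by case: x. Qed.
Lemma ImJ x : complex.Im (conjc x) = - complex.Im x. Proof. by case: x. Qed.

Lemma normc_sqr x : Normc.normc x ^+ 2 = complex.Re x ^+ 2 + complex.Im x ^+ 2.
Proof. by case: x => a b /=; rewrite sqr_sqrtr// addr_ge0// sqr_ge0. Qed.

Lemma complex_eqP x y : complex.Re x = complex.Re y -> complex.Im x = complex.Im y -> x = y.
Proof. by case: x y => [a b] [c d] /= -> ->. Qed.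

Definition cplxE := (ReM, ImM, ReD, ImD, ReN, ImN, ReJ, ImJ).

End complex_numbers.

Section complex_L2.
Context (R : realType) (n : nat).
Local Notation E := 'rV[R]_n.
Local Notation mE := 'rV[measurableTypeR R]_n.
Local Notation mu := (lebesgue_rV R n).
Local Notation C := R[i].
Local Notation reC := (@complex.Re R).
Local Notation imC := (@complex.Im R).
Local Notation toC r := (r%:C%C : C).
Variable D : set E.
Hypothesis mD : @measurable _ mE D.
Implicit Types f g h : E -> C.
Local Notation sqi h := (sqintegrable mu (D : set mE) (h : mE -> R)).
Local Notation ripD f g := (rip mu (D : set mE) (f : mE -> R) (g : mE -> R)).

(** The real part of the complex L2 product. Gradients and tangent spaces are real notions, and the
    imaginary part is recovered by pairing with [- 'i%C * g]. *)
Definition cip f g : R :=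
  ripD (fun x => reC (f x)) (fun x => reC (g x)) +
  ripD (fun x => imC (f x)) (fun x => imC (g x)).

Lemma L2P f : L2 D f <-> sqi (fun x => reC (f x)) /\ sqi (fun x => imC (f x)).
Proof.
split.
  move=> [[mr mi] fin].
  have le1 (h : E -> R) : @measurable_fun _ _ mE R D h ->
      (forall x, h x ^+ 2 <= Normc.normc (f x) ^+ 2) -> sqi h.
    move=> mh hle; apply: sqintegrableP => //; apply: le_lt_trans fin.
    apply: ge0_le_integral => //.
    - by move=> x _; rewrite lee_fin sqr_ge0.
    - by apply/measurable_EFinP/measurable_funX.
    - apply/measurable_EFinP; rewrite (_ : (fun x => _) = (fun x => reC (f x) ^+ 2 + imC (f x) ^+
      2)).
        by apply: measurable_funD; apply: measurable_funX.
      by apply/funext => x; rewrite normc_sqr.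
    - by move=> x _; rewrite lee_fin.
  by split; apply: le1 => // x; rewrite normc_sqr ?lerDl ?lerDr sqr_ge0.
move=> [[mr r2] [mi i2]]; split; first by split.
have i3 := integrableD_real mD r2 i2.
rewrite (_ : (fun x => _) = (fun x => (reC (f x) ^+ 2 + imC (f x) ^+ 2)%:E)).
  exact: (integrable_lty mD i3).
by apply/funext => x; rewrite normc_sqr.
Qed.

Lemma L2_lin (c : C) f g : L2 D f -> L2 D g -> L2 D (fun x => f x + c * g x).
Proof.
move=> /L2P[fr fi] /L2P[gr gi]; apply/L2P; split.
  under eq_fun do rewrite ReD ReM.
  by apply: sqintegrableD => //; apply: sqintegrableB => //; exact: sqintegrableZ.
under eq_fun do rewrite ImD ImM.
by apply: sqintegrableD => //; apply: sqintegrableD => //; exact: sqintegrableZ.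
Qed.

Lemma L2_0 : L2 D (fun=> 0).
Proof.
have h : sqi (fun=> 0).
  apply: sqintegrableP; first exact: measurable_cst.
  by under eq_integral do rewrite expr0n/=; rewrite integral0 ltry.
by apply/L2P.
Qed.

Lemma L2Z (c : C) f : L2 D f -> L2 D (fun x => c * f x).
Proof.
move=> fi; have := L2_lin c L2_0 fi.
by under eq_fun do rewrite add0r.
Qed.

Lemma L2B f g : L2 D f -> L2 D g -> L2 D (fun x => f x - g x).
Proof.
move=> fi gi; have := L2_lin (-1) fi gi.
by under eq_fun do rewrite mulN1r.
Qed.

Lemma L2_Mb (b : E -> R) (M : R) f : @measurable_fun _ _ mE R D b ->
  {ae mu, forall x, D x -> `|b x| <= M} -> L2 D f -> L2 D (fun x => toC (b x) * f x).
Proof.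
move=> mb bM /L2P[fr fi]; apply/L2P; split.
  under eq_fun do rewrite ReM/= mul0r subr0.
  exact: sqintegrableMb_ae bM _.
under eq_fun do rewrite ImM/= mul0r addr0.
exact: sqintegrableMb_ae bM _.
Qed.

Lemma cipC f g : cip f g = cip g f.
Proof. by rewrite /cip ripC [X in _ + X]ripC. Qed.

Lemma cip_linl (k : R) f g h : L2 D f -> L2 D g -> L2 D h ->
  cip (fun x => f x + toC k * g x) h = cip f h + k * cip g h.
Proof.
move=> /L2P[fr fi] /L2P[gr gi] /L2P[hr hi]; rewrite /cip.
under [X in rip _ _ X _]eq_fun do rewrite ReD ReM/= mul0r subr0.
under [X in _ + rip _ _ X _]eq_fun do rewrite ImD ImM/= mul0r addr0.
rewrite !ripDl//; try exact: sqintegrableZ.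
by rewrite !ripZl//; ring.
Qed.

Lemma cip_linr (k : R) f g h : L2 D f -> L2 D g -> L2 D h ->
  cip h (fun x => f x + toC k * g x) = cip h f + k * cip h g.
Proof. by move=> *; rewrite cipC cip_linl// ![cip _ h]cipC. Qed.

Lemma cipZl (k : R) f g : L2 D f -> L2 D g -> cip (fun x => toC k * f x) g = k * cip f g.
Proof.
move=> fi gi; have := @cip_linl k (fun=> 0) f g L2_0 fi gi.
under eq_fun do rewrite add0r.
move=> ->; rewrite [X in X + _](_ : _ = 0) ?add0r//.
have := @cip_linl (-1) (fun=> 0) (fun=> 0) g L2_0 L2_0 gi.
under eq_fun do rewrite mulr0 addr0.
by move: (cip _ _) => z; lra.
Qed.

Lemma cipNl f g : L2 D f -> L2 D g -> cip (fun x => - f x) g = - cip f g.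
Proof.
move=> fi gi; rewrite -mulN1r -cipZl//; congr cip; apply/funext => x.
by rewrite rmorphN1 mulN1r.
Qed.

Lemma cipBl f g h : L2 D f -> L2 D g -> L2 D h ->
  cip (fun x => f x - g x) h = cip f h - cip g h.
Proof.
move=> fi gi hi; rewrite -[cip g h]mul1r -mulNr -cip_linl//; congr cip; apply/funext => x.
by rewrite rmorphN1 mulN1r.
Qed.

Lemma cipBr f g h : L2 D f -> L2 D g -> L2 D h ->
  cip h (fun x => f x - g x) = cip h f - cip h g.
Proof. by move=> fi gi hi; rewrite cipC cipBl// (cipC f) (cipC g). Qed.

Lemma cipE f g : L2 D f -> L2 D g ->
  cip f g = \int[mu]_(x in (D : set mE)) (reC (f x) * reC (g x) + imC (f x) * imC (g x)).
Proof.
move=> /L2P[fr fi] /L2P[gr gi].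
by rewrite RintegralD//; exact: sqintegrableM.
Qed.

Lemma cip_il f g : L2 D f -> L2 D g ->
  cip (fun x => 'i%C * f x) g = - cip f (fun x => 'i%C * g x).
Proof.
move=> fi gi; have fi' := L2Z 'i%C fi; have gi' := L2Z 'i%C gi.
rewrite -mulN1r -cipZl// !cipE//; last exact: (L2Z (toC (-1)) fi).
by apply: eq_Rintegral => x _; rewrite !cplxE/=; ring.
Qed.

Lemma cip_ge0 f : 0 <= cip f f.
Proof. by rewrite addr_ge0// rip_ge0. Qed.

Lemma cip_sqrD (k : R) f g : L2 D f -> L2 D g ->
  cip (fun x => f x + toC k * g x) (fun x => f x + toC k * g x) =
  cip f f + 2 * cip f g * k + cip g g * k ^+ 2.
Proof.
move=> fi gi; have hi := L2_lin (toC k) fi gi.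
rewrite cip_linl// !cip_linr// [cip g f]cipC; ring.
Qed.

Lemma cip_CS f g : L2 D f -> L2 D g -> cip f g ^+ 2 <= cip f f * cip g g.
Proof.
move=> fi gi; apply: discr_le; first exact: cip_ge0.
by move=> t; rewrite -cip_sqrD// cip_ge0.
Qed.

Lemma cip_sqrD_le (k : R) f g : L2 D f -> L2 D g ->
  cip (fun x => f x + toC k * g x) (fun x => f x + toC k * g x) <=
  2 * cip f f + 2 * k ^+ 2 * cip g g.
Proof.
move=> fi gi; have := cip_ge0 (fun x => f x + toC (- k) * g x).
by rewrite !cip_sqrD//; lra.
Qed.

Lemma cipZZ (c : C) f : L2 D f ->
  cip (fun x => c * f x) (fun x => c * f x) = Normc.normc c ^+ 2 * cip f f.
Proof.
move=> /L2P[[mr r2] [mi i2]]; rewrite /cip !rip_sqr -!RintegralD//.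
- rewrite -RintegralZl//; last exact: integrableD_real.
  by apply: eq_Rintegral => x _; rewrite !cplxE normc_sqr; ring.
- have := (L2P (fun x => c * f x)).1 (L2Z c _) => /(_ _)[].
    by apply/L2P.
  by move=> [].
- have := (L2P (fun x => c * f x)).1 (L2Z c _) => /(_ _)[].
    by apply/L2P.
  by move=> _ [].
Qed.

Lemma eq_cip_ae f f' g : L2 D f -> L2 D f' -> L2 D g ->
  {ae mu, forall x, D x -> f x = f' x} -> cip f g = cip f' g.
Proof.
move=> /L2P[fr fi] /L2P[fr' fi'] /L2P[gr gi] ff'; rewrite /cip; congr (_ + _).
  by apply: eq_rip_ae => //; apply: aeS ff' => x /= xx Dx; rewrite xx.
by apply: eq_rip_ae => //; apply: aeS ff' => x /= xx Dx; rewrite xx.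
Qed.

Lemma eq_cip_ae2 f f' g g' : L2 D f -> L2 D f' -> L2 D g -> L2 D g' ->
  {ae mu, forall x, D x -> f x = f' x} -> {ae mu, forall x, D x -> g x = g' x} ->
  cip f g = cip f' g'.
Proof.
move=> fi fi' gi gi' ff' gg'.
by rewrite (eq_cip_ae fi fi' gi ff') cipC (eq_cip_ae gi gi' fi' gg') cipC.
Qed.

Lemma Re_L2ip f g : L2 D f -> L2 D g -> reC (L2ip D f g) = cip f g.
Proof.
move=> /L2P[fr fi] /L2P[gr gi]; rewrite /cip /rip -RintegralD//; try exact: sqintegrableM.
by apply: eq_Rintegral => x _; rewrite !cplxE; ring.
Qed.

Lemma Im_L2ip f g : L2 D f -> L2 D g -> imC (L2ip D f g) = cip f (fun x => - 'i%C * g x).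
Proof.
move=> fi gi; have gi' := L2Z (- 'i%C) gi; rewrite -Re_L2ip//.
by apply: eq_Rintegral => x _; rewrite !cplxE/=; ring.
Qed.

Lemma L2norm_sqr f : L2 D f -> L2norm D f ^+ 2 = cip f f.
Proof.
move=> fi; rewrite -Re_L2ip// sqr_sqrtr; last by apply: Rintegral_ge0 => x _; exact: sqr_ge0.
by apply: eq_Rintegral => x _; rewrite normc_sqr !cplxE; ring.
Qed.

Lemma cip_complete (f : nat -> E -> C) : (mu (D : set mE) < +oo)%E ->
  (forall k, L2 D (f k)) ->
  (forall e : R, 0 < e -> exists N, forall j k, (N <= j)%N -> (N <= k)%N ->
    cip (fun x => f j x - f k x) (fun x => f j x - f k x) <= e) ->
  exists2 g, L2 D g &
    forall e : R, 0 < e -> exists N, forall k, (N <= k)%N ->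
      cip (fun x => f k x - g x) (fun x => f k x - g x) <= e.
Proof.
move=> finD fi cf.
have fr k : sqi (fun x => reC (f k x)) by have /L2P[] := fi k.
have fj k : sqi (fun x => imC (f k x)) by have /L2P[] := fi k.
have [|gr gri Hr] := rip_complete mD finD fr.
  move=> e /cf[N HN]; exists N => j k Nj Nk; apply: le_trans (HN j k Nj Nk).
  rewrite /cip; under [X in _ <= X + _]eq_Rintegral do rewrite ReD ReN.
  by rewrite lerDl rip_ge0.
have [|gj gji Hj] := rip_complete mD finD fj.
  move=> e /cf[N HN]; exists N => j k Nj Nk; apply: le_trans (HN j k Nj Nk).
  rewrite /cip; under [X in _ <= _ + X]eq_Rintegral do rewrite ImD ImN.
  by rewrite lerDr rip_ge0.
exists (fun x => Complex (gr x) (gj x)); first by apply/L2P.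
move=> e e0; have e2 : 0 < e / 2 by rewrite divr_gt0.
have [N1 H1] := Hr _ e2; have [N2 H2] := Hj _ e2.
exists (maxn N1 N2) => k; rewrite geq_max => /andP[/H1 h1 /H2 h2].
have -> : cip (fun x => f k x - Complex (gr x) (gj x)) (fun x => f k x - Complex (gr x) (gj x)) =
    ripD (fun x => reC (f k x) - gr x) (fun x => reC (f k x) - gr x) +
    ripD (fun x => imC (f k x) - gj x) (fun x => imC (f k x) - gj x).
  by congr (_ + _); apply: eq_Rintegral => x _; rewrite !cplxE.
by rewrite [e]splitr lerD.
Qed.

End complex_L2.

(** * Test functions *)

Lemma bounded_set_cbox (R : realType) (n : nat) (D : set 'rV[R]_n) : bounded_set D ->
  exists2 L, 0 < L & D `<=` cbox (fun=> - L) (fun=> L).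
Proof.
move=> [M [_ HM]]; pose L := Num.max M 0 + 2.
have M0 : 0 <= Num.max M 0 by rewrite le_max lexx orbT.
have MM : M <= Num.max M 0 by rewrite le_max lexx.
exists L; first by rewrite /L; lra.
move=> x Dx i.
have h : `|x| <= Num.max M 0 + 1 by apply: (HM (Num.max M 0 + 1)) => //; lra.
have : ball (0 : 'rV[R]_n) L x.
  by rewrite -ball_normE /ball_/= sub0r normrN /L; lra.
by move=> [_ /(_ 0 i)]; rewrite /ball/= mxE sub0r normrN ltr_norml => /andP[/ltW -> /ltW ->].
Qed.

(** * Derivatives of compactly supported functions have integral zero *)

Section integral_derivative.
Context (R : realType).
Local Notation mE k := 'rV[measurableTypeR R]_k.
Local Notation leb := (@lebesgue_measure R).
Local Notation cons := (@cons_rV _ (measurableTypeR R) _).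

Lemma integral_line_deriv0 k L (f : 'rV[R]_k.+1 -> R) g (y : 'rV[R]_k) : C1_box_supported L f g ->
  (\int[leb]_s (g ord0 (cons (s, y)))%:E = 0)%E.
Proof.
move=> [Cf Cg df].
pose p (s : R) := f (cons (s, y)); pose q (s : R) := g ord0 (cons (s, y)).
have dp (s : R) : is_derive s (1 : R) p (q s) := line_derive s y df.
have cp : continuous p.
  by move=> s; apply: (cvg_comp _ _ (@continuous_cons_l _ _ y s)); exact: Cf.1.
have cq : continuous q.
  by move=> s; apply: (cvg_comp _ _ (@continuous_cons_l _ _ y s)); exact: (Cg ord0).1.
(* The sign of [L] is unknown here; with its absolute value the interval is nonempty and its end
   points lie outside the support. *)
pose a := - `|L| - 1; pose b := `|L| + 1.
have L0 := normr_ge0 L; have LL := ler_norm L; have LN := ler_norm (- L).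
rewrite normrN in LN.
have ab : a < b by rewrite /a /b; lra.
have out (h : 'rV[R]_k.+1 -> R) s : box_supported L h -> ~~ (a < s < b) -> h (cons (s, y)) = 0.
  move=> [_ sh] /negP ns; apply: sh => /(_ ord0); rewrite mxE unlift_none/= => /andP[h1 h2].
  by apply: ns; rewrite /a /b; apply/andP; split; lra.
have := @continuous_FTC2 R q p a b ab.
move=> /(_ _ _ _) h.
have {h} : (\int[leb]_(s in `[a, b]) (q s)%:E = (p b)%:E - (p a)%:E)%E.
  apply: h.
  - exact: continuous_subspaceT.
  - split.
    + by move=> s _; have [] := dp s.
    + by apply: cvg_at_right_filter; exact: cp.
    + by apply: cvg_at_left_filter; exact: cp.
  - by move=> s _; rewrite derive1E; exact: derive_val.
rewrite /p !out ?ltxx ?andbF// sube0 => e0; rewrite -[RHS]e0.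
rewrite [RHS]integral_mkcond; apply: eq_integral => s _; rewrite patchE.
case: ifPn => // /negP; rewrite inE/= in_itv/= => ns.
rewrite out//; apply/negP => /andP[h1 h2]; apply: ns.
by rewrite (ltW h1) (ltW h2).
Qed.

Lemma integral_rV_cons_integrable k L (h : 'rV[R]_k.+1 -> R) : box_supported L h ->
  (\int[lebesgue_rV R k.+1]_x (h x)%:E =
    \int[leb]_a \int[lebesgue_rV R k]_y (h (cons (a, y)))%:E)%E /\
  (\int[lebesgue_rV R k.+1]_x (h x)%:E =
    \int[lebesgue_rV R k]_y \int[leb]_a (h (cons (a, y)))%:E)%E.
Proof.
move=> Ch.
have mh : measurable_fun [set: mE k.+1] (EFin \o h).
  by apply/measurable_EFinP; exact: (measurable_box_supported Ch).
have ih : (leb \x lebesgue_rV R k)%E.-integrable setT ((EFin \o h) \o cons).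
  apply/integrableP; split.
    by apply: measurableT_comp => //; exact: measurable_cons_rV.
  have /integrableP[_] := box_supported_integrable Ch.
  rewrite integral_rV_prod//; exact: measurableT_comp.
have e : (\int[lebesgue_rV R k.+1]_x (h x)%:E =
    \int[leb \x lebesgue_rV R k]_p ((EFin \o h) \o cons) p)%E.
  rewrite /= /product_rV integral_pushforward//; exact: measurable_cons_rV.
rewrite e; split; first by rewrite -integral12_prod_meas1.
by rewrite -integral21_prod_meas1.
Qed.

(** For the first direction the integral along its lines is taken innermost; any other direction is
    a direction of the slices, to which induction applies. *)
Lemma integral_deriv0 k L (f : 'rV[R]_k -> R) g i : C1_box_supported L f g ->
  (\int[lebesgue_rV R k]_x (g i x)%:E = 0)%E.
Proof.
elim: k f g i => [|k IH] f g i C; first by case: i.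
have [Cf Cg df] := C.
have [e1 e2] := integral_rV_cons_integrable (Cg i).
have [j ij|i0] := unliftP ord0 i; subst i.
  rewrite e1 integral0_eq// => a _.
  exact: (IH _ _ j (C1_box_supported_slice a C)).
by rewrite e2 integral0_eq// => y _; exact: integral_line_deriv0 C.
Qed.

End integral_derivative.

Section test_functions.
Context (R : realType) (n : nat).
Local Notation E := 'rV[R]_n.
Local Notation mE := 'rV[measurableTypeR R]_n.
Local Notation mu := (lebesgue_rV R n).
Variables (D : set E) (L : R).
Hypothesis oD : open D.
Hypothesis DL : D `<=` cbox (fun=> - L) (fun=> L).
Implicit Types phi psi : E -> R.

Lemma test_funL phi psi (c : R) : test_fun D phi -> test_fun D psi ->
  test_fun D (fun x => c * phi x + psi x).
Proof.
move=> [s1 [K1 [c1 KD1 K01]]] [s2 [K2 [c2 KD2 K02]]]; split; first exact: smooth_lin.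
exists (K1 `|` K2); split; first exact: compactU.
- by rewrite subUset.
- by move=> x /not_orP[n1 n2]; rewrite K01// K02// mulr0 addr0.
Qed.

Lemma test_fun_coordM phi j : test_fun D phi -> test_fun D (fun x => x 0 j * phi x).
Proof.
move=> [s1 [K1 [c1 KD1 K01]]]; split; first exact: smooth_coordM.
by exists K1; split => // x nx; rewrite K01// mulr0.
Qed.

Lemma test_fun_partial phi i : test_fun D phi -> test_fun D (partial i phi).
Proof.
move=> [s1 [K1 [c1 KD1 K01]]]; split; first exact: smooth_partial.
exists K1; split => // x nx; apply: partialE.
have d0 : is_derive x (delta_mx 0 i : E) (fun=> 0 : R) 0 := is_derive_cst (0 : R) x _.
apply: near_eq_is_derive d0.
have oK : open (~` K1) by apply: closed_openC; apply: compact_closed => //; exact: norm_hausdorff.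
have : nbhs x (~` K1) by exact: open_nbhs_nbhs.
by apply: filterS => y ny; rewrite K01.
Qed.

Lemma test_fun_out phi x : test_fun D phi -> ~ D x -> phi x = 0.
Proof. by move=> [_ [K [_ KD K0]]] nD; apply: K0 => /KD. Qed.

Lemma test_fun_box_supported phi : test_fun D phi -> box_supported L phi.
Proof.
move=> tp; split; first exact: smooth_continuous tp.1.
by move=> x nx; apply: (test_fun_out tp) => /DL.
Qed.

Lemma test_fun_C1 phi : test_fun D phi -> C1_box_supported L phi (fun i => partial i phi).
Proof.
move=> tp; split; first exact: test_fun_box_supported.
  by move=> i; apply: test_fun_box_supported; exact: test_fun_partial.
by move=> i x; exact: smooth_is_derive tp.1.
Qed.

Let mD : @measurable _ mE D. Proof. exact: open_measurable_rV. Qed.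

Lemma test_fun_sqintegrable phi : test_fun D phi -> sqintegrable mu (D : set mE) phi.
Proof.
move=> /test_fun_box_supported/box_supported_sqintegrable[m1 i1]; split.
  exact: measurable_funS m1.
exact: integrableS i1.
Qed.

Lemma integral_out (h : E -> R) : (forall x, ~ D x -> h x = 0) ->
  (\int[mu]_(x in (D : set mE)) (h x)%:E = \int[mu]_x (h x)%:E)%E.
Proof.
move=> h0; rewrite [LHS]integral_mkcond; apply: eq_integral => x _.
by rewrite patchE; case: ifPn => // /negP; rewrite inE => /h0 ->.
Qed.

Lemma rip_test phi psi : test_fun D phi ->
  rip mu (D : set mE) phi psi = rip mu [set: mE] phi psi.
Proof.
by move=> tp; congr fine; apply: integral_out => x nx; rewrite (test_fun_out tp nx) mul0r.
Qed.

Lemma test_fun_by_parts phi psi i : test_fun D phi -> test_fun D psi ->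
  rip mu (D : set mE) phi (partial i psi) = - rip mu (D : set mE) (partial i phi) psi.
Proof.
move=> tp ts; have tpi := test_fun_partial i tp; have tsi := test_fun_partial i ts.
apply/eqP; rewrite -subr_eq0 opprK /rip -RintegralD//; last 2 first.
  exact: (sqintegrableM mD (test_fun_sqintegrable tp) (test_fun_sqintegrable tsi)).
  exact: (sqintegrableM mD (test_fun_sqintegrable tpi) (test_fun_sqintegrable ts)).
rewrite /Rintegral integral_out; last first.
  by move=> x nx; rewrite !(test_fun_out _ nx)// !mul0r addr0.
have [Cp Cgp dp] := test_fun_C1 tp; have [Cs Cgs ds] := test_fun_C1 ts.
have C : C1_box_supported L (fun x => phi x * psi x)
    (fun i x => phi x * partial i psi x + partial i phi x * psi x).
  split; first exact: box_supportedM.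
    move=> j; split.
      by apply: continuousD_fun; apply: continuousM_fun; [exact: Cp.1|exact: (Cgs j).1|exact: (Cgp
        j).1|exact: Cs.1].
    by move=> x nx; rewrite Cp.2// (Cgp j).2// !mul0r addr0.
  move=> j x; have := is_deriveM_fun (dp j x) (ds j x).
  by rewrite [psi x * _]mulrC.
by rewrite (integral_deriv0 i C).
Qed.

End test_functions.

(** * Weak derivatives and the space H01 *)

Lemma ltr_lincomb (R : realFieldType) (a b z q : R) : 0 <= q -> a < z -> b < z ->
  2 * a + q * b < 2 * z + q * z.
Proof. by move=> q0 az bz; have := ler_wpM2l q0 (ltW bz); lra. Qed.

Section sobolev.
Context (R : realType) (n : nat).
Local Notation E := 'rV[R]_n.
Local Notation mE := 'rV[measurableTypeR R]_n.
Local Notation mu := (lebesgue_rV R n).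
Local Notation C := R[i].
Local Notation reC := (@complex.Re R).
Local Notation imC := (@complex.Im R).
Local Notation toC r := (r%:C%C : C).
Variables (D : set E) (L : R).
Hypothesis oD : open D.
Hypothesis DL : D `<=` cbox (fun=> - L) (fun=> L).
Implicit Types (u v w g h f : E -> C) (phi psi : E -> R).
Local Notation sqi h := (sqintegrable mu (D : set mE) (h : mE -> R)).
Local Notation ripD f g := (rip mu (D : set mE) (f : mE -> R) (g : mE -> R)).
Local Notation ip f g := (cip D f g).

Lemma open_measurable_dom : @measurable _ mE D. Proof. exact: open_measurable_rV. Qed.
Let mD := open_measurable_dom.

Lemma dom_fin : (mu (D : set mE) < +oo)%E.
Proof.
have := @lebesgue_rV_cbox R n L; apply: le_lt_trans.
by apply: le_measure; rewrite ?inE//; exact: measurable_cbox.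
Qed.
Let finD := dom_fin.

Lemma cip_add_le f g : L2 D f -> L2 D g ->
  ip (fun x => f x + g x) (fun x => f x + g x) <= 2 * ip f f + 2 * ip g g.
Proof.
move=> fi gi; have := cip_sqrD_le mD 1 fi gi; rewrite expr1n mulr1.
by under eq_fun do rewrite rmorph1 mul1r.
Qed.

Lemma rip_re_lin (c : C) u v psi : L2 D u -> L2 D v -> sqi psi ->
  ripD (fun x => reC (u x + c * v x)) psi =
  ripD (fun x => reC (u x)) psi + (reC c * ripD (fun x => reC (v x)) psi -
    imC c * ripD (fun x => imC (v x)) psi).
Proof.
move=> /(L2P mD)[ur ui] /(L2P mD)[vr vi] si.
under [X in rip _ _ X _]eq_fun do rewrite ReD ReM -mulNr.
rewrite ripDl//; last by apply: sqintegrableD => //; exact: sqintegrableZ.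
by rewrite ripDl//; [rewrite !ripZl// mulNr|exact: sqintegrableZ|exact: sqintegrableZ].
Qed.

Lemma rip_im_lin (c : C) u v psi : L2 D u -> L2 D v -> sqi psi ->
  ripD (fun x => imC (u x + c * v x)) psi =
  ripD (fun x => imC (u x)) psi + (reC c * ripD (fun x => imC (v x)) psi +
    imC c * ripD (fun x => reC (v x)) psi).
Proof.
move=> /(L2P mD)[ur ui] /(L2P mD)[vr vi] si.
under [X in rip _ _ X _]eq_fun do rewrite ImD ImM.
rewrite ripDl//; last by apply: sqintegrableD => //; exact: sqintegrableZ.
by rewrite ripDl//; [rewrite !ripZl//|exact: sqintegrableZ|exact: sqintegrableZ].
Qed.

Lemma is_weak_partialP i u g : is_weak_partial D i u g <->
  forall phi, test_fun D phi ->
    ripD (fun x => reC (u x)) (partial i phi) = - ripD (fun x => reC (g x)) phi /\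
    ripD (fun x => imC (u x)) (partial i phi) = - ripD (fun x => imC (g x)) phi.
Proof.
have er f psi : reC (cintegral D (fun x => f x * toC (psi x))) = ripD (fun x => reC (f x)) psi.
  by apply: eq_Rintegral => x _; rewrite ReM/= mulr0 subr0.
have ei f psi : imC (cintegral D (fun x => f x * toC (psi x))) = ripD (fun x => imC (f x)) psi.
  by apply: eq_Rintegral => x _; rewrite ImM/= mulr0 add0r.
split => h phi tp.
  have := h phi tp => /[dup] /(congr1 reC) + /(congr1 imC).
  by rewrite ReN ImN !er !ei.
have [h1 h2] := h phi tp; apply: complex_eqP.
  by rewrite ReN !er.
by rewrite ImN !ei.
Qed.

(** The difference of two candidates is orthogonal to all test functions. This turns the chosen
    [weak_partial] into something computable: it agrees almost everywhere with any weak derivative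
    that can be exhibited. *)
Lemma weak_partial_unique i u g h : L2 D g -> L2 D h ->
  is_weak_partial D i u g -> is_weak_partial D i u h ->
  {ae mu, forall x, D x -> g x = h x}.
Proof.
move=> /(L2P mD)[gr gi] /(L2P mD)[hr hi] /is_weak_partialP wg /is_weak_partialP wh.
have key (p q : E -> R) : sqi p -> sqi q ->
    (forall phi, test_fun D phi -> ripD p phi = ripD q phi) ->
    {ae mu, forall x, D x -> p x = q x}.
  move=> pi qi pq.
  have := @fundamental_lemma R n D oD (fun x => p x - q x).
  move=> /(_ (sqintegrable_integrable mD finD (sqintegrableB mD pi qi))) H.
  apply: (aeS _ (H _)).
    by move=> x h0 Dx; apply/eqP; rewrite -subr_eq0; apply/eqP; exact: h0.
  move=> phi tp; have ti := test_fun_sqintegrable oD DL tp.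
  have := pq phi tp => /eqP; rewrite -subr_eq0 => /eqP e0.
  rewrite -[RHS]e0 -[X in _ - X]mul1r -mulNr -ripZl// -ripDl//; last exact: sqintegrableZ.
  by apply: eq_Rintegral => x _; rewrite mulN1r.
have h1 := key _ _ gr hr _; have h2 := key _ _ gi hi _.
have {}h1 : {ae mu, forall x, D x -> reC (g x) = reC (h x)}.
  by apply: h1 => phi tp; apply: oppr_inj; rewrite -(wg phi tp).1 -(wh phi tp).1.
have {}h2 : {ae mu, forall x, D x -> imC (g x) = imC (h x)}.
  by apply: h2 => phi tp; apply: oppr_inj; rewrite -(wg phi tp).2 -(wh phi tp).2.
apply: (aeS2 _ h1 h2) => x /= e1 e2 Dx; apply: complex_eqP; [exact: e1|exact: e2].
Qed.

Lemma is_weak_partial_lin (c : C) i u v g h : L2 D u -> L2 D v -> L2 D g -> L2 D h ->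
  is_weak_partial D i u g -> is_weak_partial D i v h ->
  is_weak_partial D i (fun x => u x + c * v x) (fun x => g x + c * h x).
Proof.
move=> ui vi gi hi /is_weak_partialP wg /is_weak_partialP wh; apply/is_weak_partialP => phi tp.
have ti := test_fun_sqintegrable oD DL tp.
have tpi := test_fun_sqintegrable oD DL (test_fun_partial i tp).
have [w1 w2] := wg phi tp; have [w3 w4] := wh phi tp.
rewrite !rip_re_lin// !rip_im_lin// w1 w2 w3 w4; split; ring.
Qed.

Lemma H1_L2 u : H1 D u -> L2 D u. Proof. by case. Qed.

Lemma H1_weak_partial i u : H1 D u ->
  L2 D (weak_partial D i u) /\ is_weak_partial D i u (weak_partial D i u).
Proof.
move=> [_ /(_ i) ex].
exact: (@xgetPex _ (fun=> 0) [set g | L2 D g /\ is_weak_partial D i u g] ex).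
Qed.

Lemma weak_partial_L2 i u : H1 D u -> L2 D (weak_partial D i u).
Proof. by move=> /(H1_weak_partial i)[]. Qed.

Lemma weak_partial_ae i u g : L2 D u -> L2 D g -> is_weak_partial D i u g ->
  {ae mu, forall x, D x -> weak_partial D i u x = g x}.
Proof.
move=> ui gi wg.
have [wi ww] : [set g | L2 D g /\ is_weak_partial D i u g] (weak_partial D i u).
  by apply: xgetPex; exists g.
exact: weak_partial_unique wi gi ww wg.
Qed.

Lemma H1_lin (c : C) u v : H1 D u -> H1 D v -> H1 D (fun x => u x + c * v x).
Proof.
move=> u1 v1; split; first exact: (L2_lin mD c (H1_L2 u1) (H1_L2 v1)).
move=> i; have [ui wu] := H1_weak_partial i u1; have [vi wv] := H1_weak_partial i v1.
exists (fun x => weak_partial D i u x + c * weak_partial D i v x).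
split; first exact: L2_lin.
by apply: is_weak_partial_lin => //; exact: H1_L2.
Qed.

Lemma weak_partial_lin (c : C) i u v : H1 D u -> H1 D v ->
  {ae mu, forall x, D x -> weak_partial D i (fun x => u x + c * v x) x =
     weak_partial D i u x + c * weak_partial D i v x}.
Proof.
move=> u1 v1; have [ui wu] := H1_weak_partial i u1; have [vi wv] := H1_weak_partial i v1.
apply: weak_partial_ae; first exact: (L2_lin mD c (H1_L2 u1) (H1_L2 v1)).
- exact: L2_lin.
- by apply: is_weak_partial_lin => //; exact: H1_L2.
Qed.

Definition cpartial i f : E -> C := fun x =>
  Complex (partial i (fun y => reC (f y)) x) (partial i (fun y => imC (f y)) x).

Lemma ctest_L2 f : ctest_fun D f -> L2 D f.
Proof.
move=> [t1 t2]; apply/(L2P mD); split; exact: (test_fun_sqintegrable oD DL).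
Qed.

Lemma ctest_partial_L2 i f : ctest_fun D f -> L2 D (cpartial i f).
Proof.
move=> [t1 t2]; apply/(L2P mD); split; apply: (test_fun_sqintegrable oD DL);
  exact: test_fun_partial.
Qed.

Lemma ctest_weak_partial i f : ctest_fun D f -> is_weak_partial D i f (cpartial i f).
Proof.
move=> [t1 t2]; apply/is_weak_partialP => phi tp.
by split; rewrite (test_fun_by_parts oD DL).
Qed.

Lemma ctest_H1 f : ctest_fun D f -> H1 D f.
Proof.
move=> tf; split; first exact: ctest_L2.
move=> i; exists (cpartial i f); split; first exact: ctest_partial_L2.
exact: ctest_weak_partial.
Qed.

Lemma ctest_lin (c : C) f g : ctest_fun D f -> ctest_fun D g ->
  ctest_fun D (fun x => f x + c * g x).
Proof.
move=> [f1 f2] [g1 g2]; split.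
  have := test_funL (reC c) g1 (test_funL (- imC c) g2 f1).
  by congr test_fun; apply/funext => x; rewrite ReD ReM; ring.
have := test_funL (reC c) g2 (test_funL (imC c) g1 f2).
by congr test_fun; apply/funext => x; rewrite ImD ImM; ring.
Qed.

Lemma cpartial_lin (c : C) i f g x : ctest_fun D f -> ctest_fun D g ->
  cpartial i (fun x => f x + c * g x) x = cpartial i f x + c * cpartial i g x.
Proof.
move=> [f1 f2] [g1 g2]; apply: complex_eqP; rewrite !cplxE/=.
  rewrite (_ : (fun y => _) = (fun y => reC c * reC (g y) + ((- imC c) * imC (g y) + reC (f y)))).
    rewrite !partial_lin; [ring|exact: g2.1|exact: f1.1|exact: g1.1|].
    exact: (test_funL (- imC c) g2 f1).1.
  by apply/funext => y; rewrite ReD ReM; ring.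
rewrite (_ : (fun y => _) = (fun y => reC c * imC (g y) + (imC c * reC (g y) + imC (f y)))).
  rewrite !partial_lin; [ring|exact: g1.1|exact: f2.1|exact: g2.1|].
  exact: (test_funL (imC c) g1 f2).1.
by apply/funext => y; rewrite ImD ImM; ring.
Qed.

(** The squared H1 distance from [u] to a test function, with the classical derivatives of [f] in
    place of the chosen weak derivatives of the difference. *)
Definition test_dist u f : R :=
  ip (fun x => u x - f x) (fun x => u x - f x) +
  \sum_i ip (fun x => weak_partial D i u x - cpartial i f x)
             (fun x => weak_partial D i u x - cpartial i f x).

Definition gnorm2 u : R := \sum_i ip (weak_partial D i u) (weak_partial D i u).

Lemma gnorm2_ge0 u : 0 <= gnorm2 u.
Proof. by apply: sumr_ge0 => i _; exact: cip_ge0. Qed.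

Lemma gradnorm_sqr u : H1 D u -> gradnorm D u ^+ 2 = gnorm2 u.
Proof.
move=> u1; rewrite sqr_sqrtr; last by apply: sumr_ge0 => i _; exact: sqr_ge0.
by apply: eq_bigr => i _; rewrite (L2norm_sqr mD)//; exact: weak_partial_L2.
Qed.

Lemma H1norm_sqr u : H1 D u -> H1norm D u ^+ 2 = ip u u + gnorm2 u.
Proof.
move=> u1; rewrite sqr_sqrtr ?addr_ge0 ?sqr_ge0// (L2norm_sqr mD) ?gradnorm_sqr//.
exact: H1_L2.
Qed.

Lemma H1B u v : H1 D u -> H1 D v -> H1 D (fun x => u x - v x).
Proof.
move=> u1 v1; have := H1_lin (-1) u1 v1.
by under eq_fun do rewrite mulN1r.
Qed.

Lemma weak_partialB i u v : H1 D u -> H1 D v ->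
  {ae mu, forall x, D x -> weak_partial D i (fun x => u x - v x) x =
     weak_partial D i u x - weak_partial D i v x}.
Proof.
move=> u1 v1; have := weak_partial_lin (-1) i u1 v1.
under [X in weak_partial D i X]eq_fun do rewrite mulN1r.
by apply: aeS => x h Dx; rewrite h// mulN1r.
Qed.

Lemma test_distE u f : H1 D u -> ctest_fun D f ->
  H1norm D (fun x => u x - f x) ^+ 2 = test_dist u f.
Proof.
move=> u1 tf; have f1 := ctest_H1 tf; have uf := H1B u1 f1.
rewrite H1norm_sqr//; congr (_ + _); apply: eq_bigr => i _.
have wi := weak_partial_L2 i uf.
have di : L2 D (fun x => weak_partial D i u x - cpartial i f x).
  exact: (L2B mD (weak_partial_L2 i u1) (ctest_partial_L2 i tf)).
have e : {ae mu, forall x, D x -> weak_partial D i (fun x => u x - f x) x =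
    weak_partial D i u x - cpartial i f x}.
  have := weak_partial_ae (ctest_L2 tf) (ctest_partial_L2 i tf) (ctest_weak_partial i tf).
  apply: (aeS2 _ (weak_partialB i u1 f1)) => x /= e1 e2 Dx.
  by rewrite e1// e2.
exact: (eq_cip_ae2 mD wi di wi di e e).
Qed.

Lemma H01P u : H01 D u <->
  H1 D u /\ forall e : R, 0 < e -> exists2 f, ctest_fun D f & test_dist u f < e.
Proof.
split=> -[u1 h]; split=> // e e0.
  have [|f tf hf] := h (Num.sqrt e); first by rewrite sqrtr_gt0.
  exists f => //; rewrite -test_distE// -[e]sqr_sqrtr ?ltW//.
  by rewrite ltrXn2r ?nnegrE ?sqrtr_ge0.
have [|f tf hf] := h (e ^+ 2); first by rewrite exprn_gt0.
exists f => //; rewrite -test_distE// in hf.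
by rewrite -(@ltr_pXn2r _ 2)// ?nnegrE ?sqrtr_ge0// ltW.
Qed.

Lemma H01_H1 u : H01 D u -> H1 D u. Proof. by case. Qed.

Lemma H01_lin (c : C) u v : H01 D u -> H01 D v -> H01 D (fun x => u x + c * v x).
Proof.
move=> /H01P[u1 hu] /H01P[v1 hv]; apply/H01P; split; first exact: H1_lin.
move=> e e0.
(* The total weight of the two approximation errors, so that errors below [e / K] add up to less
   than [e]. *)
pose K := 2 + 2 * Normc.normc c ^+ 2.
have K0 : 0 < K by rewrite /K ltr_pwDl// mulr_ge0// sqr_ge0.
have eK : 0 < e / K by rewrite divr_gt0.
have [f tf hf] := hu _ eK; have [g tg hg] := hv _ eK.
exists (fun x => f x + c * g x); first exact: ctest_lin.
have bound p q p' q' : L2 D p -> L2 D q -> L2 D p' -> L2 D q' ->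
  ip (fun x => p x + c * q x - (p' x + c * q' x)) (fun x => p x + c * q x - (p' x + c * q' x)) <=
  2 * ip (fun x => p x - p' x) (fun x => p x - p' x) +
  2 * Normc.normc c ^+ 2 * ip (fun x => q x - q' x) (fun x => q x - q' x).
  move=> pi qi pi' qi'; have h1 := L2B mD pi pi'; have h2 := L2B mD qi qi'.
  have := cip_add_le h1 (L2Z mD c h2); rewrite (cipZZ mD c h2) mulrA.
  have -> // : (fun x => p x + c * q x - (p' x + c * q' x)) =
    (fun x => p x - p' x + c * (q x - q' x)) by apply/funext => x; ring.
have le : test_dist (fun x => u x + c * v x) (fun x => f x + c * g x) <=
    2 * test_dist u f + 2 * Normc.normc c ^+ 2 * test_dist v g.
  rewrite /test_dist !(mulrDr _ (ip _ _)) addrACA; apply: lerD.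
    by apply: bound; [exact: H1_L2|exact: H1_L2|exact: ctest_L2|exact: ctest_L2].
  rewrite !mulr_sumr -big_split/=; apply: ler_sum => i _.
  have wu := weak_partial_L2 i u1; have wv := weak_partial_L2 i v1.
  have df := ctest_partial_L2 i tf; have dg := ctest_partial_L2 i tg.
  apply: le_trans (bound _ _ _ _ wu wv df dg).
  under eq_fun do rewrite cpartial_lin//.
  have h1 := L2_lin mD c df dg.
  have h2 := L2B mD (weak_partial_L2 i (H1_lin c u1 v1)) h1.
  have h3 := L2B mD (L2_lin mD c wu wv) h1.
  have e1 : {ae mu, forall x, D x -> weak_partial D i (fun x => u x + c * v x) x - (cpartial i f x
    + c * cpartial i g x)
     = weak_partial D i u x + c * weak_partial D i v x - (cpartial i f x + c * cpartial i g x)}.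
    by apply: aeS (weak_partial_lin c i u1 v1) => x ex Dx; rewrite ex.
  by rewrite (eq_cip_ae2 mD h2 h3 h2 h3 e1 e1).
apply: (le_lt_trans le) => {le bound}.
have -> : e = 2 * (e / K) + 2 * Normc.normc c ^+ 2 * (e / K).
  by rewrite -mulrDl -/K mulrC divfK// gt_eqF.
by apply: ltr_lincomb; [rewrite mulr_ge0// sqr_ge0|exact: hf|exact: hg].
Qed.

End sobolev.

(** Passage to the limit in an approximation argument. Small [e] suffices, so quadratic error terms
    can be absorbed into the linear one. *)
Lemma le_of_eps (R : realFieldType) (a b K : R) :
  (forall e : R, 0 < e -> e <= 1 -> a <= K * e + b) -> a <= b.
Proof.
move=> h; rewrite leNgt; apply/negP => ba.
pose M := `|K| + 1; have M0 : 0 < M by rewrite ltr_pwDr.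
have KM : K <= M - 1 by rewrite /M addrK ler_norm.
pose e := Num.min 1 ((a - b) / (2 * M)).
have e0 : 0 < e by rewrite /e lt_min ltr01 divr_gt0// ?subr_gt0// mulr_gt0.
have e1 : e <= 1 by rewrite /e ge_min lexx.
have e2 : e <= (a - b) / (2 * M) by rewrite /e ge_min lexx orbT.
have := h e e0 e1.
have : M * e <= (a - b) / 2.
  have -> : (a - b) / 2 = M * ((a - b) / (2 * M)) by field; rewrite gt_eqF.
  by rewrite ler_pM2l.
have : K * e <= M * e by rewrite ler_pM2r//; lra.
lra.
Qed.

Lemma cvg_of_sub0 (R : realType) (a : nat -> R) (l : R) :
  (fun m => a m - l) @ \oo --> 0 -> a @ \oo --> l.
Proof.
move=> h; have : (fun m => (a m - l) + l) @ \oo --> 0 + l.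
  by apply: cvgD => //; exact: cvg_cst.
by rewrite add0r; under eq_fun do rewrite subrK.
Qed.

(** * Poincaré and quartic inequalities on H01 *)

Section sobolev_inequalities.
Context (R : realType) (k : nat).
Local Notation n := k.+2.
Local Notation E := 'rV[R]_n.
Local Notation mE := 'rV[measurableTypeR R]_n.
Local Notation mu := (lebesgue_rV R n).
Local Notation C := R[i].
Local Notation reC := (@complex.Re R).
Local Notation imC := (@complex.Im R).
Local Notation toC r := (r%:C%C : C).
Variables (D : set E) (L : R).
Hypothesis oD : open D.
Hypothesis L0 : 0 < L.
Hypothesis DL : D `<=` cbox (fun=> - L) (fun=> L).
Hypothesis hk : n = 2%N \/ n = 3%N.
Implicit Types (u v w g h f : E -> C) (phi psi : E -> R).
Local Notation ripD f g := (rip mu (D : set mE) (f : mE -> R) (g : mE -> R)).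
Local Notation ip f g := (cip D f g).
Local Notation gn u := (gnorm2 D u).

Let mD : @measurable _ mE D := open_measurable_dom oD.
Let finD : (mu (D : set mE) < +oo)%E := dom_fin oD DL.

Definition cgnorm2 f : R := \sum_i ip (cpartial i f) (cpartial i f).

Lemma ctest_poincare f : ctest_fun D f -> ip f f <= 16 * L ^+ 2 * cgnorm2 f.
Proof.
move=> [t1 t2].
have key phi : test_fun D phi ->
    ripD phi phi <= 16 * L ^+ 2 * ripD (partial ord0 phi) (partial ord0 phi).
  move=> tp; have tpi := test_fun_partial ord0 tp.
  by rewrite !rip_test//; exact: (poincare_box L0 (test_fun_C1 DL tp)).
have c0 : 0 <= 16 * L ^+ 2 by rewrite mulr_ge0// sqr_ge0.
apply: (@le_trans _ _ (16 * L ^+ 2 * ip (cpartial ord0 f) (cpartial ord0 f))).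
  by rewrite mulrDr; apply: lerD; exact: key.
rewrite ler_wpM2l// /cgnorm2 (bigD1 ord0)//= lerDl.
by apply: sumr_ge0 => i _; exact: cip_ge0.
Qed.

Lemma cip_near f g : L2 D f -> L2 D g ->
  ip g g <= 2 * ip f f + 2 * ip (fun x => f x - g x) (fun x => f x - g x).
Proof.
move=> fi gi; have di := L2B mD fi gi.
have := cip_sqrD_le mD (-1) fi di; rewrite sqrrN expr1n mulr1.
suff -> : (fun x => f x + toC (-1) * (f x - g x)) = g by [].
by apply/funext => x; rewrite rmorphN1; ring.
Qed.

Lemma cgnorm2_near u f : H1 D u -> ctest_fun D f ->
  cgnorm2 f <= 2 * gn u + 2 * (\sum_i ip (fun x => weak_partial D i u x - cpartial i f x)
             (fun x => weak_partial D i u x - cpartial i f x)).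
Proof.
move=> u1 tf; rewrite !mulr_sumr -big_split; apply: ler_sum => i _.
exact: (cip_near (weak_partial_L2 i u1) (ctest_partial_L2 oD DL i tf)).
Qed.

Lemma test_dist_cgnorm u f : H1 D u -> ctest_fun D f ->
  ip f f + cgnorm2 f <= 2 * (ip u u + gn u) + 2 * test_dist D u f.
Proof.
move=> u1 tf.
have h1 := cip_near (H1_L2 u1) (ctest_L2 oD DL tf).
have h2 := cgnorm2_near u1 tf.
by rewrite /test_dist; lra.
Qed.

(** The constant 16 of the box is multiplied by 4: one factor 2 is lost in replacing [u] by a test
    function, another in replacing the derivatives of the test function by those of [u]. *)
Lemma poincare u : H01 D u -> ip u u <= 64 * L ^+ 2 * gn u.
Proof.
move=> /(H01P oD DL)[u1 hu]; apply: (@le_of_eps _ _ _ (2 + 64 * L ^+ 2)) => e e0 _.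
have [f tf] := hu e e0; rewrite /test_dist.
have h1 := cip_near (ctest_L2 oD DL tf) (H1_L2 u1).
have h2 := cgnorm2_near u1 tf.
have h3 := ctest_poincare tf.
have e1 : ip (fun x => f x - u x) (fun x => f x - u x) = ip (fun x => u x - f x) (fun x => u x - f
  x).
  by congr (_ + _); apply: eq_Rintegral => x _; rewrite !cplxE; ring.
rewrite e1 in h1; move: h1 h2 h3.
set a := ip (fun x => u x - f x) _; set b := \sum_i _; set c := 16 * L ^+ 2.
have a0 : 0 <= a by exact: cip_ge0.
have b0 : 0 <= b by apply: sumr_ge0 => i _; exact: cip_ge0.
have c0 : 0 <= c by rewrite mulr_ge0// sqr_ge0.
have -> : 64 * L ^+ 2 = 4 * c by rewrite /c; ring.
move: (ip u u) (ip f f) (cgnorm2 f) (gn u) => U F G N h1 h2 h3 h4.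
have h5 : c * G <= c * (2 * N + 2 * b) by rewrite ler_wpM2l.
have h6 : c * b <= c * e by rewrite ler_wpM2l//; lra.
nra.
Qed.

(** The fourth power of the modulus is at most twice the sum of the fourth powers of the real and
    imaginary parts, to which the real inequality applies. *)
Lemma ctest_L4 f : ctest_fun D f ->
  (\int[mu]_(x in (D : set mE)) (Normc.normc (f x) ^+ 4)%:E <=
    (4 * (ip f f + cgnorm2 f) ^+ 2)%:E)%E.
Proof.
move=> [t1 t2].
pose S phi := ripD phi phi + \sum_i ripD (partial i phi) (partial i phi).
have S0 phi : 0 <= S phi by rewrite addr_ge0 ?rip_ge0//; apply: sumr_ge0 => i _; exact: rip_ge0.
have key phi : test_fun D phi ->
    (\int[mu]_(x in (D : set mE)) (phi x ^+ 4)%:E <= (2 * S phi ^+ 2)%:E)%E.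
  move=> tp; rewrite integral_out; last by move=> x nx; rewrite (test_fun_out tp nx) expr0n.
  have := ladyzhenskaya hk (test_fun_C1 DL tp).
  congr (_ <= (2 * (_ + _) ^+ 2)%:E)%E; first by rewrite rip_test.
  by apply: eq_bigr => i _; rewrite rip_test//; exact: test_fun_partial.
have m4 phi : test_fun D phi -> measurable_fun (D : set mE) (fun x => (phi x ^+ 4)%:E).
  move=> tp; apply/measurable_EFinP/measurable_funX.
  exact: (test_fun_sqintegrable oD DL tp).1.
have m1 := m4 _ t1; have m2 := m4 _ t2.
have p4 (phi : E -> R) x : (0 <= (phi x ^+ 4)%:E)%E by rewrite lee_fin exprn_even_ge0.
apply: (@le_trans _ _ (2%:E * \int[mu]_(x in (D : set mE)) (reC (f x) ^+ 4)%:E +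
   2%:E * \int[mu]_(x in (D : set mE)) (imC (f x) ^+ 4)%:E)%E).
  have e1 : (2%:E * \int[mu]_(x in (D : set mE)) (reC (f x) ^+ 4)%:E =
      \int[mu]_(x in (D : set mE)) (2%:E * (reC (f x) ^+ 4)%:E))%E.
    by apply/esym; apply: ge0_integralZl_EFin => // x _; rewrite lee_fin exprn_even_ge0.
  have e2 : (2%:E * \int[mu]_(x in (D : set mE)) (imC (f x) ^+ 4)%:E =
      \int[mu]_(x in (D : set mE)) (2%:E * (imC (f x) ^+ 4)%:E))%E.
    by apply/esym; apply: ge0_integralZl_EFin => // x _; rewrite lee_fin exprn_even_ge0.
  rewrite e1 e2 -ge0_integralD//; last 4 first.
  - by move=> x _; rewrite -EFinM lee_fin mulr_ge0// exprn_even_ge0.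
  - exact: measurable_funeM.
  - by move=> x _; rewrite -EFinM lee_fin mulr_ge0// exprn_even_ge0.
  - exact: measurable_funeM.
  apply: ge0_le_integral => //.
  - by move=> x _; rewrite lee_fin exprn_even_ge0.
  - apply/measurable_EFinP; rewrite (_ : (fun x => _) = fun x => (reC (f x) ^+ 2 + imC (f x) ^+ 2)
    ^+ 2).
      apply: measurable_funX; apply: measurable_funD; apply: measurable_funX.
        exact: (test_fun_sqintegrable oD DL t1).1.
      exact: (test_fun_sqintegrable oD DL t2).1.
    by apply/funext => x; rewrite -normc_sqr -exprM.
  - by apply: emeasurable_funD; exact: measurable_funeM.
  - move=> x _; rewrite -!EFinM -EFinD lee_fin -[4%N]/(2 * 2)%N !exprM normc_sqr.
    have := sqr_ge0 (reC (f x) ^+ 2 - imC (f x) ^+ 2); lra.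
have k1 := key _ t1; have k2 := key _ t2.
have t20 : (0 <= 2%:E :> \bar R)%E by rewrite lee_fin.
apply: (le_trans (leeD (lee_wpmul2l t20 k1) (lee_wpmul2l t20 k2))).
have e3 : ip f f + cgnorm2 f = S (fun x => reC (f x)) + S (fun x => imC (f x)).
  by rewrite /S [RHS]addrACA -big_split.
have := S0 (fun x => reC (f x)); have := S0 (fun x => imC (f x)).
rewrite e3 {k1 k2 e3 m1 m2 key m4}.
move: (S (fun x => reC (f x))) (S (fun x => imC (f x))) => y x x0 y0.
have -> : (2%:E * (2 * y ^+ 2)%:E + 2%:E * (2 * x ^+ 2)%:E =
  (2 * (2 * y ^+ 2) + 2 * (2 * x ^+ 2))%:E)%E by [].
by rewrite lee_fin; nra.
Qed.

Definition L4 u := L2 D u /\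
  mu.-integrable (D : set mE) (EFin \o (fun x => Normc.normc (u x) ^+ 4)).

Definition q4 u : R := \int[mu]_(x in (D : set mE)) (Normc.normc (u x) ^+ 4).

Lemma measurable_normc4 u : L2 D u ->
  @measurable_fun _ _ mE R D (fun x => Normc.normc (u x) ^+ 4).
Proof.
move=> [[m1 m2] _].
rewrite (_ : (fun x => _) = fun x => (reC (u x) ^+ 2 + imC (u x) ^+ 2) ^+ 2).
  by apply: measurable_funX; apply: measurable_funD; exact: measurable_funX.
by apply/funext => x; rewrite -normc_sqr -exprM.
Qed.

(** Test functions approaching [u] fast enough converge almost everywhere, and Fatou's lemma gives
    both integrability and the bound. Their squared H1 norms are within a factor 2 of that of [u],
    up to a small error, whence [16 = 4 * 2 ^+ 2]. *)
Lemma H01_L4 u : H01 D u ->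
  L4 u /\ q4 u <= 16 * (ip u u + gn u) ^+ 2.
Proof.
move=> /(H01P oD DL)[u1 hu].
set N := ip u u + gn u.
have N0 : 0 <= N by rewrite addr_ge0 ?cip_ge0// gnorm2_ge0.
have ui := H1_L2 u1.
have main e : 0 < e -> (\int[mu]_(x in (D : set mE)) `|Normc.normc (u x) ^+ 4|%:E <=
    (4 * (2 * N + 2 * e) ^+ 2)%:E)%E.
  move=> e0.
  (* The geometric rate yields convergence almost everywhere; the cap [e] keeps the norms of all
     approximants close to the same bound. *)
  have /choice[f Hf] : forall m, exists f, ctest_fun D f /\
      test_dist D u f <= Num.min e (((2^-1 : R) ^+ m) ^+ 2).
    move=> m; have [|f tf hf] := hu (Num.min e (((2^-1 : R) ^+ m) ^+ 2)).
      by rewrite lt_min e0 !exprn_gt0.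
    by exists f; split => //; exact: ltW.
  have fi m : L2 D (f m) := ctest_L2 oD DL (Hf m).1.
  have dm m : ip (fun x => f m x - u x) (fun x => f m x - u x) <= ((2^-1 : R) ^+ m) ^+ 2.
    have e1 : ip (fun x => f m x - u x) (fun x => f m x - u x) = ip (fun x => u x - f m x) (fun x
      => u x - f m x).
      by congr (_ + _); apply: eq_Rintegral => x _; rewrite !cplxE; ring.
    have [_] := Hf m; rewrite le_min => /andP[_].
    rewrite e1 /test_dist; apply: le_trans; rewrite lerDl.
    by apply: sumr_ge0 => i _; exact: cip_ge0.
  have di m := (L2P mD _).1 (L2B mD (fi m) ui).
  have c1 := @ae_cvg0 _ _ _ mu (D : set mE) mD finD (fun m x => reC (f m x - u x)) (fun m => (di
    m).1).
  have {}c1 := c1 (fun m => le_trans (_ : _ <= _) (dm m)).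
  have c2 := @ae_cvg0 _ _ _ mu (D : set mE) mD finD (fun m x => imC (f m x - u x)) (fun m => (di
    m).2).
  have {}c1 : {ae mu, forall x, D x -> (fun m => reC (f m x - u x)) @ \oo --> 0}.
    by apply: c1 => m; rewrite lerDl rip_ge0.
  have {}c2 : {ae mu, forall x, D x -> (fun m => imC (f m x - u x)) @ \oo --> 0}.
    by apply: c2 => m; apply: le_trans (dm m); rewrite lerDr rip_ge0.
  apply: (@fatou_real _ _ _ mu (D : set mE) mD (fun m x => Normc.normc (f m x) ^+ 4)).
  - by move=> m; exact: measurable_normc4.
  - by move=> m x _; exact: exprn_even_ge0.
  - exact: measurable_normc4.
  - apply: (aeS2 _ c1 c2) => x h1 h2 Dx.
    have {}h1 : (fun m => reC (f m x)) @ \oo --> reC (u x).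
      by apply: cvg_of_sub0; under eq_fun do rewrite -ReN -ReD; exact: h1.
    have {}h2 : (fun m => imC (f m x)) @ \oo --> imC (u x).
      by apply: cvg_of_sub0; under eq_fun do rewrite -ImN -ImD; exact: h2.
    have -> : Normc.normc (u x) ^+ 4 = (reC (u x) * reC (u x) + imC (u x) * imC (u x)) *
        (reC (u x) * reC (u x) + imC (u x) * imC (u x)).
      by rewrite -[4%N]/(2 * 2)%N exprM normc_sqr !expr2.
    have -> : (fun m => Normc.normc (f m x) ^+ 4) = (fun m => (reC (f m x) * reC (f m x) + imC (f m
      x) * imC (f m x)) *
        (reC (f m x) * reC (f m x) + imC (f m x) * imC (f m x))).
      by apply/funext => m; rewrite -[4%N]/(2 * 2)%N exprM normc_sqr !expr2.
    by apply: cvgM; apply: cvgD; apply: cvgM.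
  - exists 0%N => m _; apply: (le_trans (ctest_L4 (Hf m).1)).
    rewrite lee_fin ler_pM2l//.
    have h1 := test_dist_cgnorm u1 (Hf m).1.
    have [_] := Hf m; rewrite le_min => /andP[h2 _].
    have h3 : 0 <= ip (f m) (f m) + cgnorm2 (f m).
      by rewrite addr_ge0 ?cip_ge0//; apply: sumr_ge0 => i _; exact: cip_ge0.
    have h4 : ip (f m) (f m) + cgnorm2 (f m) <= 2 * N + 2 * e.
      by apply: (le_trans h1); rewrite lerD2l ler_pM2l.
    by rewrite lerXn2r ?nnegrE//; exact: le_trans h3 h4.
have iu : mu.-integrable (D : set mE) (EFin \o (fun x => Normc.normc (u x) ^+ 4)).
  apply/integrableP; split; first by apply/measurable_EFinP; exact: measurable_normc4.
  exact: le_lt_trans (main 1 ltr01) (ltry _).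
split; first by split.
apply: (@le_of_eps _ _ _ (16 * (2 * N + 1))) => e e0 e1.
have : q4 u <= 4 * (2 * N + 2 * e) ^+ 2.
  apply: (Rintegral_le_fin mD iu); apply: le_trans (main e e0).
  rewrite le_eqVlt; apply/orP; left; apply/eqP; apply: eq_integral => x _.
  by rewrite ger0_norm// exprn_even_ge0.
nra.
Qed.

End sobolev_inequalities.

(** * Riesz representation *)

Section riesz.
Context (R : realType) (X : Type).
Variables (lin : R -> X -> X -> X) (H : set X) (a : X -> X -> R) (l : X -> R) (M : R).
Hypothesis H0 : H !=set0.
Hypothesis Hlin : forall t u v, H u -> H v -> H (lin t u v).
Hypothesis aC : forall u v, H u -> H v -> a u v = a v u.
Hypothesis al : forall t u v w, H u -> H v -> H w -> a (lin t u v) w = a u w + t * a v w.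
Hypothesis a0 : forall u, H u -> 0 <= a u u.
Hypothesis ll : forall t u v, H u -> H v -> l (lin t u v) = l u + t * l v.
Hypothesis lM : forall u, H u -> l u ^+ 2 <= M * a u u.
Hypothesis complete : forall f : nat -> X, (forall k, H (f k)) ->
  (forall e : R, 0 < e -> exists N, forall j k, (N <= j)%N -> (N <= k)%N ->
    a (lin (-1) (f j) (f k)) (lin (-1) (f j) (f k)) <= e) ->
  exists2 g, H g & forall e : R, 0 < e -> exists N, forall k, (N <= k)%N ->
    a (lin (-1) (f k) g) (lin (-1) (f k) g) <= e.

Let ar t u v w : H u -> H v -> H w -> a w (lin t u v) = a w u + t * a w v.
Proof. by move=> hu hv hw; rewrite aC ?al ?(aC hw)//; exact: Hlin. Qed.

Lemma form_sqrD t u v : H u -> H v ->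
  a (lin t u v) (lin t u v) = a u u + 2 * a u v * t + a v v * t ^+ 2.
Proof.
move=> hu hv; have h := Hlin t hu hv.
rewrite al// !ar// (aC hv hu); ring.
Qed.

Lemma form_CS u v : H u -> H v -> a u v ^+ 2 <= a u u * a v v.
Proof.
move=> hu hv; apply: discr_le; first exact: a0.
by move=> t; rewrite -form_sqrD// a0//; exact: Hlin.
Qed.

(** A limit of a minimizing sequence of [a v v - 2 * l v] represents [l]. The setting is a bare type
    with one operation [lin], standing for [u + t v], because elements are functions known up to
    null sets and [a] may vanish on nonzero ones. *)
Lemma riesz : exists2 g, H g & forall h, H h -> a g h = l h.
Proof.
pose q v := a v v - 2 * l v.
(* From [(2 * l v) ^+ 2 <= 4 * |M| * a v v <= (a v v + |M|) ^+ 2]. *)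
have qge v : H v -> - `|M| <= q v.
  move=> hv; have h1 := lM hv; have h2 := a0 hv.
  have h3 : l v ^+ 2 <= `|M| * a v v.
    by apply: le_trans h1 _; rewrite ler_wpM2r// ler_norm.
  rewrite /q; set A := a v v in h2 h3 *; have M0 := normr_ge0 M.
  have : (2 * l v) ^+ 2 <= (A + `|M|) ^+ 2.
    have := sqr_ge0 (A - `|M|); nra.
  rewrite -ler_sqrt ?sqr_ge0// !sqrtr_sqr (ger0_norm (addr_ge0 _ _))//.
  have := ler_norm (2 * l v); lra.
pose Q := [set r | exists2 v, H v & r = q v].
have infQ : has_inf Q.
  split; first by have [v hv] := H0; exists (q v); exists v.
  by exists (- `|M|) => _ [v hv ->]; exact: qge.
pose m := inf Q.
have mq v : H v -> m <= q v by move=> hv; apply: ge_inf; [exact: infQ.2|exists v].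
pose eps (k : nat) : R := k.+1%:R^-1.
have eps0 k : 0 < eps k by rewrite invr_gt0.
have /choice[f Hf] : forall k, exists v, H v /\ q v <= m + eps k.
  move=> k; have [_ [v hv ->] h] := inf_adherent (eps0 k) infQ.
  by exists v; split => //; exact: ltW.
have Hfk k := (Hf k).1; have qf k := (Hf k).2.
have eps_small (e : R) : 0 < e -> exists N, forall k, (N <= k)%N -> eps k <= e.
  move=> e0; have := @cvg_harmonic R => /cvgrPdist_le /(_ e e0)[N _ HN].
  exists N => k Nk; have := HN k Nk.
  by rewrite /= sub0r normrN ger0_norm// ltW// eps0.
have cauchy (e : R) : 0 < e -> exists N, forall j k, (N <= j)%N -> (N <= k)%N ->
    a (lin (-1) (f j) (f k)) (lin (-1) (f j) (f k)) <= e.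
  move=> e0; have [|N HN] := eps_small (e / 4); first by rewrite divr_gt0.
  exists N => j k Nj Nk; set d := lin (-1) (f j) (f k).
  have hd : H d by exact: Hlin.
  (* The midpoint of [f j] and [f k]. By the parallelogram identity its value of [q] is the mean of
     the two values minus [a d d / 4], and it is at least [m]; so [a d d] is at most twice
     [eps j + eps k]. *)
  have mid : H (lin (-1 / 2) (f j) d) by exact: Hlin.
  have := mq _ mid; rewrite /q form_sqrD// ll// {2}/d ll// ar// form_sqrD//.
  have := qf j; have := qf k; rewrite /q.
  have := HN j Nj; have := HN k Nk; lra.
have [g hg cg] := complete Hfk cauchy.
exists g => // h hh; apply/eqP; rewrite -subr_eq0 -sqrf_eq0 eq_le sqr_ge0 andbT.
apply: (@le_of_eps _ _ _ (4 * a h h)) => e e0 _; rewrite addr0.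
have [N1 HN1] := cg e e0; have [N2 HN2] := eps_small e e0.
pose k := maxn N1 N2.
have h1 := HN1 k (leq_maxl _ _); have h2 := HN2 k (leq_maxr _ _).
have ah := a0 hh.
(* The first variation: moving from [f k] along [h] cannot lower [q] by more than [eps k], and the
   discriminant of this quadratic in [t] is the claim. *)
have h3 : (a (f k) h - l h) ^+ 2 <= eps k * a h h.
  apply: discr_le => // t.
  have := mq _ (Hlin t (Hfk k) hh); rewrite /q form_sqrD// ll//.
  have := qf k; rewrite /q; lra.
have h4 : (a (f k) h - a g h) ^+ 2 <= e * a h h.
  have := form_CS (Hlin (-1) (Hfk k) hg) hh.
  rewrite al// mulN1r => /le_trans; apply; exact: ler_wpM2r.
have h5 : eps k * a h h <= e * a h h by exact: ler_wpM2r.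
have := sqr_ge0 ((a (f k) h - l h) + (a (f k) h - a g h)).
nra.
Qed.

End riesz.

Lemma Rintegral_sum d (T : measurableType d) (R : realType) (mu : {measure set T -> \bar R})
  (D : set T) (mD : measurable D) (I : Type) (r : seq I) (F : I -> T -> R) :
  (forall i, mu.-integrable D (EFin \o F i)) ->
  mu.-integrable D (EFin \o (fun x => \sum_(i <- r) F i x)) /\
  \int[mu]_(x in D) (\sum_(i <- r) F i x) = \sum_(i <- r) \int[mu]_(x in D) F i x.
Proof.
move=> iF; elim: r => [|i r [i1 i2]].
  rewrite big_nil; under eq_fun do rewrite big_nil; split; last first.
    by rewrite Rintegral_cst// mul0r.
  exact: integrable0.
under eq_fun do rewrite big_cons; split; first exact: integrableD_real.
rewrite big_cons.
by rewrite RintegralD// i2.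
Qed.

(** * The form a0 *)

Lemma linear_comb3 (R : comPzRingType) (Om k a a1 a2 b b1 b2 c c1 c2 : R) :
  a = a1 + k * a2 -> b = b1 + k * b2 -> c = c1 + k * c2 ->
  a + b - Om * c = a1 + b1 - Om * c1 + k * (a2 + b2 - Om * c2).
Proof. by move=> -> -> ->; ring. Qed.

Lemma antisym_comb (R : zmodType) (a b p q p' q' : R) :
  a = p - q -> b = p' - q' -> p = - p' -> q = - q' -> a = - b.
Proof. by move=> -> -> -> ->; rewrite opprK opprB addrC. Qed.

Lemma congr_comb3 (R : pzRingType) (Om a a' b b' c c' : R) :
  a = a' -> b = b' -> c = c' -> a + b - Om * c = a' + b' - Om * c'.
Proof. by move=> -> -> ->. Qed.

Lemma scaled_comb (R : comPzRingType) (z x y p q : R) :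
  x * (z * p) - y * (z * q) = z * (x * p - y * q).
Proof. by ring. Qed.

Section forms.
Context (R : realType) (m : nat).
Local Notation n := m.+2.
Local Notation E := 'rV[R]_n.
Local Notation mE := 'rV[measurableTypeR R]_n.
Local Notation mu := (lebesgue_rV R n).
Local Notation C := R[i].
Local Notation reC := (@complex.Re R).
Local Notation imC := (@complex.Im R).
Local Notation toC r := (r%:C%C : C).
Variables (D : set E) (L : R).
Hypothesis oD : open D.
Hypothesis DL : D `<=` cbox (fun=> - L) (fun=> L).
Variables (V : E -> R) (MV : R).
Hypothesis mV : @measurable_fun _ _ mE R D V.
Hypothesis V0 : {ae mu, forall x, D x -> 0 <= V x}.
Hypothesis VM : {ae mu, forall x, D x -> V x <= MV}.
Implicit Types (u v w g h f : E -> C) (Om : R).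
Local Notation ip f g := (cip D f g).
Local Notation wp := (weak_partial D).
Local Notation ripD f g := (rip mu (D : set mE) (f : mE -> R) (g : mE -> R)).
Local Notation intD F := (mu.-integrable (D : set mE) (EFin \o (F : mE -> R))).
Local Notation intg F := (\int[mu]_(x in (D : set mE)) F x).

Let mD : @measurable _ mE D := open_measurable_dom oD.

Definition re_pair f g : E -> R := fun x => reC (conjc (f x) * g x).

Lemma re_pairE f g x : re_pair f g x = reC (f x) * reC (g x) + imC (f x) * imC (g x).
Proof. by rewrite /re_pair !cplxE; ring. Qed.

Lemma re_pair_int f g : L2 D f -> L2 D g -> intD (re_pair f g).
Proof.
move=> /(L2P mD)[fr fi] /(L2P mD)[gr gi].
rewrite (_ : re_pair f g = fun x => reC (f x) * reC (g x) + imC (f x) * imC (g x)).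
  by apply: integrableD_real => //; exact: sqintegrableM.
by apply/funext => x; rewrite re_pairE.
Qed.

Lemma re_pair_integral f g : L2 D f -> L2 D g -> intg (re_pair f g) = ip f g.
Proof.
by move=> fi gi; rewrite cipE//; apply: eq_Rintegral => x _; rewrite re_pairE.
Qed.

Lemma coord_bound j : {ae mu, forall x, D x -> `|x 0 j| <= L}.
Proof.
apply: aeW => x Dx; rewrite ler_norml.
exact: DL Dx j.
Qed.

Lemma measurable_coord_dom j : @measurable_fun _ _ mE R D (fun x : E => x 0 j).
Proof. by apply: continuous_measurable_rV_in => //; exact: coord_continuous. Qed.

Lemma L2_coordM j u : L2 D u -> L2 D (fun x => toC (x 0 j) * u x).
Proof. by apply: L2_Mb (coord_bound j) => //; exact: measurable_coord_dom. Qed.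

Lemma V_bound : {ae mu, forall x, D x -> `|V x| <= MV}.
Proof. by apply: (aeS2 _ V0 VM) => x h1 h2 Dx; rewrite ger0_norm; [exact: h2|exact: h1]. Qed.

Lemma L2_VM u : L2 D u -> L2 D (fun x => toC (V x) * u x).
Proof. exact: (L2_Mb mD mV V_bound). Qed.

Lemma Lz_L2 u : H1 D u -> L2 D (Lz D u).
Proof.
move=> u1; apply: (L2Z mD); apply: (L2B mD); apply: L2_coordM; exact: weak_partial_L2.
Qed.

Lemma Lz_lin (c : C) u v : H1 D u -> H1 D v ->
  {ae mu, forall x, D x -> Lz D (fun x => u x + c * v x) x = Lz D u x + c * Lz D v x}.
Proof.
move=> u1 v1.
apply: (aeS2 _ (weak_partial_lin oD DL c (ix m) u1 v1) (weak_partial_lin oD DL c (iy m) u1 v1)).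
move=> x e1 e2 Dx; rewrite /Lz (e1 Dx) (e2 Dx).
move: (weak_partial D (ix m) u x) (weak_partial D (ix m) v x) => p q.
move: (weak_partial D (iy m) u x) (weak_partial D (iy m) v x) => p' q'.
ring.
Qed.

Definition Aform Om u v : R := \sum_i ip (wp i u) (wp i v) +
  ip (fun x => toC (V x) * u x) v - Om * ip u (Lz D v).

(* Real part of [c a0ip(u, v)]: [c = 1] and [c = -i] give the real and imaginary parts. *)
Lemma Re_c_a0ip Om (c : C) u v : H1 D u -> H1 D v ->
  intg (fun r => reC (c * (graddot D u v r + toC (V r) * conjc (u r) * v r
     - toC Om * conjc (u r) * Lz D v r))) =
  \sum_i ip (wp i u) (fun x => c * wp i v x) +
  ip (fun x => toC (V x) * u x) (fun x => c * v x) - Om * ip u (fun x => c * Lz D v x).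
Proof.
move=> u1 v1.
have ui := H1_L2 u1; have vi := H1_L2 v1.
have Vu := L2_VM ui; have cv := L2Z mD c vi; have Lv := Lz_L2 v1; have cLv := L2Z mD c Lv.
have wu i := weak_partial_L2 i u1; have cw i := L2Z mD c (weak_partial_L2 i v1).
pose F i := re_pair (wp i u) (fun x => c * wp i v x).
have iF i : intD (F i) by exact: re_pair_int.
have [iS eS] := @Rintegral_sum _ _ _ mu (D : set mE) mD _ (index_enum 'I_n) F iF.
have i2 := re_pair_int Vu cv; have i3 := integrableZ_real mD (- Om) (re_pair_int ui cLv).
have e : \int[mu]_(x in (D : set mE)) (\sum_i F i x + re_pair (fun x => toC (V x) * u x) (fun x =>
  c * v x) x +
   (- Om) * re_pair u (fun x => c * Lz D v x) x) =
  \sum_i ip (wp i u) (fun x => c * wp i v x) +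
  ip (fun x => toC (V x) * u x) (fun x => c * v x) - Om * ip u (fun x => c * Lz D v x).
  rewrite RintegralD//; last exact: integrableD_real.
  rewrite RintegralD// eS RintegralZl//; last exact: re_pair_int.
  rewrite !re_pair_integral// mulNr; congr (_ + _ - _).
  by apply: eq_bigr => i _; rewrite re_pair_integral.
rewrite -e; apply: eq_Rintegral => x _.
rewrite mulrBr mulrDr ReD ReD ReN; congr (_ + _ + _).
- rewrite /graddot mulr_sumr (big_morph reC (@ReD R) (erefl _)).
  by apply: eq_bigr => i _; rewrite /F /re_pair !cplxE; ring.
- by rewrite /re_pair; move: (u x) (v x) => p q; rewrite !cplxE/=; ring.
- by rewrite /re_pair; move: (u x) (Lz D v x) => p q; rewrite !cplxE/=; ring.
Qed.

Lemma Re_a0ip Om u v : H1 D u -> H1 D v -> reC (a0ip D V Om u v) = Aform Om u v.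
Proof.
move=> u1 v1; have := Re_c_a0ip Om 1 u1 v1.
rewrite [X in X = _ -> _](_ : _ = reC (a0ip D V Om u v)); last first.
  by apply: eq_Rintegral => x _; rewrite mul1r.
move=> ->; rewrite /Aform; congr (_ + _ - _ * _).
- by apply: eq_bigr => i _; congr cip; apply/funext => x; rewrite mul1r.
- by congr cip; apply/funext => x; rewrite mul1r.
- by congr cip; apply/funext => x; rewrite mul1r.
Qed.

Lemma H1Z (c : C) v : H1 D v -> H1 D (fun x => c * v x).
Proof.
move=> v1; have e : (fun x => c * v x) = (fun x => v x + (c - 1) * v x).
  by apply/funext => x; ring.
by rewrite e; exact: (H1_lin oD DL).
Qed.

Lemma weak_partialZ (c : C) i v : H1 D v ->
  {ae mu, forall x, D x -> wp i (fun x => c * v x) x = c * wp i v x}.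
Proof.
move=> v1; have e : (fun x => c * v x) = (fun x => v x + (c - 1) * v x).
  by apply/funext => x; ring.
rewrite e; apply: aeS (weak_partial_lin oD DL (c - 1) i v1 v1) => x h Dx.
by rewrite (h Dx) mulrBl mul1r addrC subrK.
Qed.

Lemma LzZ (c : C) v : H1 D v ->
  {ae mu, forall x, D x -> Lz D (fun x => c * v x) x = c * Lz D v x}.
Proof.
move=> v1; have e : (fun x => c * v x) = (fun x => v x + (c - 1) * v x).
  by apply/funext => x; ring.
rewrite e; apply: aeS (Lz_lin (c - 1) v1 v1) => x h Dx.
by rewrite (h Dx) mulrBl mul1r addrC subrK.
Qed.

Lemma H01Z (c : C) v : H01 D v -> H01 D (fun x => c * v x).
Proof.
move=> v1; have e : (fun x => c * v x) = (fun x => v x + (c - 1) * v x).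
  by apply/funext => x; ring.
by rewrite e; exact: (H01_lin oD DL).
Qed.

Lemma Im_a0ip Om u v : H1 D u -> H1 D v ->
  imC (a0ip D V Om u v) = Aform Om u (fun x => - 'i%C * v x).
Proof.
move=> u1 v1; have := Re_c_a0ip Om (- 'i%C) u1 v1.
rewrite [X in X = _ -> _](_ : _ = imC (a0ip D V Om u v)); last first.
  by apply: eq_Rintegral => x _; rewrite ReM/=; ring.
have w1 := H1Z (- 'i%C) v1.
have ui := H1_L2 u1.
move=> ->; rewrite /Aform; congr (_ + _ - _ * _).
- apply: eq_bigr => i _; rewrite cipC [RHS]cipC; apply: (eq_cip_ae mD).
  + exact: (L2Z mD _ (weak_partial_L2 i v1)).
  + exact: weak_partial_L2.
  + exact: weak_partial_L2.
  + by apply: aeS (weak_partialZ (- 'i%C) i v1) => x h Dx; exact/esym/h.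
- rewrite cipC [RHS]cipC; apply: (eq_cip_ae mD) => //.
  + exact: (L2Z mD _ (Lz_L2 v1)).
  + exact: Lz_L2.
  + by apply: aeS (LzZ (- 'i%C) v1) => x h Dx; exact/esym/h.
Qed.

Lemma Aform_linl Om (k : R) u v w : H1 D u -> H1 D v -> H1 D w ->
  Aform Om (fun x => u x + toC k * v x) w = Aform Om u w + k * Aform Om v w.
Proof.
move=> u1 v1 w1; have uv := H1_lin oD DL (toC k) u1 v1.
have ui := H1_L2 u1; have vi := H1_L2 v1; have wi := H1_L2 w1.
have Lw := Lz_L2 w1; have Vu := L2_VM ui; have Vv := L2_VM vi.
have e1 : \sum_i ip (wp i (fun x => u x + toC k * v x)) (wp i w) =
    \sum_i ip (wp i u) (wp i w) + k * \sum_i ip (wp i v) (wp i w).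
  rewrite mulr_sumr -big_split; apply: eq_bigr => i _ /=.
  have wu := weak_partial_L2 i u1; have wv := weak_partial_L2 i v1.
  have ww := weak_partial_L2 i w1.
  have wuv := weak_partial_L2 i uv; have wl := L2_lin mD (toC k) wu wv.
  have ae := weak_partial_lin oD DL (toC k) i u1 v1.
  exact: (etrans (eq_cip_ae mD wuv wl ww ae) (cip_linl mD k wu wv ww)).
have e2 : ip (fun x => toC (V x) * (u x + toC k * v x)) w =
    ip (fun x => toC (V x) * u x) w + k * ip (fun x => toC (V x) * v x) w.
  apply: etrans (cip_linl mD k Vu Vv wi).
  by congr cip; apply/funext => x; rewrite mulrDr mulrCA.
exact: (linear_comb3 Om e1 e2 (cip_linl mD k ui vi Lw)).
Qed.

Lemma rip_coordM j (p q : E -> R) : ripD (fun x => x 0 j * p x) q = ripD p (fun x => x 0 j * q x).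
Proof. by apply: eq_Rintegral => x _; ring. Qed.

(** As [i] and [j] differ, the derivative in direction [i] of the coordinate [j] times a test
    function has no extra term; that product is then an admissible test function for the weak
    derivative of [w]. *)
Lemma coord_parts_test i j f w : i != j -> ctest_fun D f -> H1 D w ->
  ip f (fun x => toC (x 0 j) * wp i w x) = - ip (fun x => toC (x 0 j) * cpartial i f x) w.
Proof.
move=> ij [t1 t2] w1; have [wi /(is_weak_partialP D)ww] := H1_weak_partial i w1.
have key (phi : E -> R) : test_fun D phi ->
    partial i (fun x => x 0 j * phi x) = (fun x => x 0 j * partial i phi x).
  move=> tp; apply/funext => x; rewrite partial_coordM; last exact: tp.1.
  by rewrite (negbTE ij) mul0r addr0.
have [h1 _] := ww _ (test_fun_coordM j t1); have [_ h2] := ww _ (test_fun_coordM j t2).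
rewrite key// in h1; rewrite key// in h2.
rewrite opprD; congr (_ + _).
  rewrite ripC; under [X in rip _ _ X _]eq_fun do rewrite ReM/= mul0r subr0.
  rewrite rip_coordM; apply: oppr_inj; rewrite opprK -h1 ripC.
  by under [RHS]eq_Rintegral do rewrite ReM/= mul0r subr0.
rewrite ripC; under [X in rip _ _ X _]eq_fun do rewrite ImM/= mul0r addr0.
rewrite rip_coordM; apply: oppr_inj; rewrite opprK -h2 ripC.
by under [RHS]eq_Rintegral do rewrite ImM/= mul0r addr0.
Qed.

(** Approximating [v] alone is enough: both sides are continuous in [v] for the H1 norm, and [v]
    being a limit of test functions removes any boundary term. *)
Lemma coord_parts i j v w : i != j -> H01 D v -> H1 D w ->
  ip v (fun x => toC (x 0 j) * wp i w x) = - ip (fun x => toC (x 0 j) * wp i v x) w.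
Proof.
move=> ij /(H01P oD DL)[v1 hv] w1.
set a := fun x : E => toC (x 0 j) * wp i w x.
have ai : L2 D a by exact: (L2_coordM j (weak_partial_L2 i w1)).
have wi := H1_L2 w1; have vi := H1_L2 v1; have dvi := weak_partial_L2 i v1.
set b := fun x : E => toC (x 0 j) * w x.
have bi : L2 D b by exact: L2_coordM.
have sw f : ip (fun x => toC (x 0 j) * f x) w = ip f b.
  by congr (_ + _); apply: eq_Rintegral => x _; rewrite /b !cplxE/=; ring.
rewrite sw; apply/eqP; rewrite -addr_eq0 -sqrf_eq0 eq_le sqr_ge0 andbT.
apply: (@le_of_eps _ _ _ (2 * ip a a + 2 * ip b b)) => e e0 _; rewrite addr0.
have [f tf hf] := hv e e0.
have fi := ctest_L2 oD DL tf; have dfi := ctest_partial_L2 oD DL i tf.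
have := coord_parts_test ij tf w1; rewrite sw -/a => h0.
(* The identity holds for the test function [f], so only the errors [v - f] and those of its
   derivative remain. *)
have -> : ip v a + ip (wp i v) b =
    ip (fun x => v x - f x) a + ip (fun x => wp i v x - cpartial i f x) b.
  by rewrite !(cipBl mD)// h0; ring.
have c1 := cip_CS mD (L2B mD vi fi) ai.
have c2 := cip_CS mD (L2B mD dvi dfi) bi.
have d1 : ip (fun x => v x - f x) (fun x => v x - f x) <= e.
  apply: le_trans (ltW hf); rewrite lerDl; apply: sumr_ge0 => k _; exact: cip_ge0.
have d2 : ip (fun x => wp i v x - cpartial i f x) (fun x => wp i v x - cpartial i f x) <= e.
  apply: le_trans (ltW hf); rewrite /test_dist (bigD1 i)//= addrCA lerDl.
  by rewrite addr_ge0 ?cip_ge0//; apply: sumr_ge0 => k _; exact: cip_ge0.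
have a0 := cip_ge0 D a; have b0 := cip_ge0 D b.
have c3 := le_trans c1 (ler_wpM2r a0 d1); have c4 := le_trans c2 (ler_wpM2r b0 d2).
move: (ip (fun x => v x - f x) a) (ip (fun x => wp i v x - cpartial i f x) b) c3 c4 => p q.
move: (ip a a) (ip b b) => A B c3 c4 {d1 d2 c1 c2 h0 hf}.
have := sqr_ge0 (p - q); nra.
Qed.

Lemma Vm_sym u v : ip (fun x => toC (V x) * u x) v = ip (fun x => toC (V x) * v x) u.
Proof. by congr (_ + _); apply: eq_Rintegral => x _; rewrite !cplxE/=; ring. Qed.

Opaque cip weak_partial.

(** [Lz] is [- 'i] times the real rotation field [Mz]. Both factors are antisymmetric for the real
    product, and weak derivatives commute with multiplication by ['i]. *)
Lemma Lz_sym u v : H01 D u -> H01 D v -> ip u (Lz D v) = ip (Lz D u) v.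
Proof.
move=> u0 v0; have u1 := H01_H1 u0; have v1 := H01_H1 v0.
have ui := H1_L2 u1; have vi := H1_L2 v1.
pose Mz w := fun x : E => toC (x 0 (ix m)) * wp (iy m) w x - toC (x 0 (iy m)) * wp (ix m) w x.
have Mi w : H1 D w -> L2 D (Mz w).
  by move=> w1; apply: (L2B mD); apply: L2_coordM; exact: weak_partial_L2.
have ixy : ix m != iy m by [].
have anti w w' : H01 D w -> H01 D w' -> ip w (Mz w') = - ip (Mz w) w'.
  move=> w0 w0'; have w1 := H01_H1 w0; have w1' := H01_H1 w0'.
  have l k k' z : H1 D z -> L2 D (fun x => toC (x 0 k') * wp k z x).
    by move=> h; exact: (L2_coordM k' (weak_partial_L2 k h)).
  have A1 : ip w (Mz w') = ip w (fun x => toC (x 0 (ix m)) * wp (iy m) w' x) -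
      ip w (fun x => toC (x 0 (iy m)) * wp (ix m) w' x).
    exact: (cipBr mD (l _ _ _ w1') (l _ _ _ w1') (H1_L2 w1)).
  have A2 : ip (Mz w) w' = ip (fun x => toC (x 0 (ix m)) * wp (iy m) w x) w' -
      ip (fun x => toC (x 0 (iy m)) * wp (ix m) w x) w'.
    exact: (cipBl mD (l _ _ _ w1) (l _ _ _ w1) (H1_L2 w1')).
  have B1 := @coord_parts (iy m) (ix m) w w' isT w0 w1'.
  have B2 := @coord_parts (ix m) (iy m) w w' isT w0 w1'.
  exact: (antisym_comb A1 A2 B1 B2).
have iu := H01Z 'i%C u0.
have Li w : Lz D w = (fun x => - ('i%C * Mz w x)).
  by apply/funext => x; rewrite /Lz mulNr.
have iM w : H1 D w -> L2 D (fun x => 'i%C * Mz w x) by move=> w1; exact: (L2Z mD _ (Mi _ w1)).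
rewrite !Li cipC (cipNl mD (iM _ v1) ui) (cipNl mD (iM _ u1) vi) [cip D _ u]cipC.
rewrite -(cip_il mD ui (Mi _ v1)) anti//; congr (- _).
apply: (eq_cip_ae mD) => //; [exact: Mi (H01_H1 iu)|exact: iM|].
apply: (aeS2 _ (weak_partialZ 'i%C (ix m) u1) (weak_partialZ 'i%C (iy m) u1)).
by move=> x e1 e2 Dx; rewrite /Mz (e1 Dx) (e2 Dx); exact: scaled_comb.
Qed.

Lemma Aform_sym Om u v : H01 D u -> H01 D v -> Aform Om u v = Aform Om v u.
Proof.
move=> u0 v0.
have e1 : \sum_i ip (wp i u) (wp i v) = \sum_i ip (wp i v) (wp i u).
  by apply: eq_bigr => i _; exact: cipC.
exact: (congr_comb3 Om e1 (Vm_sym u v) (etrans (Lz_sym u0 v0) (cipC D (Lz D u) v))).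
Qed.

End forms.

(** * Coercivity and boundedness of the a0 form *)

Lemma rotation_young (R : realFieldType) (s Om x y a b p1 p2 q1 q2 S v : R) : 0 < s ->
  s / 4 * Om ^+ 2 * (x ^+ 2 + y ^+ 2) <= v ->
  p1 ^+ 2 + p2 ^+ 2 + q1 ^+ 2 + q2 ^+ 2 <= S ->
  Om * (a * (x * p2 - y * q2) - b * (x * p1 - y * q1)) <=
  s^-1 * S + v * (a ^+ 2 + b ^+ 2).
Proof.
move=> s0 hv hS; rewrite -(ler_pM2l s0).
have -> : s * (s^-1 * S + v * (a ^+ 2 + b ^+ 2)) = S + s * (v * (a ^+ 2 + b ^+ 2)).
  by field; rewrite gt_eqF.
have ab : 0 <= a ^+ 2 + b ^+ 2 by rewrite addr_ge0 ?sqr_ge0.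
have h1 : s * (s / 4 * Om ^+ 2 * (x ^+ 2 + y ^+ 2) * (a ^+ 2 + b ^+ 2)) <=
    s * (v * (a ^+ 2 + b ^+ 2)) by rewrite ler_pM2l// ler_wpM2r.
(* Here [a], [b] are the parts of [u], the [p]'s those of its y-derivative and the [q]'s those of
   its x-derivative. Each square completes one cross term; the leftover terms of order zero are
   those that the trap bounds by the potential. *)
have e1 := sqr_ge0 (p2 - s * Om * x * a / 2).
have e2 := sqr_ge0 (p1 + s * Om * x * b / 2).
have e3 := sqr_ge0 (q2 + s * Om * y * a / 2).
have e4 := sqr_ge0 (q1 - s * Om * y * b / 2).
apply: le_trans (lerD hS h1); rewrite -subr_ge0.
have -> : p1 ^+ 2 + p2 ^+ 2 + q1 ^+ 2 + q2 ^+ 2 +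
   s * (s / 4 * Om ^+ 2 * (x ^+ 2 + y ^+ 2) * (a ^+ 2 + b ^+ 2)) -
   s * (Om * (a * (x * p2 - y * q2) - b * (x * p1 - y * q1))) =
   (p2 - s * Om * x * a / 2) ^+ 2 + (p1 + s * Om * x * b / 2) ^+ 2 +
   (q2 + s * Om * y * a / 2) ^+ 2 + (q1 - s * Om * y * b / 2) ^+ 2 by field.
by rewrite !addr_ge0.
Qed.

Lemma le_pair_sum (R : realFieldType) (I : finType) (F : I -> R) (i j : I) : j != i ->
  (forall k, 0 <= F k) -> F i + F j <= \sum_k F k.
Proof.
move=> ji F0; rewrite (bigD1 i)//= (bigD1 j)//= addrA lerDl.
by apply: sumr_ge0 => k _; exact: F0.
Qed.

Lemma le_addA (R : realFieldType) (a b c d s : R) : a + b + (c + d) <= s -> a + b + c + d <= s.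
Proof. by rewrite !addrA. Qed.

Lemma Rintegral_ge0_ae d (T : measurableType d) (R : realType) (mu : {measure set T -> \bar R})
  (D : set T) (mD : measurable D) (F : T -> R) : mu.-integrable D (EFin \o F) ->
  {ae mu, forall x, D x -> 0 <= F x} -> 0 <= \int[mu]_(x in D) F x.
Proof.
move=> iF F0.
have -> : \int[mu]_(x in D) F x = \int[mu]_(x in D) `|F x|.
  rewrite /Rintegral; congr fine; apply: ae_eq_integral => //.
  - exact: measurable_int iF.
  - by apply/measurable_EFinP; apply: measurableT_comp => //; exact: integrable_real_measurable iF.
  - by apply: aeS F0 => x /= h Dx; rewrite ger0_norm ?h.
by apply: Rintegral_ge0 => x _.
Qed.

Section form_bounds.
Context (R : realType) (m : nat).
Local Notation n := m.+2.
Local Notation E := 'rV[R]_n.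
Local Notation mE := 'rV[measurableTypeR R]_n.
Local Notation mu := (lebesgue_rV R n).
Local Notation C := R[i].
Local Notation reC := (@complex.Re R).
Local Notation imC := (@complex.Im R).
Local Notation toC r := (r%:C%C : C).
Variables (D : set E) (L : R).
Hypothesis oD : open D.
Hypothesis L0 : 0 < L.
Hypothesis DL : D `<=` cbox (fun=> - L) (fun=> L).
Variables (V : E -> R) (MV : R).
Hypothesis mV : @measurable_fun _ _ mE R D V.
Hypothesis V0 : {ae mu, forall x, D x -> 0 <= V x}.
Hypothesis VM : {ae mu, forall x, D x -> V x <= MV}.
Implicit Types (u v w g h f : E -> C).
Local Notation ip f g := (cip D f g).
Local Notation wp := (weak_partial D).
Local Notation gn u := (gnorm2 D u).
Local Notation intD F := (mu.-integrable (D : set mE) (EFin \o (F : mE -> R))).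
Local Notation intg F := (\int[mu]_(x in (D : set mE)) F x).
Local Notation Vm u := (fun x => toC (V x) * u x).

Let mD : @measurable _ mE D := open_measurable_dom oD.
Variables (Om K : R).
Hypothesis K0 : 0 < K.
Hypothesis trap : {ae mu, forall r, D r ->
  (1 + K) / 4 * Om ^+ 2 * (r 0 (ix m) ^+ 2 + r 0 (iy m) ^+ 2) <= V r}.

Let s0 : 0 < 1 + K. Proof. exact: addr_gt0. Qed.

Let L2V u : L2 D u -> L2 D (Vm u). Proof. exact: (L2_VM oD mV V0 VM). Qed.

(** Stated for any [Om'] with the same square, so that [Om] itself gives coercivity and [- Om] the
    upper bound on the form. *)
Lemma rotation_bound (Om' : R) u : Om' ^+ 2 = Om ^+ 2 -> H1 D u ->
  Om' * ip u (Lz D u) <= (1 + K)^-1 * gn u + ip (Vm u) u.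
Proof.
move=> OO u1; have ui := H1_L2 u1; have Vu := L2V ui; have Lu := Lz_L2 oD DL u1.
have wu i := weak_partial_L2 i u1.
pose F i := re_pair (wp i u) (wp i u).
have iF i : intD (F i) by exact: re_pair_int.
have [iS eS] := @Rintegral_sum _ _ _ mu (D : set mE) mD _ (index_enum 'I_n) F iF.
have i1 := integrableZ_real mD ((1 + K)^-1) iS.
have i2 := re_pair_int oD Vu ui; have i3 := re_pair_int oD ui Lu.
have i4 := integrableZ_real mD (- Om') i3.
rewrite -subr_ge0.
have -> : (1 + K)^-1 * gn u + ip (Vm u) u - Om' * ip u (Lz D u) =
   intg (fun x => (1 + K)^-1 * (\sum_i F i x) + re_pair (Vm u) u x + (- Om') * re_pair u (Lz D u)
     x).
  rewrite RintegralD//; last exact: integrableD_real.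
  rewrite RintegralD// !RintegralZl// eS !re_pair_integral// mulNr; congr (_ * _ + _ - _).
  by apply: eq_bigr => i _; rewrite re_pair_integral.
apply: Rintegral_ge0_ae => //.
  by apply: integrableD_real => //; exact: integrableD_real.
apply: aeS trap => x tx Dx; rewrite mulNr subr_ge0.
have e2 : re_pair (Vm u) u x = V x * (reC (u x) ^+ 2 + imC (u x) ^+ 2).
  by rewrite re_pairE !cplxE/=; ring.
have e3 : re_pair u (Lz D u) x =
  reC (u x) * (x 0 (ix m) * imC (wp (iy m) u x) - x 0 (iy m) * imC (wp (ix m) u x)) -
  imC (u x) * (x 0 (ix m) * reC (wp (iy m) u x) - x 0 (iy m) * reC (wp (ix m) u x)).
  rewrite re_pairE /Lz.
  move: (u x) (wp (iy m) u x) (wp (ix m) u x) (x 0 (ix m)) (x 0 (iy m)) => a b c d e.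
  by rewrite !cplxE/=; ring.
rewrite e2 e3; apply: (@rotation_young R (1 + K) Om' (x 0 (ix m)) (x 0 (iy m)) (reC (u x)) (imC (u
  x)) (reC (wp (iy m) u x)) (imC (wp (iy m) u x)) (reC (wp (ix m) u x)) (imC (wp (ix m) u x))
  (\sum_i F i x) (V x) s0).
  by rewrite OO; exact: tx.
have FE i : F i x = reC (wp i u x) ^+ 2 + imC (wp i u x) ^+ 2 by rewrite /F re_pairE -!expr2.
have h : F (iy m) x + F (ix m) x <= \sum_i F i x.
  by apply: (@le_pair_sum R 'I_n (F^~ x)) => // i; rewrite FE addr_ge0 ?sqr_ge0.
move: h; rewrite (FE (iy m)) (FE (ix m)).
exact: le_addA.
Qed.

(** The rotation may use up the whole potential, but only the fraction [1 / (1 + K)] of the gradient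
    term. *)
Lemma Aform_coercive u : H1 D u -> K / (1 + K) * gn u <= Aform D V Om u u.
Proof.
move=> u1; have := rotation_bound (erefl (Om ^+ 2)) u1.
have -> : K / (1 + K) = 1 - (1 + K)^-1 by field; rewrite gt_eqF.
by rewrite /Aform mulrBl mul1r -/(gn u); lra.
Qed.

Lemma V_ip_le u : L2 D u -> ip (Vm u) u <= `|MV| * ip u u.
Proof.
move=> ui; have Vu := L2V ui; rewrite -subr_ge0.
have i1 := re_pair_int oD ui ui; have i2 := re_pair_int oD Vu ui.
have -> : `|MV| * ip u u - ip (Vm u) u = intg (fun x => `|MV| * re_pair u u x + (- 1) * re_pair (Vm
  u) u x).
  rewrite RintegralD//; try exact: integrableZ_real.
  by rewrite !RintegralZl// !re_pair_integral// mulN1r.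
apply: Rintegral_ge0_ae => //; first by apply: integrableD_real => //; exact: integrableZ_real.
apply: aeS VM => x h Dx.
have -> : re_pair (Vm u) u x = V x * re_pair u u x by rewrite !re_pairE !cplxE/=; ring.
rewrite mulN1r -mulrBl mulr_ge0//.
  by rewrite subr_ge0; apply: le_trans (h Dx) (ler_norm _).
by rewrite re_pairE -!expr2 addr_ge0 ?sqr_ge0.
Qed.

(** The rotation at most doubles the gradient and potential terms; the potential is then bounded by
    the gradient through [MV] and the Poincaré inequality. *)
Lemma Aform_bounded u : H01 D u -> Aform D V Om u u <= (2 + 2 * `|MV| * (64 * L ^+ 2)) * gn u.
Proof.
move=> u0; have u1 := H01_H1 u0.
have h1 := rotation_bound (sqrrN Om) u1; have h2 := V_ip_le (H1_L2 u1).
have h3 := poincare oD L0 DL u0; have M0 := normr_ge0 MV.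
have h4 := ler_wpM2l M0 h3; have g0 := gnorm2_ge0 D u.
have h5 : (1 + K)^-1 * gn u <= gn u.
  by rewrite ler_piMl// invf_le1// lerDl ltW.
rewrite mulNr in h1; rewrite /Aform -/(gn u).
have -> : (2 + 2 * `|MV| * (64 * L ^+ 2)) * gn u = 2 * gn u + 2 * (`|MV| * (64 * L ^+ 2 * gn u)) by
  ring.
lra.
Qed.

Lemma Aform_ge0 u : H1 D u -> 0 <= Aform D V Om u u.
Proof.
move=> u1; apply: le_trans (Aform_coercive u1); rewrite mulr_ge0 ?gnorm2_ge0//.
by rewrite divr_ge0// ltW.
Qed.

End form_bounds.

(** * The quartic part of the energy *)

(** Here [s], [t] are the squared moduli of [u] and [p], and [r] is their real pairing. The term
    linear in [a] has to be exact, as it belongs to the derivative of the energy; [a <= 1] lets all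
    higher ones be estimated by [a ^+ 2]. *)
Lemma quartic_pointwise (R : realFieldType) (s t r a : R) : 0 <= s -> 0 <= t -> r ^+ 2 <= s * t ->
  0 <= a -> a <= 1 -> (s - 2 * a * r + a ^+ 2 * t) ^+ 2 <=
  s ^+ 2 + (- 4 * a) * (s * r) + (8 * a ^+ 2) * (s * t) + (3 * a ^+ 2) * t ^+ 2.
Proof.
move=> s0 t0 rst a0 a1; rewrite -subr_ge0.
have -> : s ^+ 2 + (- 4 * a) * (s * r) + (8 * a ^+ 2) * (s * t) + (3 * a ^+ 2) * t ^+ 2 -
   (s - 2 * a * r + a ^+ 2 * t) ^+ 2 =
   a ^+ 2 * (6 * (s * t - r ^+ 2) + 2 * (r + a * t) ^+ 2 + 3 * ((1 - a ^+ 2) * t ^+ 2)) by ring.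
have h1 : 0 <= s * t - r ^+ 2 by rewrite subr_ge0.
have h2 : 0 <= 1 - a ^+ 2 by rewrite subr_ge0 expr_le1.
apply: mulr_ge0 (sqr_ge0 _) _; apply: addr_ge0; last by rewrite mulr_ge0// mulr_ge0 ?sqr_ge0.
by apply: addr_ge0; rewrite mulr_ge0// sqr_ge0.
Qed.

Section quartic.
Context (R : realType) (m : nat).
Local Notation n := m.+2.
Local Notation E := 'rV[R]_n.
Local Notation mE := 'rV[measurableTypeR R]_n.
Local Notation mu := (lebesgue_rV R n).
Local Notation C := R[i].
Local Notation reC := (@complex.Re R).
Local Notation imC := (@complex.Im R).
Local Notation toC r := (r%:C%C : C).
Variables (D : set E) (L : R).
Hypothesis oD : open D.
Hypothesis DL : D `<=` cbox (fun=> - L) (fun=> L).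
Variables (V : E -> R) (MV : R).
Hypothesis mV : @measurable_fun _ _ mE R D V.
Hypothesis V0 : {ae mu, forall x, D x -> 0 <= V x}.
Hypothesis VM : {ae mu, forall x, D x -> V x <= MV}.
Implicit Types (u v w g h f : E -> C).
Local Notation ip f g := (cip D f g).
Local Notation wp := (weak_partial D).
Local Notation sqi h := (sqintegrable mu (D : set mE) (h : mE -> R)).
Local Notation ripD f g := (rip mu (D : set mE) (f : mE -> R) (g : mE -> R)).
Local Notation intD F := (mu.-integrable (D : set mE) (EFin \o (F : mE -> R))).
Local Notation intg F := (\int[mu]_(x in (D : set mE)) F x).
Local Notation Vm u := (fun x => toC (V x) * u x).

Let mD : @measurable _ mE D := open_measurable_dom oD.
Local Notation L4 := (L4 D).
Local Notation q4 := (q4 D).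

Definition w2 u : E -> R := fun x => Normc.normc (u x) ^+ 2.

Lemma w2_ge0 u x : 0 <= w2 u x. Proof. exact: sqr_ge0. Qed.

Lemma w2E u x : w2 u x = reC (u x) ^+ 2 + imC (u x) ^+ 2.
Proof. exact: normc_sqr. Qed.

Lemma re_pair_sqr_le u h x : re_pair u h x ^+ 2 <= w2 u x * w2 h x.
Proof.
rewrite re_pairE !w2E; move: (reC (u x)) (imC (u x)) (reC (h x)) (imC (h x)) => a b c d.
have := sqr_ge0 (a * d - b * c); lra.
Qed.

Lemma L4_w2 u : L4 u -> sqi (w2 u).
Proof.
move=> [ui i4]; have [[m1 m2] _] := ui; split.
  rewrite (_ : w2 u = fun x => reC (u x) ^+ 2 + imC (u x) ^+ 2).
    by apply: measurable_funD; exact: measurable_funX.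
  by apply/funext => x; exact: w2E.
by rewrite (_ : (fun x => _) = (fun x => Normc.normc (u x) ^+ 4))//; apply/funext => x; rewrite
  -exprM.
Qed.

(** [Xf u h] pairs the cubic term [|u| ^+ 2 u] with [h], a quarter of the derivative of [q4] at [u].
    [Yf u h] controls the second-order remainder. *)
Definition Xf u h : R := ripD (w2 u) (re_pair u h).
Definition Yf u h : R := ripD (w2 u) (w2 h).

Lemma q4E u : q4 u = Yf u u.
Proof. by apply: eq_Rintegral => x _; rewrite -exprD. Qed.

Lemma q4_ge0 u : 0 <= q4 u.
Proof. by rewrite q4E; exact: rip_ge0. Qed.

Lemma sqi_re_pair u h : L4 u -> L4 h -> sqi (re_pair u h).
Proof.
move=> u4 h4; have iw := sqintegrableM mD (L4_w2 u4) (L4_w2 h4).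
have mr := integrable_real_measurable (re_pair_int oD u4.1 h4.1).
split => //; apply: (integrable_le_real mD _ _ iw); first exact: measurable_funX.
by move=> x _; rewrite ger0_norm ?sqr_ge0//; exact: re_pair_sqr_le.
Qed.

Lemma Yf_CS u h : L4 u -> L4 h -> Yf u h ^+ 2 <= q4 u * q4 h.
Proof. by move=> u4 h4; rewrite !q4E; apply: rip_CS => //; exact: L4_w2. Qed.

Lemma Yf_ge0 u h : 0 <= Yf u h.
Proof. by apply: Rintegral_ge0 => x _; rewrite mulr_ge0// w2_ge0. Qed.

Lemma Xf_CS u h : L4 u -> L4 h -> Xf u h ^+ 2 <= q4 u * Yf u h.
Proof.
move=> u4 h4; have wi := L4_w2 u4; have hi := L4_w2 h4; have ri := sqi_re_pair u4 h4.
apply: le_trans (rip_CS mD wi ri) _; rewrite q4E ler_wpM2l ?rip_ge0//.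
apply: le_Rintegral => //; first exact: ri.2.
  exact: sqintegrableM.
by move=> x _; rewrite -expr2; exact: re_pair_sqr_le.
Qed.

Lemma Xf_lin (k : R) u h g : L4 u -> L4 h -> L4 g ->
  Xf u (fun x => h x + toC k * g x) = Xf u h + k * Xf u g.
Proof.
move=> u4 h4 g4; have wi := L4_w2 u4; have hi := sqi_re_pair u4 h4; have gi := sqi_re_pair u4 g4.
rewrite /Xf ripC [ripD (w2 u) (re_pair u h)]ripC [ripD (w2 u) (re_pair u g)]ripC -ripZl//.
rewrite -ripDl//; last exact: sqintegrableZ.
by apply: eq_Rintegral => x _; congr (_ * _); rewrite !re_pairE !cplxE/=; ring.
Qed.

Lemma quartic_expand (a : R) u p : 0 <= a -> a <= 1 -> L4 u -> L4 p ->
  L4 (fun x => u x + toC (- a) * p x) ->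
  q4 (fun x => u x + toC (- a) * p x) <=
  q4 u - 4 * a * Xf u p + a ^+ 2 * (8 * Yf u p + 3 * q4 p).
Proof.
move=> a0 a1 u4 p4 v4.
have wu := L4_w2 u4; have wp := L4_w2 p4; have wv := L4_w2 v4; have ri := sqi_re_pair u4 p4.
have i1 := sqintegrableM mD wu wu; have i2 := sqintegrableM mD wu ri.
have i3 := sqintegrableM mD wu wp; have i4 := sqintegrableM mD wp wp.
have j2 := integrableZ_real mD (- 4 * a) i2.
have j3 := integrableZ_real mD (8 * a ^+ 2) i3.
have j4 := integrableZ_real mD (3 * a ^+ 2) i4.
have k1 := integrableD_real mD i1 j2; have k2 := integrableD_real mD k1 j3.
have -> : q4 u - 4 * a * Xf u p + a ^+ 2 * (8 * Yf u p + 3 * q4 p) =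
  intg (fun x => w2 u x * w2 u x + (- 4 * a) * (w2 u x * re_pair u p x) +
    (8 * a ^+ 2) * (w2 u x * w2 p x) + (3 * a ^+ 2) * (w2 p x * w2 p x)).
  rewrite RintegralD// RintegralD// RintegralD// !RintegralZl// !q4E.
  change (Yf u u - 4 * a * Xf u p + a ^+ 2 * (8 * Yf u p + 3 * Yf p p) =
    Yf u u + - 4 * a * Xf u p + 8 * a ^+ 2 * Yf u p + 3 * a ^+ 2 * Yf p p).
  move: (Yf u u) (Yf p p) (Yf u p) (Xf u p) => y1 y2 y3 x1; ring.
rewrite q4E; apply: le_Rintegral => //.
- exact: sqintegrableM.
- exact: integrableD_real.
move=> x _.
have -> : w2 (fun x => u x + toC (- a) * p x) x = w2 u x - 2 * a * re_pair u p x + a ^+ 2 * w2 p x.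
  rewrite !w2E re_pairE !cplxE/=.
  move: (reC (u x)) (imC (u x)) (reC (p x)) (imC (p x)) => b c d e; ring.
rewrite -!expr2; apply: quartic_pointwise => //; try exact: w2_ge0.
exact: re_pair_sqr_le.
Qed.

Variables (beta Om : R).

Lemma energyE u : H01 D u -> L4 u ->
  energy D V beta Om u = 1 / 2 * Aform D V Om u u + beta / 4 * q4 u.
Proof.
move=> u0 u4; have u1 := H01_H1 u0; have ui := H1_L2 u1.
have Vu := L2_VM oD mV V0 VM ui; have Lu := Lz_L2 oD DL u1.
have wu i := weak_partial_L2 i u1.
pose F i := re_pair (wp i u) (wp i u).
have iF i : intD (F i) by exact: re_pair_int.
have [iS eS] := @Rintegral_sum _ _ _ mu (D : set mE) mD _ (index_enum 'I_n) F iF.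
have i2 := re_pair_int oD Vu ui.
have i3 := integrableZ_real mD (- Om) (re_pair_int oD ui Lu).
have i23 := integrableD_real mD i2 i3.
have iSS := integrableD_real mD iS i23.
have iA := integrableZ_real mD (1 / 2) iSS.
have i3' := re_pair_int oD ui Lu; have i4' := u4.2.
have i4 := integrableZ_real mD (beta / 4) u4.2.
have -> : 1 / 2 * Aform D V Om u u + beta / 4 * q4 u =
  intg (fun x => 1 / 2 * (\sum_i F i x + (re_pair (Vm u) u x + (- Om) * re_pair u (Lz D u) x)) +
    beta / 4 * Normc.normc (u x) ^+ 4).
  rewrite RintegralD// (RintegralZl _ mD iSS) (RintegralD mD iS i23) (RintegralD mD i2 i3) eS.
  rewrite (RintegralZl _ mD i3') (RintegralZl _ mD i4').
  rewrite !re_pair_integral// mulNr addrA; congr (_ * (_ + _ - _) + _).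
  by apply: eq_bigr => i _; rewrite re_pair_integral.
apply: eq_Rintegral => x _.
have eg : reC (graddot D u u x) = \sum_i F i x.
  by rewrite /graddot (big_morph reC (@ReD R) (erefl _)).
move: eg; rewrite /re_pair.
move: (graddot D u u x) (\sum_i F i x) (Lz D u x) (u x) (V x) => G S l p v eg.
have := normc_sqr p; move: (Normc.normc p) => N e.
rewrite !cplxE/= eg.
move: (reC p) (imC p) (reC l) (imC l) e => a b c d e.
by rewrite e; field.
Qed.

(** The derivative of the energy has [Lz] on [u], whereas [Aform] has it on [h]; the symmetry of
    [Lz] reconciles them. *)
Lemma denergyE u h : H01 D u -> H01 D h -> L4 u -> L4 h ->
  denergy D V beta Om u h = Aform D V Om u h + beta * Xf u h.
Proof.
move=> u0 h0 u4 h4; have u1 := H01_H1 u0; have ui := H1_L2 u1.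
have h1 := H01_H1 h0; have hi := H1_L2 h1.
have Vu := L2_VM oD mV V0 VM ui; have Lu := Lz_L2 oD DL u1.
have wu i := weak_partial_L2 i u1; have wh i := weak_partial_L2 i h1.
pose F i := re_pair (wp i u) (wp i h).
have iF i : intD (F i) by exact: re_pair_int.
have [iS eS] := @Rintegral_sum _ _ _ mu (D : set mE) mD _ (index_enum 'I_n) F iF.
have i2 := re_pair_int oD Vu hi.
have i3' := re_pair_int oD Lu hi; have i3 := integrableZ_real mD (- Om) i3'.
have iX := sqintegrableM mD (L4_w2 u4) (sqi_re_pair u4 h4).
have i4 := integrableZ_real mD beta iX.
have i23 := integrableD_real mD i2 i3.
rewrite /denergy /Aform (Lz_sym oD DL u0 h0) -addrA -addrA; congr (_ + _).
  have -> : reC (cintegral D (graddot D u h)) = intg (fun x => \sum_i F i x).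
    apply: eq_Rintegral => x _.
    by rewrite /graddot (big_morph reC (@ReD R) (erefl _)).
  by rewrite eS; apply: eq_bigr => i _; rewrite re_pair_integral.
have -> : ip (Vm u) h + (- (Om * ip (Lz D u) h) + beta * Xf u h) =
  intg (fun x => re_pair (Vm u) h x + (- Om) * re_pair (Lz D u) h x + beta * (w2 u x * re_pair u h
    x)).
  rewrite RintegralD// RintegralD// !RintegralZl//.
  by rewrite !re_pair_integral// mulNr addrA.
apply: eq_Rintegral => x _.
rewrite /re_pair /w2.
move: (Lz D u x) (u x) (h x) (V x) => l p q v.
move: (Normc.normc p) => N; rewrite !cplxE/=.
move: (reC p) (imC p) (reC l) (imC l) (reC q) (imC q) => a b c d a' b'.
ring.
Qed.

End quartic.

(** * Completeness of H01 *)

Lemma sum_eventually_le (R : realFieldType) (n : nat) (F : 'I_n -> nat -> R) :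
  (forall i (e : R), 0 < e -> exists N, forall k, (N <= k)%N -> F i k <= e) ->
  forall e : R, 0 < e -> exists N, forall k, (N <= k)%N -> \sum_i F i k <= e.
Proof.
move=> h e e0; have n0 : 0 < n.+1%:R :> R by rewrite ltr0n.
have [|N HN] := @choice _ _ (fun i N => forall k, (N <= k)%N -> F i k <= e / n.+1%:R).
  by move=> i; apply: h; rewrite divr_gt0.
exists (\max_i N i)%N => k Nk.
apply: (@le_trans _ _ (\sum_(i < n) e / n.+1%:R)).
  by apply: ler_sum => i _; apply: HN; apply: leq_trans Nk; exact: leq_bigmax.
rewrite sumr_const card_ord -[_ *+ n]mulr_natr mulrAC ler_pdivrMr// ler_pM2l// ler_nat.
exact: leqnSn.
Qed.

Lemma add_two_le (R : realFieldType) (a b c d e g : R) :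
  a <= 2 * c + 2 * e -> b <= 2 * d + 2 * g -> a + b <= 2 * (c + d) + 2 * (e + g).
Proof. by lra. Qed.

Section completeness.
Context (R : realType) (m : nat).
Local Notation n := m.+2.
Local Notation E := 'rV[R]_n.
Local Notation mE := 'rV[measurableTypeR R]_n.
Local Notation mu := (lebesgue_rV R n).
Local Notation C := R[i].
Local Notation reC := (@complex.Re R).
Local Notation imC := (@complex.Im R).
Local Notation toC r := (r%:C%C : C).
Variables (D : set E) (L : R).
Hypothesis oD : open D.
Hypothesis L0 : 0 < L.
Hypothesis DL : D `<=` cbox (fun=> - L) (fun=> L).
Variables (V : E -> R) (MV : R).
Hypothesis mV : @measurable_fun _ _ mE R D V.
Hypothesis V0 : {ae mu, forall x, D x -> 0 <= V x}.
Hypothesis VM : {ae mu, forall x, D x -> V x <= MV}.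
Implicit Types (u v w g h f : E -> C).
Local Notation ip f g := (cip D f g).
Local Notation wp := (weak_partial D).
Local Notation gn u := (gnorm2 D u).
Local Notation sqi h := (sqintegrable mu (D : set mE) (h : mE -> R)).
Local Notation ripD f g := (rip mu (D : set mE) (f : mE -> R) (g : mE -> R)).

Let mD : @measurable _ mE D := open_measurable_dom oD.
Let finD : (mu (D : set mE) < +oo)%E := dom_fin oD DL.
Variables (Om K : R).
Hypothesis K0 : 0 < K.
Hypothesis trap : {ae mu, forall r, D r ->
  (1 + K) / 4 * Om ^+ 2 * (r 0 (ix m) ^+ 2 + r 0 (iy m) ^+ 2) <= V r}.
Local Notation lin t u v := (fun x => u x + toC t * v x).
Local Notation A := (Aform D V Om).

Lemma linN1E u v : (lin (-1) u v) = (fun x => u x - v x).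
Proof. by apply/funext => x; rewrite rmorphN1 mulN1r. Qed.

Lemma ip_le_gn i u : ip (wp i u) (wp i u) <= gn u.
Proof.
rewrite /gnorm2 (bigD1 i)//= lerDl; apply: sumr_ge0 => j _; exact: cip_ge0.
Qed.

(** Weak derivatives are closed in L2, since both sides of their defining identity are continuous.
    Testing with [phi] and with ['i] times [phi] treats real and imaginary parts by one argument. *)
Lemma weak_partial_limit i u g (f h : nat -> E -> C) : L2 D u -> L2 D g ->
  (forall k, L2 D (f k)) -> (forall k, L2 D (h k)) ->
  (forall k, is_weak_partial D i (f k) (h k)) ->
  (forall e : R, 0 < e -> exists N, forall k, (N <= k)%N ->
    ip (fun x => f k x - u x) (fun x => f k x - u x) <= e) ->
  (forall e : R, 0 < e -> exists N, forall k, (N <= k)%N ->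
    ip (fun x => h k x - g x) (fun x => h k x - g x) <= e) ->
  is_weak_partial D i u g.
Proof.
move=> ui gi fi hi wf fu hg; apply/is_weak_partialP => phi tp.
have sp := test_fun_sqintegrable oD DL tp.
have sdp := test_fun_sqintegrable oD DL (test_fun_partial i tp).
pose phiC (b : C) (psi : E -> R) : E -> C := fun x => b * toC (psi x).
have L2c b psi : sqi psi -> L2 D (phiC b psi).
  move=> spsi; apply: (L2Z mD); apply/(L2P mD); split => //=.
  by have /(L2P mD)[] := L2_0 mD.
have ip1 v psi : L2 D v -> sqi psi -> ip v (phiC 1 psi) = ripD (fun x => reC (v x)) psi.
  move=> vi si; rewrite (cipE mD vi (L2c _ _ si)); apply: eq_Rintegral => x _.
  by rewrite /phiC mul1r/= mulr0 addr0.
have ip2 v psi : L2 D v -> sqi psi -> ip v (phiC 'i%C psi) = ripD (fun x => imC (v x)) psi.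
  move=> vi si; rewrite (cipE mD vi (L2c _ _ si)); apply: eq_Rintegral => x _.
  by rewrite /phiC !cplxE/=; ring.
suff key b : (forall k, ip (f k) (phiC b (partial i phi)) = - ip (h k) (phiC b phi)) ->
    ip u (phiC b (partial i phi)) = - ip g (phiC b phi).
  split.
    rewrite -!ip1//; apply: key => k; rewrite !ip1//.
    by have /is_weak_partialP/(_ _ tp)[] := wf k.
  rewrite -!ip2//; apply: key => k; rewrite !ip2//.
  by have /is_weak_partialP/(_ _ tp)[] := wf k.
move=> hk'.
have dpi := L2c b _ sdp; have ppi := L2c b _ sp.
move: (phiC b (partial i phi)) (phiC b phi) dpi ppi hk' => P Q Pi Qi hk'.
apply/eqP; rewrite -addr_eq0 -sqrf_eq0 eq_le sqr_ge0 andbT.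
apply: (@le_of_eps _ _ _ (2 * (ip P P + ip Q Q))) => e e0 _; rewrite addr0.
have [N1 H1'] := fu e e0; have [N2 H2'] := hg e e0.
have h1 := H1' (maxn N1 N2) (leq_maxl _ _); have h2 := H2' (maxn N1 N2) (leq_maxr _ _).
move: (maxn N1 N2) h1 h2 => k h1 h2 {H1' H2'}.
have c1 := cip_CS mD (L2B mD (fi k) ui) Pi; have c2 := cip_CS mD (L2B mD (hi k) gi) Qi.
have P0 := cip_ge0 D P; have Q0 := cip_ge0 D Q.
have {}c1 := le_trans c1 (ler_wpM2r P0 h1); have {}c2 := le_trans c2 (ler_wpM2r Q0 h2).
rewrite (cipBl mD (fi k) ui Pi) hk' in c1; rewrite (cipBl mD (hi k) gi Qi) in c2.
move: (ip u P) (ip g Q) (ip (h k) Q) (ip P P) (ip Q Q) c1 c2 => a b' c p q c1 c2 {h1 h2 P0 Q0}.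
have := sqr_ge0 ((- c - a) - (c - b')); nra.
Qed.

Lemma test_dist_near u v f : H1 D u -> H1 D v -> ctest_fun D f ->
  test_dist D v f <= 2 * (ip (lin (-1) u v) (lin (-1) u v) + gn (lin (-1) u v)) +
    2 * test_dist D u f.
Proof.
move=> u1 v1 tf; have ui := H1_L2 u1; have vi := H1_L2 v1.
have uv1 := H1_lin oD DL (toC (-1)) u1 v1.
have fi := ctest_L2 oD DL tf.
have key p q r : L2 D p -> L2 D q -> L2 D r ->
    ip (fun x => q x - r x) (fun x => q x - r x) <=
    2 * ip (lin (-1) p q) (lin (-1) p q) + 2 * ip (fun x => p x - r x) (fun x => p x - r x).
  move=> pi qi ri.
  have := cip_sqrD_le mD (-1) (L2B mD pi ri) (L2B mD pi qi).
  rewrite !linN1E sqrrN expr1n mulr1 addrC.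
  have -> // : (fun x => p x - r x - (p x - q x)) = (fun x => q x - r x).
  by apply/funext => x; rewrite opprB addrC addrA subrK.
have h1 := key _ _ _ ui vi fi.
have h2 : \sum_i ip (fun x => wp i v x - cpartial i f x) (fun x => wp i v x - cpartial i f x) <=
    2 * gn (lin (-1) u v) +
    2 * \sum_i ip (fun x => wp i u x - cpartial i f x) (fun x => wp i u x - cpartial i f x).
  rewrite /gnorm2 !mulr_sumr -big_split; apply: ler_sum => i _ /=.
  have wu := weak_partial_L2 i u1; have wv := weak_partial_L2 i v1.
  have df := ctest_partial_L2 oD DL i tf.
  apply: le_trans (key _ _ _ wu wv df) _.
  have wuv := weak_partial_L2 i uv1; have wl := L2_lin mD (toC (-1)) wu wv.
  have ae := weak_partial_lin oD DL (toC (-1)) i u1 v1.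
  by rewrite (eq_cip_ae2 mD wuv wl wuv wl ae ae).
exact: (add_two_le h1 h2).
Qed.

(** Coercivity makes the gradients Cauchy and the Poincaré inequality does so for the functions. The
    L2 limits of the derivatives are the weak derivatives of the limit, and boundedness of the form
    turns H1 convergence back into convergence for [A]. *)
Lemma H01_complete (f : nat -> E -> C) : (forall k, H01 D (f k)) ->
  (forall e : R, 0 < e -> exists N, forall j k, (N <= j)%N -> (N <= k)%N ->
    A (lin (-1) (f j) (f k)) (lin (-1) (f j) (f k)) <= e) ->
  exists2 g, H01 D g & forall e : R, 0 < e -> exists N, forall k, (N <= k)%N ->
    A (lin (-1) (f k) g) (lin (-1) (f k) g) <= e.
Proof.
move=> f0 cf.
have f1 k := H01_H1 (f0 k); have fi k := H1_L2 (f1 k).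
pose c := K / (1 + K); have c0 : 0 < c by rewrite divr_gt0// addr_gt0.
have cgn (e : R) : 0 < e -> exists N, forall j k, (N <= j)%N -> (N <= k)%N ->
    gn (lin (-1) (f j) (f k)) <= e.
  move=> e0; have [|N HN] := cf (c * e); first exact: mulr_gt0.
  exists N => j k Nj Nk; rewrite -(ler_pM2l c0); apply: le_trans (HN j k Nj Nk).
  exact: (Aform_coercive oD DL mV V0 VM K0 trap (H1_lin oD DL _ (f1 j) (f1 k))).
have [|g gi fg] := cip_complete mD finD fi.
  have PL : 0 < 64 * L ^+ 2 by rewrite mulr_gt0// exprn_gt0.
  move=> e e0; have [|N HN] := cgn (e / (64 * L ^+ 2)); first exact: divr_gt0.
  exists N => j k Nj Nk; rewrite -linN1E.
  apply: le_trans (poincare oD L0 DL (H01_lin oD DL _ (f0 j) (f0 k))) _.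
  by rewrite mulrC -ler_pdivlMr//; exact: HN.
have wi i k := weak_partial_L2 i (f1 k).
have /choice[G HG] : forall i, exists G, L2 D G /\ forall e : R, 0 < e ->
    exists N, forall k, (N <= k)%N ->
    ip (fun x => wp i (f k) x - G x) (fun x => wp i (f k) x - G x) <= e.
  move=> i; have [|G Gi HG] := cip_complete mD finD (wi i); last by exists G.
  move=> e /cgn[N HN]; exists N => j k Nj Nk; apply: le_trans (HN j k Nj Nk).
  apply: le_trans (ip_le_gn i _); rewrite -linN1E.
  have wuv := weak_partial_L2 i (H1_lin oD DL (toC (-1)) (f1 j) (f1 k)).
  have wl := L2_lin mD (toC (-1)) (wi i j) (wi i k).
  have ae := weak_partial_lin oD DL (toC (-1)) i (f1 j) (f1 k).
  by rewrite (eq_cip_ae2 mD wuv wl wuv wl ae ae).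
have wg i : is_weak_partial D i g (G i).
  apply: (weak_partial_limit gi (HG i).1 fi (wi i) _ fg (HG i).2) => k.
  by have [] := H1_weak_partial i (f1 k).
have g1 : H1 D g by split => // i; exists (G i); split; [exact: (HG i).1|exact: wg].
have fgn : forall e : R, 0 < e -> exists N, forall k, (N <= k)%N -> gn (lin (-1) (f k) g) <= e.
  apply: sum_eventually_le => i e e0; have [N HN] := (HG i).2 e e0; exists N => k Nk.
  have wuv := weak_partial_L2 i (H1_lin oD DL (toC (-1)) (f1 k) g1).
  have wl := L2B mD (wi i k) (HG i).1.
  have ae : {ae mu, forall x, D x -> wp i (lin (-1) (f k) g) x = wp i (f k) x - G i x}.
    apply: (aeS2 _ (weak_partial_lin oD DL (toC (-1)) i (f1 k) g1)
      (weak_partial_ae oD DL gi (HG i).1 (wg i))) => x e1 e2 Dx.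
    by rewrite (e1 Dx) (e2 Dx) rmorphN1 mulN1r.
  by rewrite (eq_cip_ae2 mD wuv wl wuv wl ae ae); exact: HN.
have g0 : H01 D g.
  apply/(H01P oD DL); split => // e e0.
  (* Three errors, each at most [e / 8] and each doubled, stay below [e]. *)
  have e8 : 0 < e / 8 by rewrite divr_gt0.
  have [N1 H1'] := fg _ e8; have [N2 H2'] := fgn _ e8.
  have h1 := H1' (maxn N1 N2) (leq_maxl _ _); have h2 := H2' (maxn N1 N2) (leq_maxr _ _).
  move: (maxn N1 N2) h1 h2 => k h1 h2.
  have /(H01P oD DL)[_ /(_ _ e8)[phi tp hp]] := f0 k.
  exists phi => //; apply: le_lt_trans (test_dist_near (f1 k) g1 tp) _.
  rewrite -linN1E in h1; move: h1 h2 hp.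
  move: (ip _ _) (gn _) (test_dist D (f k) phi) => p q r; lra.
exists g => //; set B := 2 + 2 * `|MV| * (64 * L ^+ 2).
have B0 : 0 < B.
  by rewrite /B; apply: ltr_pwDl => //; apply: mulr_ge0; apply: mulr_ge0 => //; exact: sqr_ge0.
move=> e e0; have [|N HN] := fgn (e / B); first exact: divr_gt0.
exists N => k Nk.
apply: le_trans (Aform_bounded oD L0 DL mV V0 VM K0 trap (H01_lin oD DL _ (f0 k) g0)) _.
by rewrite -/B mulrC -ler_pdivlMr//; exact: HN.
Qed.

End completeness.

(** * Descent along the projected gradient *)

(** The first-order terms add up to [- a * app]. In the second-order coefficient, 1/2 comes from the
    quadratic part of the energy, and 8 and 3 from [quartic_expand]. *)
Lemma descent_arith (R : realFieldType) (a b app auu aup x qu qw qp y Aw k1 k2 : R) :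
  0 <= a -> 0 < b -> 0 <= app -> aup + b * x = app ->
  Aw = auu + 2 * aup * (- a) + app * (- a) ^+ 2 ->
  qw <= qu - 4 * a * x + a ^+ 2 * (8 * y + 3 * qp) ->
  y <= k1 * app -> qp <= k2 * app ->
  a * (1 / 2 + b / 4 * (8 * k1 + 3 * k2)) <= 1 / 2 ->
  a / 2 * app <= 1 / 2 * auu + b / 4 * qu - (1 / 2 * Aw + b / 4 * qw).
Proof.
move=> a0 b0 p0 pp -> hq hy hp ha.
have b4 : 0 <= b / 4 by rewrite divr_ge0// ltW.
have h1 := ler_wpM2l b4 hq.
have a2 : 0 <= a ^+ 2 := sqr_ge0 a.
have h2 : 8 * y + 3 * qp <= (8 * k1 + 3 * k2) * app by lra.
have h3 := ler_wpM2l b4 (ler_wpM2l a2 h2).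
have h4 := ler_wpM2l a0 (ler_wpM2r p0 ha).
rewrite -pp in h4 h3 *; nra.
Qed.

Lemma ler_sqr_mono (R : realFieldType) (a b : R) : 0 <= a -> a <= b -> a ^+ 2 <= b ^+ 2.
Proof. by move=> a0 ab; rewrite ler_pXn2r ?nnegrE// (le_trans a0). Qed.

Lemma le_of_sqr_le (R : realFieldType) (a b : R) : 0 <= b -> a ^+ 2 <= b ^+ 2 -> a <= b.
Proof. by move=> b0; case: (leP a b) => // ba; rewrite leNgt ltr_pXn2r ?nnegrE ?ba// ltW//
  (le_lt_trans b0 ba). Qed.

Section descent.
Context (R : realType) (m : nat).
Local Notation n := m.+2.
Local Notation E := 'rV[R]_n.
Local Notation mE := 'rV[measurableTypeR R]_n.
Local Notation mu := (lebesgue_rV R n).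
Local Notation C := R[i].
Local Notation reC := (@complex.Re R).
Local Notation imC := (@complex.Im R).
Local Notation toC r := (r%:C%C : C).
Variables (D : set E) (L : R).
Hypothesis oD : open D.
Hypothesis L0 : 0 < L.
Hypothesis DL : D `<=` cbox (fun=> - L) (fun=> L).
Hypothesis hk : n = 2%N \/ n = 3%N.
Variables (V : E -> R) (MV : R).
Hypothesis mV : @measurable_fun _ _ mE R D V.
Hypothesis V0 : {ae mu, forall x, D x -> 0 <= V x}.
Hypothesis VM : {ae mu, forall x, D x -> V x <= MV}.
Implicit Types (u v w g h f : E -> C).
Local Notation ip f g := (cip D f g).
Local Notation gn u := (gnorm2 D u).

Let mD : @measurable _ mE D := open_measurable_dom oD.
Variables (Om K beta : R).
Hypothesis K0 : 0 < K.
Hypothesis trap : {ae mu, forall r, D r ->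
  (1 + K) / 4 * Om ^+ 2 * (r 0 (ix m) ^+ 2 + r 0 (iy m) ^+ 2) <= V r}.
Hypothesis beta0 : 0 < beta.
Local Notation lin t u v := (fun x => u x + toC t * v x).
Local Notation A := (Aform D V Om).
Local Notation q4 := (q4 D).
Local Notation X := (Xf D).
Local Notation Y := (Yf D).

Let Asym u v : H01 D u -> H01 D v -> A u v = A v u.
Proof. exact: (Aform_sym oD DL). Qed.

Let Al t u v w : H01 D u -> H01 D v -> H01 D w -> A (lin t u v) w = A u w + t * A v w.
Proof.
move=> u0 v0 w0.
exact: (Aform_linl oD DL mV V0 VM Om t (H01_H1 u0) (H01_H1 v0) (H01_H1 w0)).
Qed.

Let A0 u : H01 D u -> 0 <= A u u.
Proof. by move=> u0; exact: (Aform_ge0 oD DL mV V0 VM K0 trap (H01_H1 u0)). Qed.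

Let Hlin t u v : H01 D u -> H01 D v -> H01 D (lin t u v).
Proof. by move=> u0 v0; exact: (H01_lin oD DL). Qed.

Let ACS u v : H01 D u -> H01 D v -> A u v ^+ 2 <= A u u * A v v.
Proof. exact: (@form_CS R (E -> C) (fun t u v => lin t u v) (H01 D) A Hlin Asym Al A0). Qed.

Let L4H u : H01 D u -> L4 D u.
Proof. by move=> /(H01_L4 oD DL hk)[]. Qed.

Definition Pconst : R := 64 * L ^+ 2 * ((1 + K) / K).
(** Chosen so that [q4 u <= (Qconst * A u u) ^+ 2]: 4 is the square root of the 16 in [H01_L4], the
    next factor adds the Poincaré constant and 1, and the last inverts coercivity. *)
Definition Qconst : R := 4 * ((64 * L ^+ 2 + 1) * ((1 + K) / K)).

Lemma gn_le_A u : H01 D u -> gn u <= (1 + K) / K * A u u.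
Proof.
move=> u0; have c := Aform_coercive oD DL mV V0 VM K0 trap (H01_H1 u0).
have s0 : 0 < 1 + K by exact: addr_gt0.
have k0 : 0 <= (1 + K) / K by rewrite divr_ge0// ltW.
have := ler_wpM2l k0 c; rewrite mulrA.
suff -> : (1 + K) / K * (K / (1 + K)) = 1 by rewrite mul1r.
by field; rewrite !gt_eqF.
Qed.

Lemma ip_le_A u : H01 D u -> ip u u <= Pconst * A u u.
Proof.
move=> u0; apply: le_trans (poincare oD L0 DL u0) _; rewrite /Pconst -[X in _ <= X]mulrA.
by rewrite ler_wpM2l ?(gn_le_A u0)// mulr_ge0// sqr_ge0.
Qed.

Lemma q4_le_A u : H01 D u -> q4 u <= (Qconst * A u u) ^+ 2.
Proof.
move=> u0; have [_ h] := H01_L4 oD DL hk u0; apply: le_trans h _.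
have -> : 16 * (ip u u + gn u) ^+ 2 = (4 * (ip u u + gn u)) ^+ 2 by rewrite exprMn; congr (_ * _);
  ring.
have g0 := gnorm2_ge0 D u; have i0 := cip_ge0 D u.
have h1 : ip u u + gn u <= (64 * L ^+ 2 + 1) * gn u.
  by rewrite mulrDl mul1r lerD2r; exact: (poincare oD L0 DL u0).
have l0 : 0 <= 64 * L ^+ 2 + 1 by rewrite addr_ge0// mulr_ge0// sqr_ge0.
have h2 := le_trans h1 (ler_wpM2l l0 (gn_le_A u0)).
have s0 : 0 <= ip u u + gn u by rewrite addr_ge0.
have h3 : 4 * (ip u u + gn u) <= Qconst * A u u.
  by rewrite /Qconst -!mulrA ler_pM2l//; rewrite -!mulrA in h2.
apply: ler_sqr_mono h3; exact: mulr_ge0.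
Qed.

Lemma Qconst_ge0 : 0 <= Qconst.
Proof.
by rewrite /Qconst !mulr_ge0 ?addr_ge0 ?mulr_ge0 ?sqr_ge0 ?invr_ge0 ?ltW.
Qed.

Lemma Yf_le_A u h : H01 D u -> H01 D h -> Y u h <= Qconst ^+ 2 * (A u u * A h h).
Proof.
move=> u0 h0; have := Yf_CS oD (L4H u0) (L4H h0).
have y0 := Yf_ge0 D u h; have q1 := q4_le_A u0; have q2 := q4_le_A h0.
have a1 := A0 u0; have a2 := A0 h0; have Q0 := Qconst_ge0.
have p1 := q4_ge0 D u; have p2 := q4_ge0 D h.
move=> hy; have : Y u h ^+ 2 <= (Qconst ^+ 2 * (A u u * A h h)) ^+ 2.
  apply: le_trans hy _; apply: le_trans (ler_pM p1 p2 q1 q2) _.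
  by move: Qconst (A u u) (A h h) => q a b; rewrite -exprMn [X in _ <= X](_ : _ = (q * a * (q * b))
    ^+ 2)//; ring.
by apply: le_of_sqr_le; apply: mulr_ge0 (sqr_ge0 _) (mulr_ge0 a1 a2).
Qed.

Lemma Xf_sqr_le_A u h : H01 D u -> H01 D h ->
  X u h ^+ 2 <= Qconst ^+ 4 * A u u ^+ 3 * A h h.
Proof.
move=> u0 h0; apply: le_trans (Xf_CS oD (L4H u0) (L4H h0)) _.
apply: le_trans (ler_pM (q4_ge0 D u) (Yf_ge0 D u h) (q4_le_A u0) (Yf_le_A u0 h0)) _.
by move: Qconst (A u u) (A h h) => q a b; rewrite [X in _ <= X](_ : _ = (q * a) ^+ 2 * (q ^+ 2 * (a
  * b)))//; ring.
Qed.

Lemma riesz_H01 (l : (E -> C) -> R) (M : R) :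
  (forall t u v, H01 D u -> H01 D v -> l (lin t u v) = l u + t * l v) ->
  (forall u, H01 D u -> l u ^+ 2 <= M * A u u) -> forall w, H01 D w ->
  exists2 g, H01 D g & forall h, H01 D h -> A g h = l h.
Proof.
move=> ll lM w w0.
apply: (@riesz R (E -> C) (fun t u v => lin t u v) (H01 D) A l M _ Hlin Asym Al A0 ll lM).
  by exists w.
exact: (H01_complete oD L0 DL mV V0 VM K0 trap).
Qed.

(** Riesz representation of the derivative of the energy makes the choice in [sobolev_grad]
    meaningful. Boundedness of the functional comes from Cauchy-Schwarz for [A] and the quartic
    bound on [X]. *)
Lemma sobolev_gradP u : H01 D u ->
  H01 D (sobolev_grad D V beta Om u) /\
  forall h, H01 D h -> A (sobolev_grad D V beta Om u) h = A u h + beta * X u h.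
Proof.
move=> u0.
have [||g g0 Hg] := @riesz_H01 (fun h => A u h + beta * X u h)
    (2 * A u u + 2 * beta ^+ 2 * (Qconst ^+ 4 * A u u ^+ 3)) _ _ u u0.
- move=> t h k h0 k0; rewrite (Xf_lin oD t (L4H u0) (L4H h0) (L4H k0)).
  rewrite (Asym u0 (Hlin t h0 k0)) Al// (Asym h0 u0) (Asym k0 u0).
  move: (A u h) (A u k) (X u h) (X u k) => a b c d; ring.
- move=> h h0; have c1 := ACS u0 h0; have c2 := Xf_sqr_le_A u0 h0; have a0 := A0 h0.
  move: c1 c2 a0; move: (A u h) (X u h) (A u u) (A h h) (Qconst ^+ 4) => a x p q c c1 c2 a0.
  have b0 := sqr_ge0 beta; have c3 := ler_wpM2l b0 c2.
  have := sqr_ge0 (a - beta * x); rewrite -subr_ge0 => c4; nra.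
have P : [set g | H01 D g /\ forall h, H01 D h -> reC (a0ip D V Om g h) = denergy D V beta Om u h]
    (sobolev_grad D V beta Om u).
  apply: xgetPex; exists g; split => // h h0.
  rewrite (Re_a0ip oD DL mV V0 VM Om (H01_H1 g0) (H01_H1 h0)) Hg//.
  by rewrite (denergyE oD DL mV V0 VM beta Om u0 h0 (L4H u0) (L4H h0)).
have [s0 Hs] := P; split => // h h0.
rewrite -(Re_a0ip oD DL mV V0 VM Om (H01_H1 s0) (H01_H1 h0)) Hs//.
by rewrite (denergyE oD DL mV V0 VM beta Om u0 h0 (L4H u0) (L4H h0)).
Qed.

(** The Riesz theorem provides only the real part of the complex identity that defines [a0_green];
    the imaginary part is the real identity tested with [- 'i%C * h]. *)
Lemma a0_greenP u : H01 D u ->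
  H01 D (a0_green D V Om u) /\ forall h, H01 D h -> A (a0_green D V Om u) h = ip u h.
Proof.
move=> u0; have ui := H1_L2 (H01_H1 u0).
have [||g g0 Hg] := @riesz_H01 (fun h => ip u h) (ip u u * Pconst) _ _ u u0.
- move=> t h k h0 k0.
  exact: (cip_linr mD t (H1_L2 (H01_H1 h0)) (H1_L2 (H01_H1 k0)) ui).
- move=> h h0; apply: le_trans (cip_CS mD ui (H1_L2 (H01_H1 h0))) _.
  by rewrite -mulrA ler_wpM2l ?cip_ge0//; exact: ip_le_A.
have P : [set g | H01 D g /\ forall h, H01 D h -> a0ip D V Om g h = L2ip D u h]
    (a0_green D V Om u).
  apply: xgetPex; exists g; split => // h h0; have hi := H1_L2 (H01_H1 h0).
  apply: complex_eqP.
    by rewrite (Re_a0ip oD DL mV V0 VM Om (H01_H1 g0) (H01_H1 h0)) Hg// (Re_L2ip mD ui hi).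
  rewrite (Im_a0ip oD DL mV V0 VM Om (H01_H1 g0) (H01_H1 h0)) Hg; last exact: (H01Z oD DL).
  by rewrite (Im_L2ip mD ui hi).
have [s0 Hs] := P; split => // h h0.
by rewrite -(Re_a0ip oD DL mV V0 VM Om (H01_H1 s0) (H01_H1 h0)) Hs// (Re_L2ip mD ui (H1_L2 (H01_H1
  h0))).
Qed.

Lemma a0norm_sqr u : H01 D u -> a0norm D V Om u ^+ 2 = A u u.
Proof.
move=> u0; rewrite /a0norm (Re_a0ip oD DL mV V0 VM Om (H01_H1 u0) (H01_H1 u0)).
by rewrite sqr_sqrtr// A0.
Qed.

Lemma a0norm_ge0 u : 0 <= a0norm D V Om u. Proof. exact: sqrtr_ge0. Qed.

Lemma a0norm_le u (c : R) : H01 D u -> 0 <= c -> A u u <= c ^+ 2 -> a0norm D V Om u <= c.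
Proof.
move=> u0 c0 h; rewrite -(@ler_pXn2r _ 2)// ?nnegrE ?a0norm_ge0//.
by rewrite a0norm_sqr.
Qed.

(** Pairing with the Green function is the L2 product with [u], so removing its component makes [p]
    tangent. Then [A s p = A p p] for the Sobolev gradient [s], and Cauchy-Schwarz shows that
    projection does not increase the norm. *)
Lemma riemannian_gradP u : H01 D u -> ip u u = 1 ->
  [/\ H01 D (riemannian_grad D V beta Om u), ip u (riemannian_grad D V beta Om u) = 0,
      A (riemannian_grad D V beta Om u) (riemannian_grad D V beta Om u) <=
        A (sobolev_grad D V beta Om u) (sobolev_grad D V beta Om u) &
      A u (riemannian_grad D V beta Om u) + beta * X u (riemannian_grad D V beta Om u) =
        A (riemannian_grad D V beta Om u) (riemannian_grad D V beta Om u)].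
Proof.
move=> u0 u1; have [s0 Hs] := sobolev_gradP u0; have [g0 Hg] := a0_greenP u0.
set s := sobolev_grad D V beta Om u in s0 Hs *; set g := a0_green D V Om u in g0 Hg *.
pose la := A s g / A g g.
have pE : riemannian_grad D V beta Om u = lin (- la) s g.
  apply/funext => x; rewrite /riemannian_grad /tangent_proj -/g -/s.
  rewrite (a0norm_sqr g0) (Re_a0ip oD DL mV V0 VM Om (H01_H1 s0) (H01_H1 g0)) -/la.
  by rewrite rmorphN mulNr.
rewrite pE; have p0 := Hlin (- la) s0 g0.
(* Otherwise Cauchy-Schwarz would force [A g u = ip u u = 1] to vanish. *)
have gg : A g g != 0.
  apply/eqP => g00; have := ACS g0 u0; rewrite (Hg _ u0) u1 g00 mul0r expr1n.
  by rewrite ler10.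
have up : ip u (lin (- la) s g) = 0.
  rewrite -(Hg _ p0) (Asym g0 p0) Al// mulNr /la divfK//.
  by rewrite subrr.
have sp : A s (lin (- la) s g) = A (lin (- la) s g) (lin (- la) s g).
  by rewrite [RHS]Al// (Hg _ p0) up mulr0 addr0.
split; [exact: p0|exact: up| |by rewrite -(Hs _ p0)].
have := ACS s0 p0; rewrite sp; have a1 := A0 p0; have a2 := A0 s0.
move: (A (lin (- la) s g) _) (A s s) a1 a2 => a b a1 a2; rewrite expr2.
move: a1; rewrite le_eqVlt => /predU1P[<-//|a1]; by rewrite ler_pM2r.
Qed.

(** The energy is a sum of nonnegative terms homogeneous of degrees 2 and 4. *)
Lemma energy_lin_scale u (c : R) : H01 D u -> 0 <= c -> c <= 1 ->
  energy D V beta Om (fun x => toC c * u x) <= energy D V beta Om u.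
Proof.
move=> u0 c0 c1; have cu0 := H01Z oD DL (toC c) u0.
have cE : (fun x => toC c * u x) = lin (c - 1) u u.
  by apply/funext => x; rewrite rmorphB rmorph1 mulrBl mul1r addrC subrK.
rewrite (energyE oD DL mV V0 VM beta Om u0 (L4H u0)) (energyE oD DL mV V0 VM beta Om cu0 (L4H cu0)).
have e1 : A (fun x => toC c * u x) (fun x => toC c * u x) = c ^+ 2 * A u u.
  have key h : H01 D h -> A (fun x => toC c * u x) h = c * A u h.
    by move=> h0; rewrite cE (Al (c - 1) u0 u0 h0); move: (A u h) => z; ring.
  by rewrite (key _ cu0) (Asym u0 cu0) (key _ u0) mulrA -expr2.
have e2 : q4 (fun x => toC c * u x) = c ^+ 4 * q4 u.
  rewrite /q4 -RintegralZl//; last exact: (L4H u0).2.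
  apply: eq_Rintegral => x _; rewrite -[4%N]/(2 * 2)%N !exprM !normc_sqr !cplxE/=.
  by move: (reC (u x)) (imC (u x)) => a b; ring.
rewrite e1 e2; have a0 := A0 u0; have q0 := q4_ge0 D u.
apply: lerD; rewrite ler_wpM2l//.
- by rewrite ler_piMl// expr_le1.
- by rewrite divr_ge0// ltW.
- by rewrite ler_piMl// expr_le1.
Qed.

Lemma descent_step (Cu Cg a : R) u : H01 D u -> ip u u = 1 -> 0 <= a -> a <= 1 ->
  A u u <= Cu -> A (sobolev_grad D V beta Om u) (sobolev_grad D V beta Om u) <= Cg ->
  a * (1 / 2 + beta / 4 * (8 * (Qconst ^+ 2 * Cu) + 3 * (Qconst ^+ 2 * Cg))) <= 1 / 2 ->
  let p := riemannian_grad D V beta Om u in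
  let v := a0_step D V beta Om a u in
  [/\ H01 D v, ip v v = 1 &
    a / 2 * A p p <= energy D V beta Om u - energy D V beta Om v].
Proof.
move=> u0 u1 a0 a1 uC gC aC /=.
have [p0 up pg pp] := riemannian_gradP u0 u1.
rewrite /a0_step; set p := riemannian_grad D V beta Om u in p0 up pg pp *.
have -> : (fun r => u r - toC a * p r) = lin (- a) u p.
  by apply/funext => x; rewrite rmorphN mulNr.
set w := lin (- a) u p.
have w0 : H01 D w by exact: Hlin.
have ui := H1_L2 (H01_H1 u0); have pi := H1_L2 (H01_H1 p0); have wi := H1_L2 (H01_H1 w0).
have ww : ip w w = 1 + a ^+ 2 * ip p p.
  by rewrite (cip_sqrD mD (- a) ui pi) u1 up; move: (ip p p) => z; ring.
have w1 : 1 <= ip w w by rewrite ww lerDl mulr_ge0 ?sqr_ge0// cip_ge0.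
set c := (L2norm D w)^-1.
have cc : c ^+ 2 * ip w w = 1.
  by rewrite exprVn (L2norm_sqr mD wi) mulVf// gt_eqF// (lt_le_trans ltr01 w1).
have c0 : 0 <= c by rewrite invr_ge0 sqrtr_ge0.
have c1 : c <= 1.
  have : c ^+ 2 <= 1.
    by rewrite -cc ler_peMr// sqr_ge0.
  by rewrite expr_le1.
have v0 : H01 D (retraction D w) by exact: (H01Z oD DL).
split => //.
  rewrite (cipZZ mD (toC c) wi) -cc; congr (_ * _).
  by rewrite normc_sqr/= expr0n addr0.
have := energy_lin_scale w0 c0 c1; rewrite -/(retraction D w).
set ev := energy D V beta Om (retraction D w) => hv.
have := (energyE oD DL mV V0 VM beta Om w0 (L4H w0)) => ew.
have := (energyE oD DL mV V0 VM beta Om u0 (L4H u0)) => eu.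
have Aw : A w w = A u u + 2 * A u p * (- a) + A p p * (- a) ^+ 2.
  exact: (@form_sqrD R (E -> C) (fun t u v => lin t u v) (H01 D) A Hlin Asym Al (- a) u p u0 p0).
have qw := quartic_expand oD a0 a1 (L4H u0) (L4H p0) (L4H w0).
(* The bound on [q4 p] is quadratic in [A p p]; spending one factor on the bound [Cg] leaves it
   linear, like the other terms. *)
have y := Yf_le_A u0 p0; have q := Yf_le_A p0 p0; rewrite -q4E in q.
have Ap := A0 p0; have pC := le_trans pg gC; have Q2 := sqr_ge0 Qconst.
have y1 : Y u p <= (Qconst ^+ 2 * Cu) * A p p.
  by apply: le_trans y _; rewrite mulrA ler_wpM2r// ler_wpM2l.
have q1 : q4 p <= (Qconst ^+ 2 * Cg) * A p p.
  by apply: le_trans q _; rewrite mulrA ler_wpM2r// ler_wpM2l.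
have key := descent_arith a0 beta0 Ap pp Aw qw y1 q1 aC.
rewrite ew in hv; rewrite eu.
exact: le_trans key (lerB (lexx _) hv).
Qed.

(** Testing the gradient against itself bounds the square of [A s s] by a multiple of [A s s];
    dividing needs the degenerate case apart. *)
Lemma sobolev_grad_le u : H01 D u ->
  A (sobolev_grad D V beta Om u) (sobolev_grad D V beta Om u) <=
  2 * A u u + 2 * beta ^+ 2 * (Qconst ^+ 4 * A u u ^+ 3).
Proof.
move=> u0; have [s0 /(_ _ s0)] := sobolev_gradP u0.
move: (sobolev_grad D V beta Om u) s0 => s s0 ss.
have c1 := ACS u0 s0; have c2 := Xf_sqr_le_A u0 s0; have as0 := A0 s0; have a0 := A0 u0.
move: (A u s) (X u s) (A s s) (A u u) Qconst Qconst_ge0 ss c1 c2 as0 a0.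
move=> a x p q c c0 ss c1 c2 p0 q0; have c3 := ler_wpM2l (sqr_ge0 beta) c2.
have [->|pn] := eqVneq p 0.
  apply: addr_ge0; first exact: mulr_ge0.
  apply: mulr_ge0 (mulr_ge0 _ (sqr_ge0 _)) _ => //.
  by apply: mulr_ge0; exact: exprn_ge0.
have pp : 0 < p by rewrite lt_neqAle eq_sym pn.
rewrite -(ler_pM2r pp) -expr2 {1}ss.
have c4 := sqr_ge0 (a - beta * x); nra.
Qed.

Lemma Aform_le_energy u : H01 D u -> A u u <= 2 * energy D V beta Om u.
Proof.
move=> u0; rewrite (energyE oD DL mV V0 VM beta Om u0 (L4H u0)).
have := mulr_ge0 (ltW beta0) (q4_ge0 D u).
move: (A u u) (q4 u) => a q h; lra.
Qed.

Lemma energy_le u (b : R) : H01 D u -> A u u <= b ->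
  energy D V beta Om u <= 1 / 2 * b + beta / 4 * (Qconst * b) ^+ 2.
Proof.
move=> u0 ub; rewrite (energyE oD DL mV V0 VM beta Om u0 (L4H u0)).
have b4 : 0 <= beta / 4 by rewrite divr_ge0// ltW.
have h : (Qconst * A u u) ^+ 2 <= (Qconst * b) ^+ 2.
  apply: ler_sqr_mono; first exact: mulr_ge0 Qconst_ge0 (A0 u0).
  exact: ler_wpM2l Qconst_ge0 _ _ ub.
have h' := ler_wpM2l b4 (le_trans (q4_le_A u0) h).
by apply: lerD h'; rewrite ler_pM2l.
Qed.

End descent.

(** * Constants and induction along the iteration *)

Theorem theorem3p2 (R : realType) (n : nat) (hd : n.+2 = 2%N \/ n.+2 = 3%N)
  (D : set 'rV[R]_n.+2) (hD : bounded_domain D)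
  (V : 'rV[R]_n.+2 -> R) (hV : nonneg_Linfty D V)
  (beta : R) (hbeta : 0 < beta) (Om : R) (hOm : 0 <= Om)
  (htrap : trap_condition D V Om) (rho : R) :
  exists Cu Cg Calpha : R,
    [/\ 0 < Cu, 0 < Cg, 0 < Calpha, Calpha <= 1 &
      forall u0 : 'rV[R]_n.+2 -> R[i],
        manifold D u0 -> gradnorm D u0 = rho ->
      forall (alpha : nat -> R) (alpha_min alpha_max : R),
        0 < alpha_min ->
        (forall k, alpha_min <= alpha k <= alpha_max) ->
        alpha_max <= Calpha ->
      forall u : nat -> 'rV[R]_n.+2 -> R[i],
        u 0%N = u0 ->
        (forall k, u k.+1 = a0_step D V beta Om (alpha k) (u k)) ->
      forall k,
        [/\ a0norm D V Om (u k) <= Cu,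
            a0norm D V Om (riemannian_grad D V beta Om (u k))
              <= a0norm D V Om (sobolev_grad D V beta Om (u k)),
            a0norm D V Om (sobolev_grad D V beta Om (u k)) <= Cg &
            alpha_min / 2 *
              a0norm D V Om (riemannian_grad D V beta Om (u k)) ^+ 2
              <= energy D V beta Om (u k) - energy D V beta Om (u k.+1)]].
Proof.
have [oD _ _ /bounded_set_cbox[L L0 DL]] := hD.
have [mV V0 [MV VM]] := hV; have [K [K0 trap]] := htrap.
have mD : @measurable _ 'rV[measurableTypeR R]_n.+2 D := open_measurable_dom oD.
pose Q := Qconst L K; have Q0 : 0 <= Q := Qconst_ge0 L0 K0.
(* [B] bounds the form at the initial function, [E0] its energy; [a] and [g] then bound the form and
   the squared gradient norm at any function of energy at most [E0]. *)
pose B := (2 + 2 * `|MV| * (64 * L ^+ 2)) * rho ^+ 2.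
pose E0 := 1 / 2 * B + beta / 4 * (Q * B) ^+ 2.
pose a := 2 * E0; pose g := 2 * a + 2 * beta ^+ 2 * (Q ^+ 4 * a ^+ 3).
pose M := 1 / 2 + beta / 4 * (8 * (Q ^+ 2 * a) + 3 * (Q ^+ 2 * g)).
have b4 : 0 <= beta / 4 by rewrite divr_ge0// ltW.
have B0 : 0 <= B.
  apply: mulr_ge0 (sqr_ge0 _); apply: addr_ge0 => //.
  by apply: mulr_ge0; apply: mulr_ge0 => //; exact: sqr_ge0.
have E00 : 0 <= E0 by apply: addr_ge0 (mulr_ge0 _ B0) (mulr_ge0 b4 (sqr_ge0 _)).
have a0 : 0 <= a by exact: mulr_ge0.
have g0 : 0 <= g.
  apply: addr_ge0; first exact: mulr_ge0.
  apply: mulr_ge0 (mulr_ge0 _ (sqr_ge0 _)) _ => //.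
  by apply: mulr_ge0; exact: exprn_ge0.
have M0 : 0 < M.
  apply: ltr_pwDl => //; apply: mulr_ge0 b4 _.
  by apply: addr_ge0; apply: mulr_ge0 => //; apply: mulr_ge0 (sqr_ge0 _) _.
have M2 : 0 < 2 * M by rewrite mulr_gt0.
(* The bounds on squared norms become bounds on norms through [1 + a] and [1 + g], which also stay
   positive when [rho] is 0. *)
have sqr1D (c : R) : 0 <= c -> c <= (1 + c) ^+ 2.
  by move=> c0; have := sqr_ge0 c; move: c c0 => c c0 h; nra.
(* The cap 1 is required by the quartic expansion, and [(2 * M)^-1] gives [t * M <= 1 / 2] for every
   admissible step [t]. *)
exists (1 + a), (1 + g), (Num.min 1 (2 * M)^-1); split.
- exact: ltr_pwDl.
- exact: ltr_pwDl.
- by rewrite lt_min ltr01 invr_gt0.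
- by rewrite ge_min lexx.
move=> u0 [u0H u0n] u0rho alpha amin amax amin0 alphaP amaxC u uu0 uS.
(* Energy at most [E0] is the invariant: it implies all the bounds for one step, and the step does
   not increase the energy. *)
have step v t : H01 D v -> cip D v v = 1 -> energy D V beta Om v <= E0 ->
    0 <= t -> t <= Num.min 1 (2 * M)^-1 ->
    [/\ Aform D V Om v v <= a,
      Aform D V Om (sobolev_grad D V beta Om v) (sobolev_grad D V beta Om v) <= g &
      [/\ H01 D (a0_step D V beta Om t v),
        cip D (a0_step D V beta Om t v) (a0_step D V beta Om t v) = 1 &
        t / 2 * Aform D V Om (riemannian_grad D V beta Om v) (riemannian_grad D V beta Om v) <=
          energy D V beta Om v - energy D V beta Om (a0_step D V beta Om t v)]].
  move=> v0 v1 vE t0; rewrite le_min => /andP[t1 tM].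
  have va : Aform D V Om v v <= a.
    apply: le_trans (Aform_le_energy oD DL hd mV V0 VM Om hbeta v0) _.
    by rewrite ler_pM2l.
  have A0 := Aform_ge0 oD DL mV V0 VM K0 trap (H01_H1 v0).
  have vg : Aform D V Om (sobolev_grad D V beta Om v) (sobolev_grad D V beta Om v) <= g.
    apply: le_trans (sobolev_grad_le oD L0 DL hd mV V0 VM beta K0 trap v0) _.
    apply: lerD; first by rewrite ler_pM2l.
    apply: ler_wpM2l; first by apply: mulr_ge0 => //; exact: sqr_ge0.
    apply: ler_wpM2l; first exact: exprn_ge0.
    by rewrite lerXn2r ?nnegrE.
  have tM2 : t * M <= 1 / 2.
    by have := ler_wpM2r (ltW M0) tM; rewrite invfM -mulrA mulVf ?gt_eqF// mulr1 div1r.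
  split; [exact: va|exact: vg|].
  exact: (descent_step oD L0 DL hd mV V0 VM K0 trap hbeta v0 v1 t0 t1 va vg tM2).
have u0E : energy D V beta Om u0 <= E0.
  apply: (energy_le oD L0 DL hd mV V0 VM K0 trap hbeta u0H).
  rewrite /B -u0rho (gradnorm_sqr oD (H01_H1 u0H)).
  exact: (Aform_bounded oD L0 DL mV V0 VM K0 trap u0H).
have alpha0 k : 0 <= alpha k.
  by have /andP[h _] := alphaP k; apply: le_trans h; exact: ltW.
have alphaC k : alpha k <= Num.min 1 (2 * M)^-1.
  by have /andP[_ h] := alphaP k; exact: le_trans h amaxC.
have A0 v : H01 D v -> 0 <= Aform D V Om v v.
  by move=> vH; exact: (Aform_ge0 oD DL mV V0 VM K0 trap (H01_H1 vH)).
have inv k : [/\ H01 D (u k), cip D (u k) (u k) = 1 & energy D V beta Om (u k) <= E0].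
  elim: k => [|k [kH k1 kE]].
    rewrite uu0; split => //.
    by rewrite -(L2norm_sqr mD (H1_L2 (H01_H1 u0H))) u0n expr1n.
  have [_ _ [sH s1 sE]] := step _ _ kH k1 kE (alpha0 k) (alphaC k).
  have [pH _ _ _] := riemannian_gradP oD L0 DL hd mV V0 VM beta K0 trap kH k1.
  have h0 := le_trans (mulr_ge0 (divr_ge0 (alpha0 k) (ler0n _ 2)) (A0 _ pH)) sE.
  rewrite uS; split; [exact: sH|exact: s1|].
  by rewrite subr_ge0 in h0; exact: le_trans h0 kE.
move=> k; have [kH k1 kE] := inv k.
have [ka kg [_ _ kE']] := step _ _ kH k1 kE (alpha0 k) (alphaC k).
have [pH _ psA _] := riemannian_gradP oD L0 DL hd mV V0 VM beta K0 trap kH k1.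
have [sH _] := sobolev_gradP oD L0 DL hd mV V0 VM beta K0 trap kH.
have norm_sqr v := @a0norm_sqr R n D L oD DL V MV mV V0 VM Om K K0 trap v.
have norm_le v c := @a0norm_le R n D L oD DL V MV mV V0 VM Om K K0 trap v c.
split.
- by apply: norm_le => //; [rewrite addr_ge0|exact: le_trans ka (sqr1D _ a0)].
- by apply: norm_le => //; [exact: a0norm_ge0|rewrite norm_sqr].
- by apply: norm_le => //; [rewrite addr_ge0|exact: le_trans kg (sqr1D _ g0)].
- rewrite (norm_sqr _ pH) uS; apply: le_trans _ kE'; apply: ler_wpM2r (A0 _ pH) _ _ _.
  by rewrite ler_pM2r//; have /andP[] := alphaP k.
Qed.
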